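(* Let $p\in(0,\sqrt{3}-1]$. For $f\in Co(p)$ write $f(z)=\sum_{n=-1}^{\infty}a_n(f)(z-p)^n$ for $0<|z-p|<1-p$. Then the domain of variability $\{a_0(f): f\in Co(p)\}$ of $a_0(f)$ is determined by the inequality $$\left|\frac{1-p^2}{p}\,a_0(f)+\frac{1-p^2+p^4}{1-p^4}\right|\ \leq\ \frac{p^2(2-p^2)}{1-p^4},$$ that is, it is exactly the set of all $w\in\mathbb{C}$ that satisfy this inequality with $w$ in place of $a_0(f)$. Moreover, for $f\in Co(p)$, equality is attained in this inequality if and only if there is some $\theta\in[0,2\pi]$ such that $$f(z)=\frac{z-\frac{p}{1+p^2}\left(1+e^{i\theta}\right)z^2}{\left(1-\frac{z}{p}\right)(1-zp)},\qquad z\in\mathbb{D}.$$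
   Context: $\mathbb{D}=\{z\in\mathbb{C}:|z|<1\}$ is the open unit disc and $\overline{\mathbb{C}}$ is the Riemann sphere. For $p\in(0,1)$, $Co(p)$ denotes the family of functions $f:\mathbb{D}\to\overline{\mathbb{C}}$ such that: (i) $f$ is meromorphic in $\mathbb{D}$ and has a simple pole at the point $p$; (ii) $f(0)=f'(0)-1=0$; (iii) $f$ maps $\mathbb{D}$ conformally (in particular injectively) onto a set whose complement with respect to $\overline{\mathbb{C}}$ is convex. For $f\in Co(p)$, the numbers $a_n(f)$, $n\geq -1$, are the Laurent coefficients of $f$ at the point $p$. *)

(* Defs.v *)
From Stdlib Require Export Reals ZArith.
From Stdlib Require Import ClassicalEpsilon.
From Coquelicot Require Export Coquelicot.

Open Scope R_scope.

(** The Riemann sphere [C] with a point at infinity added. *)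
Inductive Csphere : Set :=
| Fin (z : C)
| Inf.

(** Junk value [0] at infinity. *)
Definition finite_part (w : Csphere) : C :=
  match w with Fin z => z | Inf => RtoC 0 end.

(** Quotient with values in the sphere; only meaningful when [u] and [v] do not
    both vanish. *)
Definition sphere_div (u v : C) : Csphere :=
  if Ceq_dec v (RtoC 0) then Inf else Fin (u / v)%C.

Definition unit_disc (z : C) : Prop := Cmod z < 1.

(** Functions on the unit disc are represented by total functions on [C]; their
    values outside the disc are never used. *)

(** [f] is finite near [z] and complex differentiable at [z], with [f'(z) = l]. *)
Definition is_sphere_derive (f : C -> Csphere) (z l : C) : Prop :=
  locally z (fun y => f y <> Inf) /\
  is_derive (fun y => finite_part (f y)) z l.

Definition holomorphic_at (f : C -> Csphere) (z : C) : Prop :=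
  locally z (fun y => exists l : C, is_sphere_derive f y l).

(** Near [z], [f(y) = g(y) / (y - z)^k] with [g] holomorphic and [g(z) <> 0]. *)
Definition pole_at (f : C -> Csphere) (k : nat) (z : C) : Prop :=
  f z = Inf /\
  exists g : C -> C,
    locally z (fun y => ex_derive g y) /\
    g z <> RtoC 0 /\
    locally' z (fun y => f y = Fin (g y / (y - z) ^ k)%C).

Definition meromorphic_on (D : C -> Prop) (f : C -> Csphere) : Prop :=
  forall z : C, D z ->
    holomorphic_at f z \/ exists k : nat, (1 <= k)%nat /\ pole_at f k z.

(** At a pole, conformality of a map into the sphere means that the pole is
    simple, i.e. that [1/f] has a nonzero derivative there. *)
Definition conformal_on (D : C -> Prop) (f : C -> Csphere) : Prop :=
  (forall z1 z2 : C, D z1 -> D z2 -> f z1 = f z2 -> z1 = z2) /\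
  (forall z : C, D z ->
     (exists l : C, l <> RtoC 0 /\ is_sphere_derive f z l) \/ pole_at f 1 z).

Definition image_of (D : C -> Prop) (f : C -> Csphere) (w : Csphere) : Prop :=
  exists z : C, D z /\ f z = w.

Definition convex_set (K : C -> Prop) : Prop :=
  forall (x y : C) (t : R),
    K x -> K y -> 0 <= t <= 1 -> K (RtoC t * x + RtoC (1 - t) * y)%C.

(** A subset of the sphere is convex if it is a convex subset of the plane. *)
Definition sphere_convex (K : Csphere -> Prop) : Prop :=
  ~ K Inf /\ convex_set (fun z => K (Fin z)).

(** The class of concave univalent functions with a simple pole at [p]. *)
Record Co (p : R) (f : C -> Csphere) : Prop := {
  Co_meromorphic : meromorphic_on unit_disc f;
  Co_pole : pole_at f 1 (RtoC p);
  Co_zero : f (RtoC 0) = Fin (RtoC 0);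
  Co_derive : is_sphere_derive f (RtoC 0) (RtoC 1);
  Co_conformal : conformal_on unit_disc f;
  Co_concave : sphere_convex (fun w => ~ image_of unit_disc f w) }.

(** [f(z) = sum_{n >= -1} a_n (z - c)^n] for [0 < |z - c| < r]. The [k]-th term
    of the series below is the one of exponent [n = k - 1]; setting the other
    coefficients to [0] makes [a] unique. *)
Definition is_laurent (f : C -> Csphere) (c : C) (r : R) (a : Z -> C) : Prop :=
  (forall n : Z, (n < -1)%Z -> a n = RtoC 0) /\
  forall z : C, 0 < Cmod (z - c)%C < r ->
    exists v : C, f z = Fin v /\
      is_series
        (fun k : nat => (a (Z.of_nat k - 1)%Z * ((z - c) ^ k / (z - c)))%C) v.

(** The Laurent coefficients at [p] of a function on the unit disc. *)
Definition laurent_coef (p : R) (f : C -> Csphere) : Z -> C :=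
  epsilon (inhabits (fun _ : Z => RtoC 0)) (is_laurent f (RtoC p) (1 - p)).

(** [exp (i * theta)] *)
Definition Cexp_i (theta : R) : C := (cos theta, sin theta).

Definition extremal_function (p theta : R) (z : C) : Csphere :=
  sphere_div
    (z - RtoC (p / (1 + p ^ 2)) * (1 + Cexp_i theta) * z ^ 2)%C
    ((1 - z / RtoC p) * (1 - z * RtoC p))%C.

(* Main.v *)
Require Import Defs.
From Stdlib Require Import Lra Lia Classical ClassicalEpsilon.

(** The idea is to write every function of the class in the form
    [f z = (z - c (1 + om z) z^2) / ((1 - z / p) (1 - z p))], [c = p / (1 + p^2)],
    and to show that [om] maps the disc into the closed unit disc. The coefficient
    [a_0] depends only on [om p] and [om' p]: in the coordinate [w] of the disc in
    which [p] becomes the origin, with [W w = om z], the expression to be estimated is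
    [(p^2 (2 - p^2) W 0 + p^3 W' 0) / (1 - p^4)] ([laurent_om]). The Schwarz-Pick
    lemma gives [|W' 0| <= 1 - |W 0|^2]. For [p <= sqrt 3 - 1], that is
    [2 p <= 2 - p^2], the resulting bound [(2 - p^2) x + p (1 - x^2)], [x = |W 0|],
    increases up to [x = 1] ([variability_bound]), where [W] is a unimodular constant
    ([schwarz_pick_constant]). Conversely every constant [om] of modulus at most one
    occurs ([om_constant_Co]), and as [W' = 0] then, these functions give all points
    of the disc and, for unimodular constants, the points of the circle.

    Why [|om| <= 1]. In the coordinate [w] let [F] be [f], with a simple pole at the
    origin and omitting a convex set. The images of the punctured discs [|w| < r] also
    have convex complements. Indeed, let [q w] be the preimage of
    [t F w + (1 - t) F (b w)] with [|b| = 1], wherever that point is not omitted; the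
    quotient [w / q w] is holomorphic, and at the boundary of its domain of definition
    its modulus does not exceed one, because there [w] tends to the origin, where [F]
    is like a multiple of [1 / w], or [q w] tends to the unit circle. So [|w| <= |q w|]
    ([level_convex]). In the limit [t -> 1] this says that
    [Re (z F' z / (F z - F w)) <= 0] if [|z| = |w|] ([level_support]), hence that
    [T z w = 2 z F' z / (F z - F w) - (z + w) / (z - w)] has nonpositive real part for
    such points, the last quotient being imaginary. As [T] has no poles on the diagonal,
    the maximum principle extends this to all pairs of points ([two_point_re]). As [T]
    is [-1] when either variable is the origin, the Schwarz lemma in each variable
    sharpens it to [|(T + 1) / (T - 1)| <= |z| |w|] ([two_point_schwarz]). Finally
    [z = - p] corresponds to the origin of the original disc, where [f] and [f'] are
    [0] and [1]; so the inequality becomes one for [f w] alone, which is [|om| <= 1]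
    ([om_disc_bound]).

    For constant [om] the function is [1 / w + gam w] in the coordinate [w], up to an
    affine map, with [|gam| <= 1]. The values it omits are those of
    [t |-> Cconj t + gam t] on the closed disc, and form a convex set since this map is
    real-linear ([joukowski_omitted]).

    The function theory rests on Goursat's lemma ([rect_int_zero]). In the coordinate
    [log (z - c)] it shows that the mean of a holomorphic function over a circle does
    not depend on the radius, whence the mean value property, the maximum principle,
    Cauchy's formula and Taylor series. *)


(** * Complex differentiability *)

Ltac rmin2 a b := let h1 := fresh "Hmin" in pose proof a as h1;
  let h2 := fresh "Hmin" in pose proof b as h2.

(** Adds the defining inequalities of the minima and maxima in sight. *)
Ltac rmin := repeat match goal with
  | H : context [Rmin ?a ?b] |- _ => lazymatch goal with
      | _ : Rmin a b <= a |- _ => fail | _ => rmin2 (Rmin_l a b) (Rmin_r a b) end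
  | |- context [Rmin ?a ?b] => lazymatch goal with
      | _ : Rmin a b <= a |- _ => fail | _ => rmin2 (Rmin_l a b) (Rmin_r a b) end
  | H : context [Rmax ?a ?b] |- _ => lazymatch goal with
      | _ : a <= Rmax a b |- _ => fail | _ => rmin2 (Rmax_l a b) (Rmax_r a b) end
  | |- context [Rmax ?a ?b] => lazymatch goal with
      | _ : a <= Rmax a b |- _ => fail | _ => rmin2 (Rmax_l a b) (Rmax_r a b) end
  end.

Lemma Cmod_sub_sym : forall a b : C, Cmod (a - b)%C = Cmod (b - a)%C.
Proof. intros a b. rewrite <- Cmod_opp. f_equal. ring. Qed.

Lemma Cmod_sub_triangle : forall a b : C, Cmod (a - b)%C <= Cmod a + Cmod b.
Proof.
  intros a b. unfold Cminus. rewrite <- (Cmod_opp b). apply Cmod_triangle.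
Qed.

Lemma Cmod_rev_triangle : forall a b : C, Cmod a - Cmod b <= Cmod (a - b)%C.
Proof.
  intros a b. assert (H := Cmod_triangle (a - b) b).
  replace (a - b + b)%C with a in H by ring. lra.
Qed.

Lemma Csub_0_r : forall z : C, (z - 0)%C = z.
Proof. intros z. ring. Qed.

Lemma Cmod_sub_diag : forall z : C, Cmod (z - z)%C = 0.
Proof. intros z. replace (z - z)%C with (RtoC 0) by ring. apply Cmod_0. Qed.

Lemma Cmod_zero_eq : forall a b : C, Cmod (a - b)%C = 0 -> a = b.
Proof. intros a b H. apply Ceq_minus. now apply Cmod_eq_0. Qed.

Lemma Cmod_sub_pos : forall a b : C, a <> b -> 0 < Cmod (a - b)%C.
Proof. intros a b H. apply Cmod_gt_0. now apply Cminus_eq_contra. Qed.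

Lemma Cmod_fst : forall z : C, Rabs (fst z) <= Cmod z.
Proof. intros z. apply Rle_trans with (2 := Rmax_Cmod z). apply Rmax_l. Qed.

Lemma Cmod_snd : forall z : C, Rabs (snd z) <= Cmod z.
Proof. intros z. apply Rle_trans with (2 := Rmax_Cmod z). apply Rmax_r. Qed.

Lemma Cmod_le_sum : forall z : C, Cmod z <= Rabs (fst z) + Rabs (snd z).
Proof.
  intros [x y]. unfold Cmod; simpl.
  rewrite <- (sqrt_Rsqr (Rabs x + Rabs y)).
  2:{ assert (H1 := Rabs_pos x); assert (H2 := Rabs_pos y); lra. }
  apply sqrt_le_1_alt. unfold Rsqr.
  assert (H1 := Rabs_pos x); assert (H2 := Rabs_pos y).
  assert (Hx : Rabs x * Rabs x = x * x) by (rewrite <- Rabs_mult; apply Rabs_pos_eq; nra).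
  assert (Hy : Rabs y * Rabs y = y * y) by (rewrite <- Rabs_mult; apply Rabs_pos_eq; nra).
  nra.
Qed.

Lemma Cmod_sqr : forall z : C, Cmod z * Cmod z = fst z * fst z + snd z * snd z.
Proof.
  intros z. unfold Cmod. rewrite sqrt_sqrt; [ring|].
  assert (H1 := pow2_ge_0 (fst z)); assert (H2 := pow2_ge_0 (snd z)); lra.
Qed.

Lemma locally_Cmod : forall (z : C) (P : C -> Prop),
  locally z P <-> exists d, 0 < d /\ forall y : C, Cmod (y - z)%C < d -> P y.
Proof.
  intros z P. split.
  - intros [e He]. exists e. split; [apply cond_pos|]. intros y Hy. apply He.
    split; [ apply Rle_lt_trans with (2 := Hy); apply (Cmod_fst (y - z))
           | apply Rle_lt_trans with (2 := Hy); apply (Cmod_snd (y - z)) ].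
  - intros [d [Hd H]]. assert (Hd2 : 0 < d / 2) by lra.
    exists (mkposreal _ Hd2). intros y [H1 H2]. apply H.
    apply Rle_lt_trans with (1 := Cmod_le_sum _).
    change (Rabs (fst y - fst z) < d / 2) in H1.
    change (Rabs (snd y - snd z) < d / 2) in H2.
    change (Rabs (fst y - fst z) + Rabs (snd y - snd z) < d). lra.
Qed.

Lemma locally'_Cmod : forall (z : C) (P : C -> Prop),
  locally' z P <->
  exists d, 0 < d /\ forall y : C, 0 < Cmod (y - z)%C < d -> P y.
Proof.
  intros z P. unfold locally', within. rewrite (locally_Cmod z). split.
  - intros [d [Hd H]]. exists d. split; [exact Hd|]. intros y [H1 H2].
    apply H; [exact H2|]. intros E. rewrite E in H1.
    replace (z - z)%C with (RtoC 0) in H1 by ring. rewrite Cmod_0 in H1. lra.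
  - intros [d [Hd H]]. exists d. split; [exact Hd|]. intros y H1 H2.
    apply H. split; [|exact H1]. now apply Cmod_sub_pos.
Qed.

Lemma is_derive_C : forall (f : C -> C) (z l : C),
  is_derive f z l <->
  forall eps, 0 < eps -> exists d, 0 < d /\ forall y : C, Cmod (y - z)%C < d ->
    Cmod (f y - f z - l * (y - z))%C <= eps * Cmod (y - z)%C.
Proof.
  intros f z l. split.
  - intros [_ H] eps He. specialize (H z (fun P HP => HP) (mkposreal eps He)).
    apply locally_C in H.
    destruct (proj1 (locally_Cmod z _) H) as [d [Hd Hl]].
    exists d. split; [exact Hd|]. intros y Hy. specialize (Hl y Hy). 
    change (Cmod (f y - f z - (y - z) * l)%C <= eps * Cmod (y - z)%C) in Hl.
    replace (f y - f z - l * (y - z))%C with (f y - f z - (y - z) * l)%C by ring.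
    exact Hl.
  - intros H. split.
    + apply is_linear_scal_l.
    + intros z' Hz' eps.
      apply (is_filter_lim_locally_unique (K := C_AbsRing) (V := AbsRing_NormedModule C_AbsRing)) in Hz'. subst z'.
      destruct (H eps (cond_pos eps)) as [d [Hd Hl]].
      apply locally_C. apply locally_Cmod. exists d. split; [exact Hd|].
      intros y Hy. specialize (Hl y Hy).
      change (Cmod (f y - f z - (y - z) * l)%C <= eps * Cmod (y - z)%C).
      replace (f y - f z - l * (y - z))%C with (f y - f z - (y - z) * l)%C in Hl by ring.
      exact Hl.
Qed.

(** [P] holds in a disc around [z]. The modulus is more convenient here than the
    product uniform structure carried by [C]. *)
Definition near (z : C) (P : C -> Prop) : Prop :=
  exists d, 0 < d /\ forall y : C, Cmod (y - z)%C < d -> P y.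

Lemma near_and : forall z P Q, near z P -> near z Q -> near z (fun y => P y /\ Q y).
Proof.
  intros z P Q [d1 [Hd1 H1]] [d2 [Hd2 H2]]. exists (Rmin d1 d2).
  split; [now apply Rmin_pos|]. intros y Hy.
  split; [apply H1 | apply H2]; apply Rlt_le_trans with (1 := Hy); [apply Rmin_l | apply Rmin_r].
Qed.

Arguments near_and {z P Q}.

Lemma near_mono : forall z (P Q : C -> Prop), near z P -> (forall y, P y -> Q y) -> near z Q.
Proof. intros z P Q [d [Hd H]] HPQ. exists d. auto. Qed.

Lemma near_center : forall z P, near z P -> P z.
Proof. intros z P [d [Hd H]]. apply H. now rewrite Cmod_sub_diag. Qed.

Lemma near_disc : forall z d, 0 < d -> near z (fun y => Cmod (y - z)%C < d).
Proof. intros z d Hd. exists d. auto. Qed.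

Lemma near_neq : forall z a : C, z <> a -> near z (fun y => y <> a).
Proof.
  intros z a H. exists (Cmod (z - a)%C). split; [now apply Cmod_sub_pos|].
  intros y Hy ->. rewrite Cmod_sub_sym in Hy. lra.
Qed.

Lemma near_ball : forall z c r, Cmod (z - c)%C < r -> near z (fun y => Cmod (y - c)%C < r).
Proof.
  intros z c r H. exists (r - Cmod (z - c)%C). split; [lra|]. intros y Hy.
  assert (T := Cmod_triangle (y - z) (z - c)).
  replace (y - z + (z - c))%C with (y - c)%C in T by ring. lra.
Qed.

Lemma near_lt : forall z r, Cmod z < r -> near z (fun y => Cmod y < r).
Proof.
  intros z r H. exists (r - Cmod z). split; [lra|]. intros y Hy.
  assert (T := Cmod_rev_triangle y z). lra.
Qed.

Lemma near_punctured : forall z P, near z P -> exists y, y <> z /\ P y.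
Proof.
  intros z P [d [Hd H]]. exists (z + RtoC (d / 2))%C.
  assert (E : Cmod (z + RtoC (d / 2) - z)%C = d / 2).
  { replace (z + RtoC (d / 2) - z)%C with (RtoC (d / 2)) by ring.
    rewrite Cmod_R. apply Rabs_pos_eq. lra. }
  split; [|apply H; lra]. intros Ez. rewrite Ez, Cmod_sub_diag in E. lra.
Qed.

Lemma locally_near : forall z P, near z P -> locally z P.
Proof. intros z P. apply locally_Cmod. Qed.

Definition Ccont (f : C -> C) (z : C) : Prop :=
  forall eps, 0 < eps -> near z (fun y => Cmod (f y - f z)%C < eps).

Lemma Ccont_const : forall (a z : C), Ccont (fun _ => a) z.
Proof.
  intros a z eps He. exists 1. split; [lra|]. intros y _. now rewrite Cmod_sub_diag.
Qed.

Lemma Ccont_id : forall z, Ccont (fun y => y) z.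
Proof. intros z eps He. now apply near_disc. Qed.

Lemma Ccont_bounded : forall f z, Ccont f z -> near z (fun y => Cmod (f y) <= Cmod (f z) + 1).
Proof.
  intros f z H. apply near_mono with (1 := H 1 Rlt_0_1). intros y Hy.
  assert (T := Cmod_rev_triangle (f y) (f z)). lra.
Qed.

Lemma Ccont_plus : forall f g z, Ccont f z -> Ccont g z ->
  Ccont (fun y => f y + g y)%C z.
Proof.
  intros f g z Hf Hg eps He.
  eapply near_mono; [apply (near_and (Hf (eps / 2) ltac:(lra)) (Hg (eps / 2) ltac:(lra)))|].
  intros y [H1 H2]. cbv beta.
  replace (f y + g y - (f z + g z))%C with ((f y - f z) + (g y - g z))%C by ring.
  apply Rle_lt_trans with (1 := Cmod_triangle _ _). lra.
Qed.

Lemma Ccont_mult : forall f g z, Ccont f z -> Ccont g z ->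
  Ccont (fun y => f y * g y)%C z.
Proof.
  intros f g z Hf Hg eps He.
  set (A := Cmod (g z) + 1). set (B := Cmod (f z) + 1).
  assert (HA : 0 < A) by (unfold A; assert (H := Cmod_ge_0 (g z)); lra).
  assert (HB : 0 < B) by (unfold B; assert (H := Cmod_ge_0 (f z)); lra).
  eapply near_mono.
  { exact (near_and (Ccont_bounded g z Hg)
      (near_and (Hf (eps / (2 * A)) ltac:(apply Rdiv_lt_0_compat; lra))
                (Hg (eps / (2 * B)) ltac:(apply Rdiv_lt_0_compat; lra)))). }
  intros y [H0 [H1 H2]]. cbv beta. fold A in H0.
  replace (f y * g y - f z * g z)%C with ((f y - f z) * g y + f z * (g y - g z))%C by ring.
  apply Rle_lt_trans with (1 := Cmod_triangle _ _). rewrite !Cmod_mult.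
  replace eps with (eps / (2 * A) * A + B * (eps / (2 * B))) by (field; lra).
  assert (P := Cmod_ge_0 (f y - f z)%C). assert (Q := Cmod_ge_0 (g y - g z)%C).
  apply Rle_lt_trans with (Cmod (f y - f z)%C * A + B * Cmod (g y - g z)%C);
    unfold B in *; nra.
Qed.

Lemma Ccont_opp : forall f z, Ccont f z -> Ccont (fun y => - f y)%C z.
Proof.
  intros f z Hf eps He. apply near_mono with (1 := Hf eps He). intros y Hy.
  now replace (- f y - - f z)%C with (- (f y - f z))%C by ring; rewrite Cmod_opp.
Qed.

Lemma Ccont_minus : forall f g z, Ccont f z -> Ccont g z ->
  Ccont (fun y => f y - g y)%C z.
Proof. intros f g z Hf Hg. apply Ccont_plus; [exact Hf | now apply Ccont_opp]. Qed.

Lemma Ccont_away : forall f z a, Ccont f z -> f z <> a ->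
  near z (fun y => Cmod (f z - a)%C / 2 < Cmod (f y - a)%C).
Proof.
  intros f z a Hf Hz. assert (Hp := Cmod_sub_pos _ _ Hz).
  apply near_mono with (1 := Hf (Cmod (f z - a)%C / 2) ltac:(lra)). intros y Hy.
  assert (H1 := Cmod_triangle (f z - f y) (f y - a)).
  replace (f z - f y + (f y - a))%C with (f z - a)%C in H1 by ring.
  rewrite (Cmod_sub_sym (f z) (f y)) in H1. lra.
Qed.

Lemma Ccont_neq : forall f z a, Ccont f z -> f z <> a -> near z (fun y => f y <> a).
Proof.
  intros f z a Hf Hz. apply near_mono with (1 := Ccont_away f z a Hf Hz). intros y Hy E.
  rewrite E, Cmod_sub_diag in Hy. assert (P := Cmod_ge_0 (f z - a)%C). lra.
Qed.

Lemma Ccont_inv : forall f z, Ccont f z -> f z <> 0 -> Ccont (fun y => / f y)%C z.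
Proof.
  intros f z Hf Hz eps He.
  assert (Hp : 0 < Cmod (f z)) by now apply Cmod_gt_0.
  set (m := Cmod (f z)) in *.
  eapply near_mono; [apply (near_and (Ccont_away f z 0 Hf Hz)
    (Hf (eps * (m * m / 2)) ltac:(apply Rmult_lt_0_compat; nra)))|].
  intros y [H1 H2]. cbv beta in *. rewrite !Csub_0_r in H1. fold m in H1.
  assert (Hy0 : f y <> 0) by (apply Cmod_gt_0; lra).
  replace (/ f y - / f z)%C with ((f z - f y) / (f y * f z))%C by (field; auto).
  rewrite Cmod_div by now apply Cmult_neq_0.
  rewrite Cmod_mult, Cmod_sub_sym. fold m.
  apply Rlt_div_l; [nra|].
  apply Rlt_le_trans with (1 := H2). apply Rmult_le_compat_l; [lra|]. nra.
Qed.

Lemma Ccont_comp : forall f g z, Ccont g z -> Ccont f (g z) ->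
  Ccont (fun y => f (g y)) z.
Proof.
  intros f g z Hg Hf eps He. destruct (Hf eps He) as [d [Hd H]].
  apply near_mono with (1 := Hg d Hd). auto.
Qed.

Lemma Ccont_ext_loc : forall f g z, near z (fun y => f y = g y) ->
  Ccont f z -> Ccont g z.
Proof.
  intros f g z E H eps He. rewrite <- (near_center z (fun y => f y = g y) E).
  apply near_mono with (1 := near_and E (H eps He)). now intros y [<- Hy].
Qed.

(** Carries an estimate to a point where the formulas behind it are singular. *)
Lemma Ccont_le_punctured : forall f g z, Ccont f z -> Ccont g z ->
  near z (fun y => y <> z -> Cmod (f y) <= Cmod (g y)) -> Cmod (f z) <= Cmod (g z).
Proof.
  intros f g z Hf Hg H. apply Rnot_lt_le. intros L.
  destruct (near_punctured z _ (near_and H (near_and (Hf ((Cmod (f z) - Cmod (g z)) / 2) ltac:(lra))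
    (Hg ((Cmod (f z) - Cmod (g z)) / 2) ltac:(lra))))) as [y [Ny [H1 [H2 H3]]]].
  specialize (H1 Ny). assert (T1 := Cmod_rev_triangle (f z) (f y)).
  assert (T2 := Cmod_rev_triangle (g y) (g z)). rewrite Cmod_sub_sym in T1. lra.
Qed.

(** Carathéodory's form of the derivative turns each rule of differentiation
    into an identity plus the corresponding rule of continuity. *)
Lemma is_derive_slope : forall (f : C -> C) (z l : C),
  is_derive f z l <->
  exists k : C -> C, Ccont k z /\ k z = l /\
    forall y, f y = (f z + k y * (y - z))%C.
Proof.
  intros f z l. rewrite is_derive_C. split.
  - intros H.
    exists (fun y => if Ceq_dec y z then l else ((f y - f z) / (y - z))%C).
    split; [|split].
    + intros eps He. destruct (H (eps / 2) ltac:(lra)) as [d [Hd H1]]. exists d.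
      split; [exact Hd|]. intros y Hy. destruct (Ceq_dec z z) as [_|N]; [|easy].
      destruct (Ceq_dec y z) as [E|N].
      * now rewrite Cmod_sub_diag.
      * assert (N' : (y - z)%C <> 0) by now apply Cminus_eq_contra.
        assert (Hp := Cmod_sub_pos _ _ N). specialize (H1 y Hy).
        replace ((f y - f z) / (y - z) - l)%C with
          ((f y - f z - l * (y - z)) / (y - z))%C by (field; exact N').
        rewrite Cmod_div by exact N'.
        apply (Rmult_lt_reg_r (Cmod (y - z)%C)); [exact Hp|].
        unfold Rdiv. rewrite Rmult_assoc, Rinv_l, Rmult_1_r by lra.
        apply Rle_lt_trans with (1 := H1). apply Rmult_lt_compat_r; lra.
    + destruct (Ceq_dec z z); easy.
    + intros y. destruct (Ceq_dec y z) as [->|N]; [ring|]. field.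
      now apply Cminus_eq_contra.
  - intros [k [Hk [E H]]] eps He. destruct (Hk eps He) as [d [Hd H1]].
    exists d. split; [exact Hd|]. intros y Hy. rewrite (H y). rewrite <- E.
    replace (f z + k y * (y - z) - f z - k z * (y - z))%C
      with ((k y - k z) * (y - z))%C by ring.
    rewrite Cmod_mult. apply Rmult_le_compat_r; [apply Cmod_ge_0|].
    left. auto.
Qed.

Lemma is_derive_Ccont : forall (f : C -> C) (z l : C), is_derive f z l -> Ccont f z.
Proof.
  intros f z l H. apply is_derive_slope in H. destruct H as [k [Hk [_ H]]].
  apply Ccont_ext_loc with (f := fun y => (f z + k y * (y - z))%C).
  - exists 1. split; [lra|]. intros y _. now rewrite (H y).
  - apply Ccont_plus; [apply Ccont_const|]. apply Ccont_mult; [exact Hk|].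
    apply Ccont_minus; [apply Ccont_id | apply Ccont_const].
Qed.

Lemma Cderive_const : forall a z : C, is_derive (fun _ : C => a) z (RtoC 0).
Proof. intros a z. exact (is_derive_const (V := C_NormedModule) a z). Qed.

Lemma Cderive_id : forall z : C, is_derive (fun y : C => y) z (RtoC 1).
Proof.
  intros z. apply is_derive_slope. exists (fun _ => RtoC 1).
  split; [apply Ccont_const|]. split; [reflexivity|]. intros y. ring.
Qed.

Lemma Cderive_eq : forall (f : C -> C) (z l m : C),
  is_derive f z l -> l = m -> is_derive f z m.
Proof. intros f z l m H <-. exact H. Qed.

Lemma Cderive_plus : forall (f g : C -> C) (z l m : C),
  is_derive f z l -> is_derive g z m -> is_derive (fun y => f y + g y)%C z (l + m)%C.
Proof. exact (is_derive_plus (V := C_NormedModule)). Qed.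

Lemma Cderive_mult : forall (f g : C -> C) (z l m : C),
  is_derive f z l -> is_derive g z m ->
  is_derive (fun y => f y * g y)%C z (l * g z + f z * m)%C.
Proof.
  intros f g z l m Hf Hg. assert (Cg := is_derive_Ccont _ _ _ Hg).
  apply is_derive_slope in Hf, Hg. apply is_derive_slope.
  destruct Hf as [k [Hk [<- Hf]]], Hg as [h [Hh [<- Hg]]].
  exists (fun y => k y * g y + f z * h y)%C. split.
  { apply Ccont_plus; apply Ccont_mult; auto. apply Ccont_const. }
  split; [reflexivity|]. intros y. rewrite (Hf y), (Hg y). ring.
Qed.

Lemma Cderive_opp : forall (f : C -> C) (z l : C),
  is_derive f z l -> is_derive (fun y => - f y)%C z (- l)%C.
Proof. exact (is_derive_opp (V := C_NormedModule)). Qed.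

Lemma Cderive_minus : forall (f g : C -> C) (z l m : C),
  is_derive f z l -> is_derive g z m -> is_derive (fun y => f y - g y)%C z (l - m)%C.
Proof. exact (is_derive_minus (V := C_NormedModule)). Qed.

Lemma Cderive_ext_loc : forall (f g : C -> C) (z l : C),
  near z (fun y => f y = g y) -> is_derive f z l -> is_derive g z l.
Proof.
  intros f g z l E H. apply is_derive_ext_loc with (f := f); [|exact H].
  now apply locally_C, locally_near.
Qed.

Lemma Cderive_inv : forall (f : C -> C) (z l : C),
  is_derive f z l -> f z <> 0 -> is_derive (fun y => / f y)%C z (- l / (f z * f z))%C.
Proof.
  intros f z l Hf Hz. assert (Cf := is_derive_Ccont _ _ _ Hf).
  apply is_derive_slope in Hf. destruct Hf as [k [Hk [<- Hf]]].
  apply Cderive_ext_loc with (f := fun y => (/ f z + - k y / (f y * f z) * (y - z))%C).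
  { apply near_mono with (1 := Ccont_neq f z 0 Cf Hz). intros y Ny.
    assert (E : (k y * (y - z) = f y - f z)%C) by (rewrite (Hf y); ring).
    transitivity (/ f z - (k y * (y - z)) / (f y * f z))%C; [field; auto|].
    rewrite E. field. auto. }
  apply is_derive_slope. exists (fun y => - k y / (f y * f z))%C. split.
  { apply Ccont_mult; [now apply Ccont_opp|]. apply Ccont_inv.
    - apply Ccont_mult; [exact Cf | apply Ccont_const].
    - now apply Cmult_neq_0. }
  split; [reflexivity|]. intros y. ring.
Qed.

Lemma Cderive_comp : forall (f g : C -> C) (z l m : C),
  is_derive g z m -> is_derive f (g z) l -> is_derive (fun y => f (g y)) z (l * m)%C.
Proof.
  intros f g z l m Hg Hf. assert (Cg := is_derive_Ccont _ _ _ Hg).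
  apply is_derive_slope in Hf, Hg. apply is_derive_slope.
  destruct Hf as [k [Hk [<- Hf]]], Hg as [h [Hh [<- Hg]]].
  exists (fun y => k (g y) * h y)%C. split.
  { apply Ccont_mult; [|exact Hh]. apply (Ccont_comp k g z Cg Hk). }
  split; [reflexivity|]. intros y. rewrite (Hf (g y)). rewrite (Hg y) at 2. ring.
Qed.

Lemma Cderive_unique : forall (f : C -> C) (z l m : C),
  is_derive f z l -> is_derive f z m -> l = m.
Proof.
  intros f z l m Hl Hm. apply is_C_derive_unique in Hl, Hm. congruence.
Qed.

Definition Cdiff (f : C -> C) (z : C) : Prop := exists l : C, is_derive f z l.

Lemma Cdiff_cont : forall f z, Cdiff f z -> Ccont f z.
Proof. intros f z [l H]. now apply is_derive_Ccont with l. Qed.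

Lemma Cdiff_const : forall a z, Cdiff (fun _ => a) z.
Proof. intros a z. eexists. apply Cderive_const. Qed.

Lemma Cdiff_id : forall z, Cdiff (fun y => y) z.
Proof. intros z. eexists. apply Cderive_id. Qed.

Lemma Cdiff_plus : forall f g z, Cdiff f z -> Cdiff g z -> Cdiff (fun y => f y + g y)%C z.
Proof. intros f g z [l Hl] [m Hm]. eexists. eapply Cderive_plus; eassumption. Qed.

Lemma Cdiff_minus : forall f g z, Cdiff f z -> Cdiff g z -> Cdiff (fun y => f y - g y)%C z.
Proof. intros f g z [l Hl] [m Hm]. eexists. eapply Cderive_minus; eassumption. Qed.

Lemma Cdiff_opp : forall f z, Cdiff f z -> Cdiff (fun y => - f y)%C z.
Proof. intros f z [l Hl]. eexists. eapply Cderive_opp; eassumption. Qed.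

Lemma Cdiff_mult : forall f g z, Cdiff f z -> Cdiff g z -> Cdiff (fun y => f y * g y)%C z.
Proof. intros f g z [l Hl] [m Hm]. eexists. eapply Cderive_mult; eassumption. Qed.

Lemma Cdiff_inv : forall f z, Cdiff f z -> f z <> 0 -> Cdiff (fun y => / f y)%C z.
Proof. intros f z [l Hl] Hz. eexists. eapply Cderive_inv; eassumption. Qed.

Lemma Cdiff_div : forall f g z, Cdiff f z -> Cdiff g z -> g z <> 0 ->
  Cdiff (fun y => f y / g y)%C z.
Proof. intros f g z Hf Hg Hz. apply Cdiff_mult; [exact Hf | now apply Cdiff_inv]. Qed.

Lemma Cdiff_comp : forall f g z, Cdiff g z -> Cdiff f (g z) -> Cdiff (fun y => f (g y)) z.
Proof. intros f g z [l Hl] [m Hm]. eexists. eapply Cderive_comp; eassumption. Qed.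

Lemma Cdiff_pow : forall f n z, Cdiff f z -> Cdiff (fun y => f y ^ n)%C z.
Proof.
  intros f n z H. induction n as [|n IH]; simpl; [apply Cdiff_const|].
  now apply Cdiff_mult.
Qed.

Lemma Cdiff_ext_loc : forall f g z,
  near z (fun y => f y = g y) -> Cdiff f z -> Cdiff g z.
Proof. intros f g z E [l H]. exists l. now apply Cderive_ext_loc with f. Qed.

Ltac cdiff_step := lazymatch goal with
  | |- Cdiff (fun y => y) _ => apply Cdiff_id
  | |- Cdiff (fun _ => ?a) _ => apply (Cdiff_const a)
  | |- Cdiff (fun y => Cplus (@?f y) (@?g y)) _ => apply (Cdiff_plus f g)
  | |- Cdiff (fun y => Cminus (@?f y) (@?g y)) _ => apply (Cdiff_minus f g)
  | |- Cdiff (fun y => Cmult (@?f y) (@?g y)) _ => apply (Cdiff_mult f g)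
  | |- Cdiff (fun y => Cdiv (@?f y) (@?g y)) _ => apply (Cdiff_div f g)
  | |- Cdiff (fun y => Copp (@?f y)) _ => apply (Cdiff_opp f)
  | |- Cdiff (fun y => Cinv (@?f y)) _ => apply (Cdiff_inv f)
  | |- Cdiff (fun y => Cpow (@?f y) ?n) _ => apply (Cdiff_pow f n)
  end.

(** The rules are selected by the head symbol, since unification alone would
    split a goal along any decomposition. *)
Ltac cdiff := repeat (cdiff_step; cbv beta).

Ltac cderive_step := lazymatch goal with
  | |- is_derive (fun y => y) _ _ => apply Cderive_id
  | |- is_derive (fun _ => ?a) _ _ => apply (Cderive_const a)
  | |- is_derive (fun y => Cplus (@?f y) (@?g y)) _ _ => apply (Cderive_plus f g)
  | |- is_derive (fun y => Cminus (@?f y) (@?g y)) _ _ => apply (Cderive_minus f g)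
  | |- is_derive (fun y => Cmult (@?f y) (@?g y)) _ _ => apply (Cderive_mult f g)
  | |- is_derive (fun y => Copp (@?f y)) _ _ => apply (Cderive_opp f)
  | |- is_derive (fun y => Cinv (@?f y)) _ _ => apply (Cderive_inv f)
  end.

(** Computes a derivative, to be used under [Cderive_eq]. *)
Ltac cderive := repeat (cderive_step; cbv beta).

(** * Compactness *)

Definition Cconv (u : nat -> C) (l : C) : Prop :=
  forall eps, 0 < eps -> exists N, forall n, (N <= n)%nat -> Cmod (u n - l)%C < eps.

Lemma Cconv_sub : forall u l phi, Cconv u l -> (forall n, (n <= phi n)%nat) ->
  Cconv (fun n => u (phi n)) l.
Proof.
  intros u l phi H Hphi eps He. destruct (H eps He) as [N HN]. exists N.
  intros n Hn. apply HN. specialize (Hphi n). lia.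
Qed.

Lemma Cconv_cont : forall f u l, Ccont f l -> Cconv u l -> Cconv (fun n => f (u n)) (f l).
Proof.
  intros f u l Hf Hu eps He. destruct (Hf eps He) as [d [Hd H]].
  destruct (Hu d Hd) as [N HN]. exists N. auto.
Qed.

Lemma inv_S_pos : forall n, 0 < / (INR n + 1).
Proof. intros n. apply Rinv_0_lt_compat. assert (H := pos_INR n). lra. Qed.

Lemma inv_S_small : forall eps, 0 < eps -> exists N, forall n, (N <= n)%nat ->
  / (INR n + 1) < eps.
Proof.
  intros eps He. destruct (archimed_cor1 eps He) as [N [HN HN0]]. exists N.
  intros n Hn. apply Rle_lt_trans with (2 := HN).
  apply Rinv_le_contravar; [now apply lt_0_INR|]. apply le_INR in Hn. lra.
Qed.

Lemma Rbounded_subseq : forall (u : nat -> R) M, (forall n, Rabs (u n) <= M) ->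
  exists (phi : nat -> nat) (l : R), (forall n, (n <= phi n)%nat) /\
    forall n, Rabs (u (phi n) - l) < / (INR n + 1).
Proof.
  intros u M H.
  destruct (Bolzano_Weierstrass u (fun x => - M <= x <= M) (compact_P3 (- M) M)) as [l Hl].
  { intros n. specialize (H n). apply Rabs_le_between in H. exact H. }
  assert (Hc : forall n, exists m, (n <= m)%nat /\ Rabs (u m - l) < / (INR n + 1)).
  { intros n. destruct (Hl (disc l (mkposreal _ (inv_S_pos n))) n) as [m [Hm1 Hm2]].
    - exists (mkposreal _ (inv_S_pos n)). intros x Hx. exact Hx.
    - exists m. split; auto. }
  apply choice in Hc. destruct Hc as [phi Hphi]. exists phi, l.
  split; intros n; apply Hphi.
Qed.

(** Only [n <= phi n] is recorded: it is enough for composing subsequences. *)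
Lemma Cbounded_subseq : forall (u : nat -> C) M, (forall n, Cmod (u n) <= M) ->
  exists (phi : nat -> nat) (l : C),
    (forall n, (n <= phi n)%nat) /\ Cconv (fun n => u (phi n)) l.
Proof.
  intros u M H.
  destruct (Rbounded_subseq (fun n => fst (u n)) M) as [phi [x [Hphi Hx]]].
  { intros n. apply Rle_trans with (2 := H n). apply Cmod_fst. }
  destruct (Rbounded_subseq (fun n => snd (u (phi n))) M) as [psi [y [Hpsi Hy]]].
  { intros n. apply Rle_trans with (2 := H (phi n)). apply Cmod_snd. }
  exists (fun n => phi (psi n)), (x, y). split.
  { intros n. specialize (Hphi (psi n)). specialize (Hpsi n). lia. }
  intros eps He. destruct (inv_S_small (eps / 2) ltac:(lra)) as [N HN]. exists N.
  intros n Hn. apply Rle_lt_trans with (1 := Cmod_le_sum _). simpl.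
  specialize (Hx (psi n)). specialize (Hy n). specialize (Hpsi n).
  assert (H1 := HN n Hn). assert (H2 := HN (psi n) ltac:(lia)). simpl in *.
  unfold Rminus in *. lra.
Qed.

Lemma Cconv_mod_le : forall u l M N, Cconv u l ->
  (forall n, (N <= n)%nat -> Cmod (u n) <= M) -> Cmod l <= M.
Proof.
  intros u l M N Hu H. apply Rnot_lt_le. intros Hlt.
  destruct (Hu (Cmod l - M) ltac:(lra)) as [N' HN].
  specialize (HN (N + N')%nat ltac:(lia)). specialize (H (N + N')%nat ltac:(lia)).
  assert (H1 := Cmod_rev_triangle l (u (N + N')%nat)). rewrite Cmod_sub_sym in H1. lra.
Qed.

Lemma Cconv_mod_ge : forall u l M N, Cconv u l ->
  (forall n, (N <= n)%nat -> M <= Cmod (u n)) -> M <= Cmod l.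
Proof.
  intros u l M N Hu H. apply Rnot_lt_le. intros Hlt.
  destruct (Hu (M - Cmod l) ltac:(lra)) as [N' HN].
  specialize (HN (N + N')%nat ltac:(lia)). specialize (H (N + N')%nat ltac:(lia)).
  assert (H1 := Cmod_rev_triangle (u (N + N')%nat) l). lra.
Qed.

Lemma Cconv_unique : forall u l m, Cconv u l -> Cconv u m -> l = m.
Proof.
  intros u l m Hl Hm. apply Cmod_zero_eq. apply NNPP. intros N.
  assert (Hp : 0 < Cmod (l - m)%C) by (assert (H := Cmod_ge_0 (l - m)%C); lra).
  destruct (Hl (Cmod (l - m)%C / 2) ltac:(lra)) as [N1 H1].
  destruct (Hm (Cmod (l - m)%C / 2) ltac:(lra)) as [N2 H2].
  specialize (H1 (N1 + N2)%nat ltac:(lia)). specialize (H2 (N1 + N2)%nat ltac:(lia)).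
  set (z := u (N1 + N2)%nat) in *.
  assert (H3 := Cmod_triangle (l - z) (z - m)).
  replace (l - z + (z - m))%C with (l - m)%C in H3 by ring.
  rewrite (Cmod_sub_sym l z) in H3. lra.
Qed.

Lemma Cconv_mod_bounded : forall u l, Cconv u l ->
  exists N, forall n, (N <= n)%nat -> Cmod (u n) <= Cmod l + 1.
Proof.
  intros u l H. destruct (H 1 Rlt_0_1) as [N HN]. exists N. intros n Hn.
  specialize (HN n Hn). assert (H1 := Cmod_rev_triangle (u n) l). lra.
Qed.

Lemma Cconv_lin : forall u v a b (s t : C), Cconv u a -> Cconv v b ->
  Cconv (fun n => s * u n + t * v n)%C (s * a + t * b)%C.
Proof.
  intros u v a b s t Hu Hv eps He.
  set (A := Cmod s + 1). set (B := Cmod t + 1).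
  assert (HA : 0 < A) by (unfold A; assert (H := Cmod_ge_0 s); lra).
  assert (HB : 0 < B) by (unfold B; assert (H := Cmod_ge_0 t); lra).
  destruct (Hu (eps / (2 * A)) ltac:(apply Rdiv_lt_0_compat; lra)) as [N1 H1].
  destruct (Hv (eps / (2 * B)) ltac:(apply Rdiv_lt_0_compat; lra)) as [N2 H2].
  exists (N1 + N2)%nat. intros n Hn.
  specialize (H1 n ltac:(lia)). specialize (H2 n ltac:(lia)).
  replace (s * u n + t * v n - (s * a + t * b))%C
    with (s * (u n - a) + t * (v n - b))%C by ring.
  apply Rle_lt_trans with (1 := Cmod_triangle _ _). rewrite !Cmod_mult.
  replace eps with (A * (eps / (2 * A)) + B * (eps / (2 * B))) by (field; lra).
  assert (P1 := Cmod_ge_0 (u n - a)%C). assert (P2 := Cmod_ge_0 (v n - b)%C).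
  apply Rplus_lt_compat.
  - apply Rle_lt_trans with (A * Cmod (u n - a)%C).
    + apply Rmult_le_compat_r; unfold A; lra.
    + now apply Rmult_lt_compat_l.
  - apply Rle_lt_trans with (B * Cmod (v n - b)%C).
    + apply Rmult_le_compat_r; unfold B; lra.
    + now apply Rmult_lt_compat_l.
Qed.

(** * The complex exponential *)

Definition Cexp (z : C) : C := (RtoC (exp (fst z)) * Cexp_i (snd z))%C.

Lemma Cmod_Cexp_i : forall t, Cmod (Cexp_i t) = 1.
Proof.
  intros t. unfold Cmod, Cexp_i; simpl.
  replace (cos t * (cos t * 1) + sin t * (sin t * 1)) with 1; [apply sqrt_1|].
  assert (H := sin2_cos2 t). unfold Rsqr in H. lra.
Qed.

Lemma Cmod_RtoC_pos : forall r, 0 <= r -> Cmod (RtoC r) = r.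
Proof. intros r H. rewrite Cmod_R. now apply Rabs_pos_eq. Qed.

Lemma Cmod_Cexp : forall z, Cmod (Cexp z) = exp (fst z).
Proof.
  intros z. unfold Cexp. rewrite Cmod_mult, Cmod_Cexp_i, Rmult_1_r.
  apply Cmod_RtoC_pos. left. apply exp_pos.
Qed.

Lemma Cexp_i_plus : forall s t, Cexp_i (s + t) = (Cexp_i s * Cexp_i t)%C.
Proof.
  intros s t. unfold Cexp_i, Cmult; simpl. rewrite cos_plus, sin_plus.
  f_equal; ring.
Qed.

Lemma Cexp_i_0 : Cexp_i 0 = 1.
Proof. unfold Cexp_i. rewrite cos_0, sin_0. reflexivity. Qed.

Lemma Cexp_i_2PI : Cexp_i (2 * PI) = 1.
Proof. unfold Cexp_i. rewrite cos_2PI, sin_2PI. reflexivity. Qed.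

Lemma Cexp_plus : forall z w, Cexp (z + w) = (Cexp z * Cexp w)%C.
Proof.
  intros z w. unfold Cexp. simpl. rewrite exp_plus, Cexp_i_plus, RtoC_mult. ring.
Qed.

Lemma Cexp_0 : Cexp 0 = 1.
Proof. unfold Cexp; simpl. rewrite exp_0, Cexp_i_0. ring. Qed.

Lemma derive_small : forall (f : R -> R) (l : R), is_derive f 0 l ->
  forall eps, 0 < eps -> exists d, 0 < d /\ forall x, Rabs x < d ->
    Rabs (f x - f 0 - l * x) <= eps * Rabs x.
Proof.
  intros f l H eps He. apply is_derive_Reals in H. destruct (H eps He) as [d Hd].
  exists d. split; [apply cond_pos|]. intros x Hx.
  destruct (Req_dec x 0) as [->|N].
  - rewrite Rabs_R0. replace (f 0 - f 0 - l * 0) with 0 by ring. rewrite Rabs_R0. lra.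
  - specialize (Hd x N Hx). rewrite Rplus_0_l in Hd.
    replace (f x - f 0 - l * x) with (((f x - f 0) / x - l) * x) by (field; auto).
    rewrite Rabs_mult. apply Rmult_le_compat_r; [apply Rabs_pos | lra].
Qed.

Lemma Cexp_derive_0 : is_derive Cexp (RtoC 0) (RtoC 1).
Proof.
  apply is_derive_C. intros eps He.
  destruct (derive_small exp 1 ltac:(rewrite <- exp_0; apply is_derive_exp)
    (eps / 8) ltac:(lra)) as [d1 [Hd1 H1]].
  destruct (derive_small cos 0
    ltac:(replace 0 with (- sin 0) at 2 by (rewrite sin_0; ring); apply is_derive_cos)
    (eps / 12) ltac:(lra)) as [d2 [Hd2 H2]].
  destruct (derive_small sin 1 ltac:(rewrite <- cos_0; apply is_derive_sin)
    (eps / 12) ltac:(lra)) as [d3 [Hd3 H3]].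
  assert (He12 : 0 < eps / 12) by lra.
  exists (Rmin (Rmin d1 1) (Rmin (eps / 12) (Rmin d2 d3))). split.
  { repeat apply Rmin_pos; lra. }
  intros [x y] Hz. rewrite Csub_0_r in *. rmin.
  assert (Hx := Cmod_fst (x, y)). assert (Hy := Cmod_snd (x, y)). simpl in Hx, Hy.
  set (m := Cmod (x, y)) in *.
  specialize (H1 x ltac:(lra)). specialize (H2 y ltac:(lra)). specialize (H3 y ltac:(lra)).
  rewrite exp_0 in H1. rewrite cos_0 in H2. rewrite sin_0 in H3.
  rewrite Cexp_0.
  apply Rle_trans with (1 := Cmod_le_sum _). unfold Cexp, Cexp_i. simpl.
  assert (Ex : exp x <= 3).
  { apply Rle_trans with (2 := exp_le_3).
    left. apply exp_increasing. assert (H := Rle_abs x). lra. }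
  assert (Ep := exp_pos x).
  assert (P1 : Rabs (exp x * cos y - 0 * sin y + - (1) + - (1 * x - 0 * y)) <= eps / 2 * m).
  { replace (exp x * cos y - 0 * sin y + - (1) + - (1 * x - 0 * y))
      with ((exp x - 1 - 1 * x) + exp x * (cos y - 1 - 0 * y)) by ring.
    apply Rle_trans with (1 := Rabs_triang _ _). rewrite Rabs_mult, (Rabs_pos_eq (exp x)) by lra.
    assert (P := Rabs_pos (cos y - 1 - 0 * y)). nra. }
  assert (P2 : Rabs (exp x * sin y + 0 * cos y + - 0 + - (1 * y + 0 * x)) <= eps / 2 * m).
  { replace (exp x * sin y + 0 * cos y + - 0 + - (1 * y + 0 * x))
      with (exp x * (sin y - 0 - 1 * y) + ((exp x - 1 - 1 * x) + x) * y) by ring.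
    apply Rle_trans with (1 := Rabs_triang _ _).
    rewrite !Rabs_mult, (Rabs_pos_eq (exp x)) by lra.
    assert (P := Rabs_pos (sin y - 0 - 1 * y)).
    assert (Q := Rabs_triang (exp x - 1 - 1 * x) x).
    assert (Qx := Rabs_pos x). assert (Qy := Rabs_pos y).
    assert (Q' : Rabs (exp x - 1 - 1 * x + x) * Rabs y <= eps / 4 * m).
    { apply Rle_trans with ((eps / 8 + eps / 8) * m); [|lra].
      apply Rmult_le_compat; try apply Rabs_pos; [|lra]. nra. }
    nra. }
  lra.
Qed.

Lemma Cexp_derive : forall z, is_derive Cexp z (Cexp z).
Proof.
  intros z. apply Cderive_ext_loc with (f := fun y => (Cexp z * Cexp (y - z))%C).
  { exists 1. split; [lra|]. intros y _.
    rewrite <- Cexp_plus. f_equal. ring. }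
  eapply Cderive_eq.
  - apply Cderive_mult; [apply Cderive_const|].
    apply (Cderive_comp Cexp (fun y => y - z)%C).
    + apply Cderive_minus; [apply Cderive_id | apply Cderive_const].
    + replace (z - z)%C with (RtoC 0) by ring. apply Cexp_derive_0.
  - cbv beta. ring.
Qed.

(** * Cauchy's theorem on rectangles *)

Lemma C_R_norm : forall z : C, norm (V := C_R_NormedModule) z = Cmod z.
Proof.
  intros [x y]. change (sqrt (Rabs x ^ 2 + Rabs y ^ 2) = sqrt (x ^ 2 + y ^ 2)).
  now rewrite !pow2_abs.
Qed.

Lemma is_derive_RC : forall (f : R -> C) (x : R) (l : C),
  (forall eps, 0 < eps -> exists d, 0 < d /\ forall y, Rabs (y - x) < d ->
    Cmod (f y - f x - l * RtoC (y - x))%C <= eps * Rabs (y - x)) ->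
  is_derive (K := R_AbsRing) (V := C_R_NormedModule) f x l.
Proof.
  intros f x l H. split.
  - apply is_linear_scal_l.
  - intros x' Hx' eps.
    apply (is_filter_lim_locally_unique (K := R_AbsRing) (V := R_NormedModule)) in Hx'.
    subst x'.
    destruct (H eps (cond_pos eps)) as [d [Hd Hl]].
    exists (mkposreal d Hd). intros y Hy.
    specialize (Hl y Hy). rewrite C_R_norm.
    change (Cmod (f y - f x - scal (V := C_R_NormedModule) (y - x)%R l)%C
            <= eps * Rabs (y - x)).
    replace (scal (V := C_R_NormedModule) (y - x)%R l) with (l * RtoC (y - x))%C; [exact Hl|].
    rewrite Cmult_comm. symmetry. apply scal_R_Cmult.
Qed.

Lemma continuous_RC : forall (f : R -> C) (x : R),
  (forall eps, 0 < eps -> exists d, 0 < d /\ forall y, Rabs (y - x) < d ->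
    Cmod (f y - f x)%C < eps) ->
  continuous (U := C_R_NormedModule) f x.
Proof.
  intros f x H. apply filterlim_locally. intros eps.
  destruct (H eps (cond_pos eps)) as [d [Hd Hl]]. exists (mkposreal d Hd).
  intros y Hy. specialize (Hl y Hy).
  split; [ apply Rle_lt_trans with (2 := Hl); apply (Cmod_fst (f y - f x))
         | apply Rle_lt_trans with (2 := Hl); apply (Cmod_snd (f y - f x)) ].
Qed.

Definition Cint (f : R -> C) (a b : R) : C := RInt (V := C_R_CompleteNormedModule) f a b.

Definition Rcont (f : R -> C) (x : R) : Prop := continuous (U := C_R_NormedModule) f x.

Lemma is_Cint : forall f a b, (forall x, Rmin a b <= x <= Rmax a b -> Rcont f x) ->
  is_RInt (V := C_R_CompleteNormedModule) f a b (Cint f a b).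
Proof.
  intros f a b H. apply (RInt_correct (V := C_R_CompleteNormedModule)).
  apply (ex_RInt_continuous (V := C_R_CompleteNormedModule)). exact H.
Qed.

Lemma Cint_unique : forall f a b l,
  is_RInt (V := C_R_CompleteNormedModule) f a b l -> Cint f a b = l.
Proof. intros f a b l H. exact (is_RInt_unique (V := C_R_CompleteNormedModule) f a b l H). Qed.

Lemma Cint_FTC : forall (f g : R -> C) a b,
  (forall x, Rmin a b <= x <= Rmax a b ->
     is_derive (K := R_AbsRing) (V := C_R_NormedModule) f x (g x)) ->
  (forall x, Rmin a b <= x <= Rmax a b -> Rcont g x) ->
  Cint g a b = (f b - f a)%C.
Proof.
  intros f g a b H1 H2. apply Cint_unique.
  exact (is_RInt_derive (V := C_R_CompleteNormedModule) f g a b H1 H2).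
Qed.

Lemma Cint_bound : forall f a b M, a <= b -> (forall x, a <= x <= b -> Rcont f x) ->
  (forall x, a <= x <= b -> Cmod (f x) <= M) -> Cmod (Cint f a b) <= (b - a) * M.
Proof.
  intros f a b M Hab Hc HM. rewrite <- C_R_norm.
  apply (norm_RInt_le_const (V := C_R_NormedModule) f a b (Cint f a b) M Hab).
  - intros x Hx. rewrite C_R_norm. auto.
  - apply is_Cint. rewrite Rmin_left, Rmax_right by exact Hab. exact Hc.
Qed.

Lemma Cint_plus : forall f g a b, (forall x, Rmin a b <= x <= Rmax a b -> Rcont f x) ->
  (forall x, Rmin a b <= x <= Rmax a b -> Rcont g x) ->
  Cint (fun x => f x + g x)%C a b = (Cint f a b + Cint g a b)%C.
Proof.
  intros f g a b Hf Hg. apply Cint_unique.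
  exact (is_RInt_plus (V := C_R_CompleteNormedModule) f g a b _ _
    (is_Cint f a b Hf) (is_Cint g a b Hg)).
Qed.

Lemma Cint_minus : forall f g a b, (forall x, Rmin a b <= x <= Rmax a b -> Rcont f x) ->
  (forall x, Rmin a b <= x <= Rmax a b -> Rcont g x) ->
  Cint (fun x => f x - g x)%C a b = (Cint f a b - Cint g a b)%C.
Proof.
  intros f g a b Hf Hg. apply Cint_unique.
  exact (is_RInt_minus (V := C_R_CompleteNormedModule) f g a b _ _
    (is_Cint f a b Hf) (is_Cint g a b Hg)).
Qed.

Lemma Cint_Chasles : forall f a b c, a <= b <= c -> (forall x, a <= x <= c -> Rcont f x) ->
  Cint f a c = (Cint f a b + Cint f b c)%C.
Proof.
  intros f a b c Hb H. apply Cint_unique.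
  apply (is_RInt_Chasles (V := C_R_CompleteNormedModule) f a b c); apply is_Cint;
    intros x; rewrite Rmin_left, Rmax_right by lra; intros Hx; apply H; lra.
Qed.

Lemma Cint_ext : forall f g a b, (forall x, Rmin a b <= x <= Rmax a b -> f x = g x) ->
  Cint f a b = Cint g a b.
Proof.
  intros f g a b H. apply (RInt_ext (V := C_R_CompleteNormedModule)).
  intros x Hx. apply H. lra.
Qed.

Lemma pair_sub_l : forall x x' y : R, ((x, y) - (x', y))%C = RtoC (x - x').
Proof. intros. unfold Cminus, Cplus, Copp, RtoC; simpl. f_equal; ring. Qed.

Lemma pair_sub_r : forall x y y' : R, ((x, y) - (x, y'))%C = (Ci * RtoC (y - y'))%C.
Proof. intros. unfold Cminus, Cplus, Copp, RtoC, Ci, Cmult; simpl. f_equal; ring. Qed.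

Lemma Rcont_horiz : forall g x y, Ccont g (x, y) -> Rcont (fun t => g (t, y)) x.
Proof.
  intros g x y H. apply continuous_RC. intros eps He.
  destruct (H eps He) as [d [Hd Hl]]. exists d. split; [exact Hd|].
  intros t Ht. apply Hl. rewrite pair_sub_l, Cmod_R. exact Ht.
Qed.

Lemma Rcont_vert : forall g x y, Ccont g (x, y) -> Rcont (fun t => g (x, t)) y.
Proof.
  intros g x y H. apply continuous_RC. intros eps He.
  destruct (H eps He) as [d [Hd Hl]]. exists d. split; [exact Hd|].
  intros t Ht. apply Hl. rewrite pair_sub_r, Cmod_mult, Cmod_Ci, Rmult_1_l, Cmod_R.
  exact Ht.
Qed.

Lemma derive_horiz : forall (g : C -> C) (x y : R) (l : C), is_derive g ((x, y) : C) l ->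
  is_derive (K := R_AbsRing) (V := C_R_NormedModule) (fun t => g (t, y)) x l.
Proof.
  intros g x y l H. apply is_derive_RC. intros eps He.
  destruct (proj1 (is_derive_C _ _ _) H eps He) as [d [Hd Hl]]. exists d.
  split; [exact Hd|]. intros t Ht. specialize (Hl (t, y)).
  rewrite pair_sub_l, Cmod_R in Hl. auto.
Qed.

Lemma derive_vert : forall (g : C -> C) (x y : R) (l : C), is_derive g ((x, y) : C) l ->
  is_derive (K := R_AbsRing) (V := C_R_NormedModule) (fun t => g (x, t)) y (Ci * l)%C.
Proof.
  intros g x y l H. apply is_derive_RC. intros eps He.
  destruct (proj1 (is_derive_C _ _ _) H eps He) as [d [Hd Hl]]. exists d.
  split; [exact Hd|]. intros t Ht. specialize (Hl (x, t)).
  rewrite pair_sub_r, Cmod_mult, Cmod_Ci, Rmult_1_l, Cmod_R in Hl.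
  replace (Ci * l * RtoC (t - y))%C with (l * (Ci * RtoC (t - y)))%C by ring. auto.
Qed.

(** Integral of [g(z) dz] along the boundary of the rectangle with corner [c],
    width [A] and height [B]. *)
Definition rect_int (g : C -> C) (c : C) (A B : R) : C :=
  (Cint (fun x => g (x, snd c)) (fst c) (fst c + A)
   + Cint (fun y => Ci * g ((fst c + A)%R, y)) (snd c) (snd c + B)
   - Cint (fun x => g (x, (snd c + B)%R)) (fst c) (fst c + A)
   - Cint (fun y => Ci * g (fst c, y)) (snd c) (snd c + B))%C.

Definition in_rect (c : C) (A B : R) (z : C) : Prop :=
  fst c <= fst z <= fst c + A /\ snd c <= snd z <= snd c + B.

Lemma Rcont_sides : forall g c A B, 0 <= A -> 0 <= B ->
  (forall z, in_rect c A B z -> Ccont g z) ->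
  (forall x y, fst c <= x <= fst c + A -> snd c <= y <= snd c + B ->
     Rcont (fun t => g (t, y)) x) /\
  (forall x y, fst c <= x <= fst c + A -> snd c <= y <= snd c + B ->
     Rcont (fun t => Ci * g (x, t))%C y).
Proof.
  intros g c A B HA HB H. split; intros x y Hx Hy.
  - apply Rcont_horiz, H. now split.
  - apply (Rcont_vert (fun z => Ci * g z)%C). apply Ccont_mult; [apply Ccont_const|].
    apply H. now split.
Qed.

Ltac rside := intros; match goal with
  | H : Rmin ?a ?b <= _ <= Rmax ?a ?b |- _ => rewrite Rmin_left, Rmax_right in H by lra
  end.

Lemma rect_int_quarters : forall g c A B, 0 <= A -> 0 <= B ->
  (forall z, in_rect c A B z -> Ccont g z) ->
  rect_int g c A B =
  (rect_int g c (A / 2) (B / 2)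
   + rect_int g ((fst c + A / 2)%R, snd c) (A / 2) (B / 2)
   + rect_int g (fst c, (snd c + B / 2)%R) (A / 2) (B / 2)
   + rect_int g ((fst c + A / 2)%R, (snd c + B / 2)%R) (A / 2) (B / 2))%C.
Proof.
  intros g c A B HA HB H.
  destruct (Rcont_sides g c A B HA HB H) as [Hh Hv].
  destruct c as [a b]. unfold rect_int; simpl in *.
  replace (a + A / 2 + A / 2) with (a + A) by field.
  replace (b + B / 2 + B / 2) with (b + B) by field.
  rewrite (Cint_Chasles (fun x => g (x, b)) a (a + A / 2) (a + A)) by
    (try lra; intros; apply Hh; lra).
  rewrite (Cint_Chasles (fun x => g (x, (b + B)%R)) a (a + A / 2) (a + A)) by
    (try lra; intros; apply Hh; lra).
  rewrite (Cint_Chasles (fun y => Ci * g ((a + A)%R, y))%C b (b + B / 2) (b + B)) by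
    (try lra; intros; apply Hv; lra).
  rewrite (Cint_Chasles (fun y => Ci * g (a, y))%C b (b + B / 2) (b + B)) by
    (try lra; intros; apply Hv; lra).
  ring.
Qed.

Lemma rect_int_primitive : forall (G g : C -> C) (c : C) A B, 0 <= A -> 0 <= B ->
  (forall z, is_derive G z (g z)) -> (forall z, Ccont g z) ->
  rect_int g c A B = 0.
Proof.
  intros G g c A B HA HB HG Hg.
  destruct (Rcont_sides g c A B HA HB (fun z _ => Hg z)) as [Hh Hv].
  destruct c as [a b]. unfold rect_int; simpl in *.
  rewrite (Cint_FTC (fun x => G (x, b)) (fun x => g (x, b))) by
    (rside; first [now apply derive_horiz | apply Hh; lra]).
  rewrite (Cint_FTC (fun x => G (x, (b + B)%R)) (fun x => g (x, (b + B)%R))) by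
    (rside; first [now apply derive_horiz | apply Hh; lra]).
  rewrite (Cint_FTC (fun y => G ((a + A)%R, y)) (fun y => Ci * g ((a + A)%R, y))%C) by
    (rside; first [now apply derive_vert | apply Hv; lra]).
  rewrite (Cint_FTC (fun y => G (a, y)) (fun y => Ci * g (a, y))%C) by
    (rside; first [now apply derive_vert | apply Hv; lra]).
  ring.
Qed.

Lemma rect_int_affine : forall a l z0 c A B, 0 <= A -> 0 <= B ->
  rect_int (fun z => a + l * (z - z0))%C c A B = 0.
Proof.
  intros a l z0 c A B HA HB.
  apply rect_int_primitive with
    (G := fun z => ((a - l * z0) * z + l * (/ 2) * (z * z))%C); try lra.
  - intros z. eapply Cderive_eq.
    + cderive.
    + cbv beta. field.
  - intros z. apply Cdiff_cont. cdiff.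
Qed.

Lemma rect_int_minus : forall f g c A B, 0 <= A -> 0 <= B ->
  (forall z, in_rect c A B z -> Ccont f z) -> (forall z, in_rect c A B z -> Ccont g z) ->
  rect_int (fun z => f z - g z)%C c A B = (rect_int f c A B - rect_int g c A B)%C.
Proof.
  intros f g c A B HA HB Hf Hg.
  destruct (Rcont_sides f c A B HA HB Hf) as [Hfh Hfv].
  destruct (Rcont_sides g c A B HA HB Hg) as [Hgh Hgv].
  destruct c as [a b]. unfold rect_int; simpl in *.
  assert (E : forall x, Cint (fun y => Ci * (f (x, y) - g (x, y)))%C b (b + B) =
    Cint (fun y => Ci * f (x, y) - Ci * g (x, y))%C b (b + B)).
  { intros x. apply Cint_ext. intros. ring. }
  rewrite !E.
  rewrite (Cint_minus (fun x => f (x, b)) (fun x => g (x, b)));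
    [| rside; apply Hfh; lra | rside; apply Hgh; lra].
  rewrite (Cint_minus (fun x => f (x, (b + B)%R)) (fun x => g (x, (b + B)%R)));
    [| rside; apply Hfh; lra | rside; apply Hgh; lra].
  rewrite (Cint_minus (fun y => Ci * f ((a + A)%R, y))%C (fun y => Ci * g ((a + A)%R, y))%C);
    [| rside; apply Hfv; lra | rside; apply Hgv; lra].
  rewrite (Cint_minus (fun y => Ci * f (a, y))%C (fun y => Ci * g (a, y))%C);
    [| rside; apply Hfv; lra | rside; apply Hgv; lra].
  ring.
Qed.

Lemma rect_int_bound : forall g c A B M, 0 <= A -> 0 <= B ->
  (forall z, in_rect c A B z -> Ccont g z) ->
  (forall z, in_rect c A B z -> Cmod (g z) <= M) ->
  Cmod (rect_int g c A B) <= 2 * (A + B) * M.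
Proof.
  intros g c A B M HA HB H HM.
  destruct (Rcont_sides g c A B HA HB H) as [Hh Hv].
  destruct c as [a b]. unfold rect_int; simpl in *.
  assert (B1 := Cint_bound (fun x => g (x, b)) a (a + A) M ltac:(lra)
    ltac:(intros; apply Hh; lra) ltac:(intros; apply HM; split; simpl; lra)).
  assert (B2 := Cint_bound (fun y => Ci * g ((a + A)%R, y))%C b (b + B) M ltac:(lra)
    ltac:(intros; apply Hv; lra)
    ltac:(intros; cbv beta; rewrite Cmod_mult, Cmod_Ci, Rmult_1_l; apply HM; split; simpl; lra)).
  assert (B3 := Cint_bound (fun x => g (x, (b + B)%R)) a (a + A) M ltac:(lra)
    ltac:(intros; apply Hh; lra) ltac:(intros; apply HM; split; simpl; lra)).
  assert (B4 := Cint_bound (fun y => Ci * g (a, y))%C b (b + B) M ltac:(lra)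
    ltac:(intros; apply Hv; lra)
    ltac:(intros; cbv beta; rewrite Cmod_mult, Cmod_Ci, Rmult_1_l; apply HM; split; simpl; lra)).
  apply Rle_trans with (1 := Cmod_sub_triangle _ _).
  eapply Rle_trans; [apply Rplus_le_compat_r, Cmod_sub_triangle|].
  eapply Rle_trans; [apply Rplus_le_compat_r, Rplus_le_compat_r, Cmod_triangle|].
  simpl in *. lra.
Qed.

Lemma in_rect_closed : forall c A B u z, Cconv u z ->
  (forall n, in_rect c A B (u n)) -> in_rect c A B z.
Proof.
  intros c A B u z Hz H.
  assert (K : forall eps, 0 < eps -> (fst c <= fst z + eps /\ fst z <= fst c + A + eps) /\
    (snd c <= snd z + eps /\ snd z <= snd c + B + eps)).
  { intros eps He. destruct (Hz eps He) as [N HN]. specialize (HN N (le_n N)).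
    destruct (H N) as [I1 I2].
    assert (W1 := Rle_lt_trans _ _ _ (Cmod_fst (u N - z)%C) HN).
    assert (W2 := Rle_lt_trans _ _ _ (Cmod_snd (u N - z)%C) HN).
    apply Rabs_lt_between in W1, W2. simpl in W1, W2. lra. }
  split; split; apply le_epsilon; intros eps He; specialize (K eps He); lra.
Qed.

(** Goursat's lemma. Were the integral nonzero, halving the sides repeatedly
    would give nested rectangles, the [n]-th of which carries at least [4^-n] of
    it; at their common point the function agrees with an affine one to first
    order, which bounds the integral by [o(4^-n)]. *)
Lemma rect_int_zero : forall g c A B, 0 < A -> 0 < B ->
  (forall z, in_rect c A B z -> Cdiff g z) -> rect_int g c A B = 0.
Proof.
  intros g c A B HA HB Hg. apply Cmod_eq_0. apply NNPP. intros N.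
  assert (He : 0 < Cmod (rect_int g c A B)).
  { assert (H := Cmod_ge_0 (rect_int g c A B)). lra. }
  set (e := Cmod (rect_int g c A B)) in *. set (h := fun n => (/ 2) ^ n).
  assert (Ph : forall n, 0 < h n) by (intros; apply pow_lt; lra).
  assert (hS : forall n, h (S n) = h n / 2) by (intros n; unfold h; simpl; lra).
  set (sub := fun m z' n z => forall w, in_rect z' (A * h m) (B * h m) w -> in_rect z (A * h n) (B * h n) w).
  set (bad := fun n z => sub n z O c /\
     e * (h n * h n) <= Cmod (rect_int g z (A * h n) (B * h n))).
  assert (E0 : A * h O = A /\ B * h O = B) by (unfold h; simpl; lra). destruct E0 as [EA EB].
  assert (Hstep : forall s : nat * C, exists z', bad (fst s) (snd s) ->
    bad (S (fst s)) z' /\ sub (S (fst s)) z' (fst s) (snd s)).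
  { intros [n z]. simpl. destruct (classic (bad n z)) as [[S0 Hb]|Nb]; [|exists z; easy].
    assert (P := Ph n). assert (QA : 0 < A * h n) by nra. assert (QB : 0 < B * h n) by nra.
    rewrite rect_int_quarters in Hb by (try lra; intros w Hw; apply Cdiff_cont, Hg;
      rewrite <- EA, <- EB; now apply S0).
    replace (A * h n / 2) with (A * h (S n)) in Hb by (rewrite hS; lra).
    replace (B * h n / 2) with (B * h (S n)) in Hb by (rewrite hS; lra).
    apply NNPP. intros Nz.
    assert (K : forall z', sub (S n) z' n z ->
      Cmod (rect_int g z' (A * h (S n)) (B * h (S n))) < e * (h (S n) * h (S n))).
    { intros z' H1. apply Rnot_le_lt. intros H3. apply Nz. exists z'. intros _.
      split; [split; [intros w Hw; now apply S0, H1 | exact H3] | exact H1]. }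
    assert (K1 := K z). assert (K2 := K ((fst z + A * h (S n))%R, snd z)).
    assert (K3 := K (fst z, (snd z + B * h (S n))%R)).
    assert (K4 := K ((fst z + A * h (S n))%R, (snd z + B * h (S n))%R)).
    unfold sub, in_rect in K1, K2, K3, K4. simpl in K1, K2, K3, K4. rewrite hS in K1, K2, K3, K4.
    specialize (K1 ltac:(intros w [W1 W2]; lra)). specialize (K2 ltac:(intros w [W1 W2]; lra)).
    specialize (K3 ltac:(intros w [W1 W2]; lra)). specialize (K4 ltac:(intros w [W1 W2]; lra)).
    rewrite <- hS in K1, K2, K3, K4. apply (Rle_not_lt _ _ Hb).
    eapply Rle_lt_trans; [apply Cmod_triangle|].
    eapply Rle_lt_trans; [apply Rplus_le_compat_r, Cmod_triangle|].
    eapply Rle_lt_trans; [apply Rplus_le_compat_r, Rplus_le_compat_r, Cmod_triangle|].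
    replace (e * (h n * h n)) with (4 * (e * (h (S n) * h (S n)))) by (rewrite hS; field). lra. }
  apply choice in Hstep. destruct Hstep as [step Hstep].
  set (cs := fix cs n := match n with O => c | S m => step (m, cs m) end).
  assert (Hbad : forall n, bad n (cs n)).
  { induction n as [|n IH]; [|now apply (Hstep (n, cs n))].
    split; [easy|]. unfold h; simpl. rewrite !Rmult_1_r. unfold e. lra. }
  assert (Hcorner : forall n, in_rect (cs n) (A * h n) (B * h n) (cs n)).
  { intros n. assert (P := Ph n). split; nra. }
  assert (Hnest : forall n k, sub (n + k)%nat (cs (n + k)%nat) n (cs n)).
  { intros n k. induction k as [|k IH]; [now rewrite Nat.add_0_r|].
    rewrite Nat.add_succ_r. intros w Hw. apply IH. now apply (Hstep ((n + k)%nat, cs (n + k)%nat) (Hbad _)). }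
  destruct (Cbounded_subseq cs (Cmod c + (A + B))) as [phi [z0 [Hphi Hz0]]].
  { intros n. destruct (proj1 (Hbad n) _ (Hcorner n)) as [I1 I2]. rewrite EA in I1. rewrite EB in I2.
    assert (H1 := Cmod_rev_triangle (cs n) c). assert (H2 := Cmod_le_sum (cs n - c)%C).
    simpl in H2. rewrite !Rabs_pos_eq in H2 by lra. lra. }
  (* The [n]-th rectangle is closed and contains all later corners. *)
  assert (Hz : forall n, in_rect (cs n) (A * h n) (B * h n) z0).
  { intros n. apply in_rect_closed with (fun k => cs (phi (n + k)%nat)).
    - apply (Cconv_sub (fun k => cs (phi k)) z0 (fun k => (n + k)%nat) Hz0). lia.
    - intros k. assert (L := Hphi (n + k)%nat).
      replace (phi (n + k)%nat) with (n + (phi (n + k)%nat - n))%nat by lia.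
      exact (Hnest n _ _ (Hcorner _)). }
  destruct (Hg z0) as [l Hl]; [specialize (Hz O); rewrite EA, EB in Hz; exact Hz|].
  set (e' := e / (4 * ((A + B) * (A + B)))).
  assert (He' : 0 < e') by (apply Rdiv_lt_0_compat; nra).
  destruct (proj1 (is_derive_C _ _ _) Hl e' He') as [d [Hd Hdl]].
  destruct (pow_lt_1_zero (/ 2) ltac:(rewrite Rabs_pos_eq; lra) (d / (A + B))
      ltac:(apply Rdiv_lt_0_compat; lra)) as [n Hn].
  specialize (Hn n (le_n n)). fold (h n) in Hn. rewrite Rabs_pos_eq in Hn by (left; auto).
  apply Rlt_div_r in Hn; [|lra]. destruct (Hbad n) as [Hsub Hb]. specialize (Hz n).
  set (t := h n) in *. assert (Ht : 0 < t) by apply Ph.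
  assert (QA : 0 <= A * t) by nra. assert (QB : 0 <= B * t) by nra.
  set (aff := fun z => (g z0 + l * (z - z0))%C).
  assert (Hg' : forall z, in_rect (cs n) (A * t) (B * t) z -> Ccont g z).
  { intros z Hzz. apply Hsub in Hzz. rewrite EA, EB in Hzz. now apply Cdiff_cont, Hg. }
  assert (Ha' : forall z, Ccont aff z) by (intros z; apply Cdiff_cont; unfold aff; cdiff).
  assert (E := rect_int_minus g aff (cs n) (A * t) (B * t) QA QB Hg' (fun z _ => Ha' z)).
  unfold aff in E at 2. rewrite rect_int_affine, Csub_0_r in E by lra. rewrite <- E in Hb.
  assert (Bd : Cmod (rect_int (fun z => g z - aff z)%C (cs n) (A * t) (B * t)) <=
    2 * (A * t + B * t) * (e' * ((A + B) * t))).
  { apply rect_int_bound; auto.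
    - intros z Hzz. apply Ccont_minus; auto.
    - intros z [Z1 Z2]. destruct Hz as [Y1 Y2].
      assert (Hm : Cmod (z - z0)%C <= (A + B) * t).
      { apply Rle_trans with (1 := Cmod_le_sum _). simpl.
        assert (Rabs (fst z + - fst z0) <= A * t) by (apply Rabs_le; lra).
        assert (Rabs (snd z + - snd z0) <= B * t) by (apply Rabs_le; lra). lra. }
      replace (g z - aff z)%C with (g z - g z0 - l * (z - z0))%C by (unfold aff; ring).
      apply Rle_trans with (1 := Hdl z ltac:(lra)). apply Rmult_le_compat_l; lra. }
  replace (2 * (A * t + B * t) * (e' * ((A + B) * t))) with (e / 2 * (t * t)) in Bd
    by (unfold e'; field; lra).
  assert (0 < e * (t * t)) by (apply Rmult_lt_0_compat; nra). lra.
Qed.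

(** * Means over circles *)

Lemma Cint_scal : forall (a : C) f s t, (forall x, Rmin s t <= x <= Rmax s t -> Rcont f x) ->
  Cint (fun x => a * f x)%C s t = (a * Cint f s t)%C.
Proof.
  intros [x y] f s t H. apply Cint_unique. assert (Hi := is_Cint f s t H).
  set (I := Cint f s t) in *.
  assert (H1 := is_RInt_fct_extend_fst (U := R_NormedModule) (V := R_NormedModule) f s t I Hi).
  assert (H2 := is_RInt_fct_extend_snd (U := R_NormedModule) (V := R_NormedModule) f s t I Hi).
  apply (is_RInt_fct_extend_pair (U := R_NormedModule) (V := R_NormedModule)
    (fun u => (x, y) * f u)%C s t (x * fst I - y * snd I) (x * snd I + y * fst I)).
  - apply (is_RInt_minus (V := R_NormedModule)); now apply (is_RInt_scal (V := R_NormedModule)).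
  - apply (is_RInt_plus (V := R_NormedModule)); now apply (is_RInt_scal (V := R_NormedModule)).
Qed.

Lemma exp_le_mono : forall x y, x <= y -> exp x <= exp y.
Proof.
  intros x y [H| ->]; [left; now apply exp_increasing | lra].
Qed.

Definition circ (c : C) (r t : R) : C := (c + RtoC r * Cexp_i t)%C.

Lemma circ_dist : forall c r t, 0 <= r -> Cmod (circ c r t - c)%C = r.
Proof.
  intros c r t Hr. unfold circ.
  replace (c + RtoC r * Cexp_i t - c)%C with (RtoC r * Cexp_i t)%C by ring.
  now rewrite Cmod_mult, Cmod_Cexp_i, Rmult_1_r, Cmod_RtoC_pos.
Qed.

Lemma circ_Cexp : forall c r t, circ c r t = (c + RtoC r * Cexp ((0, t) : C))%C.
Proof. intros c r t. unfold circ, Cexp. simpl. rewrite exp_0. ring. Qed.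

Lemma circ_ln : forall c r t, 0 < r -> circ c r t = (c + Cexp ((ln r, t) : C))%C.
Proof. intros c r t H. unfold circ, Cexp. simpl. now rewrite exp_ln. Qed.

Lemma circ_cont : forall f c r t, Ccont f (circ c r t) -> Rcont (fun t => f (circ c r t)) t.
Proof.
  intros f c r t H.
  apply (continuous_ext (fun t => f (c + RtoC r * Cexp ((0, t) : C))%C)).
  { intros s. now rewrite circ_Cexp. }
  apply (Rcont_vert (fun z => f (c + RtoC r * Cexp z)%C)).
  apply (Ccont_comp f (fun z => c + RtoC r * Cexp z)%C).
  - apply Ccont_plus; [apply Ccont_const|]. apply Ccont_mult; [apply Ccont_const|].
    apply is_derive_Ccont with (1 := Cexp_derive _).
  - now rewrite <- circ_Cexp.
Qed.

Definition cmean (f : C -> C) (c : C) (r : R) : C :=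
  (RtoC (/ (2 * PI)) * Cint (fun t => f (circ c r t)) 0 (2 * PI))%C.

Definition cont_circle (f : C -> C) (c : C) (r : R) : Prop :=
  forall z : C, Cmod (z - c)%C = r -> Ccont f z.

Lemma cont_circle_Rcont : forall f c r, 0 <= r -> cont_circle f c r ->
  forall t, Rcont (fun t => f (circ c r t)) t.
Proof. intros f c r Hr H t. apply circ_cont, H, circ_dist, Hr. Qed.

Lemma cmean_scal : forall a f c r, 0 <= r -> cont_circle f c r ->
  cmean (fun z => a * f z)%C c r = (a * cmean f c r)%C.
Proof.
  intros a f c r Hr H. unfold cmean.
  rewrite (Cint_scal a (fun t => f (circ c r t))) by (intros; now apply cont_circle_Rcont).
  ring.
Qed.

Lemma cmean_plus : forall f g c r, 0 <= r -> cont_circle f c r -> cont_circle g c r ->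
  cmean (fun z => f z + g z)%C c r = (cmean f c r + cmean g c r)%C.
Proof.
  intros f g c r Hr Hf Hg. unfold cmean.
  rewrite (Cint_plus (fun t => f (circ c r t)) (fun t => g (circ c r t)))
    by (intros; now apply cont_circle_Rcont).
  ring.
Qed.

Lemma cmean_bound : forall f c r M, 0 <= r -> cont_circle f c r ->
  (forall z : C, Cmod (z - c)%C = r -> Cmod (f z) <= M) -> Cmod (cmean f c r) <= M.
Proof.
  intros f c r M Hr Hf HM. unfold cmean.
  assert (Hpi := PI_RGT_0).
  assert (Hb := Cint_bound (fun t => f (circ c r t)) 0 (2 * PI) M ltac:(lra)
    ltac:(intros; now apply cont_circle_Rcont) ltac:(intros; apply HM, circ_dist, Hr)).
  rewrite Cmod_mult, Cmod_RtoC_pos by (left; apply Rinv_0_lt_compat; lra).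
  apply (Rmult_le_reg_l (2 * PI)); [lra|].
  rewrite <- Rmult_assoc, Rinv_r, Rmult_1_l by lra. lra.
Qed.

Lemma cmean_const : forall a c r, cmean (fun _ => a) c r = a.
Proof.
  intros a c r. unfold cmean. assert (Hpi := PI_RGT_0).
  assert (E : Cint (fun _ => a) 0 (2 * PI) = (RtoC (2 * PI) * a)%C).
  { apply Cint_unique. rewrite <- (Rminus_0_r (2 * PI)) at 2.
    rewrite <- scal_R_Cmult.
    apply (is_RInt_const (V := C_R_CompleteNormedModule)). }
  rewrite E, Cmult_assoc, <- RtoC_mult, Rinv_l by lra. ring.
Qed.

Lemma cmean_ext : forall f g c r, 0 <= r -> (forall z : C, Cmod (z - c)%C = r -> f z = g z) ->
  cmean f c r = cmean g c r.
Proof.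
  intros f g c r Hr H. unfold cmean. f_equal. apply Cint_ext. intros t _.
  apply H, circ_dist, Hr.
Qed.

(** In the coordinate [log (z - c)] an annulus becomes a rectangle whose
    horizontal sides carry the same values, so Goursat's lemma equates the
    integrals over its vertical sides. *)
Lemma cmean_annulus : forall f c r1 r2, 0 < r1 <= r2 ->
  (forall z : C, r1 <= Cmod (z - c)%C <= r2 -> Cdiff f z) ->
  cmean f c r1 = cmean f c r2.
Proof.
  intros f c r1 r2 [H1 H2] Hf. destruct (Rle_lt_or_eq_dec _ _ H2) as [H2'| ->]; [|reflexivity].
  assert (Hpi := PI_RGT_0).
  assert (L : 0 < ln r2 - ln r1) by (assert (H := ln_increasing r1 r2 H1 H2'); lra).
  set (g := fun s => f (c + Cexp s)%C).
  assert (Hm : forall z : C, ln r1 <= fst z <= ln r2 -> r1 <= Cmod (c + Cexp z - c)%C <= r2).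
  { intros z Hz. replace (c + Cexp z - c)%C with (Cexp z) by ring. rewrite Cmod_Cexp.
    rewrite <- (exp_ln r1), <- (exp_ln r2) by lra.
    split; apply exp_le_mono; lra. }
  assert (Hg : forall z : C, ln r1 <= fst z <= ln r2 -> Cdiff g z).
  { intros z Hz. apply Cdiff_comp with (g := fun s => (c + Cexp s)%C).
    - apply Cdiff_plus; [apply Cdiff_const|]. eexists. apply Cexp_derive.
    - apply Hf, Hm, Hz. }
  assert (J := rect_int_zero g (ln r1, 0) (ln r2 - ln r1) (2 * PI) L ltac:(lra)).
  assert (J0 : rect_int g (ln r1, 0) (ln r2 - ln r1) (2 * PI) = 0).
  { apply J. intros z [Z1 Z2]. apply Hg. simpl in Z1. lra. }
  unfold rect_int in J0. simpl in J0. rewrite Rplus_0_l in J0.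
  replace (ln r1 + (ln r2 - ln r1)) with (ln r2) in J0 by ring.
  assert (Ep : Cint (fun x => g (x, (2 * PI)%R)) (ln r1) (ln r2) =
    Cint (fun x => g (x, 0)) (ln r1) (ln r2)).
  { apply Cint_ext. intros x _. unfold g, Cexp. simpl. now rewrite Cexp_i_2PI, Cexp_i_0. }
  rewrite Ep in J0.
  rewrite !(Cint_scal Ci) in J0.
  2, 3 : intros x _; apply Rcont_vert, Cdiff_cont, Hg; simpl; lra.
  assert (E : (Ci * (Cint (fun y => g (ln r2, y)) 0 (2 * PI)
                     - Cint (fun y => g (ln r1, y)) 0 (2 * PI)) = 0)%C).
  { rewrite <- J0. ring. }
  assert (E' : Cint (fun y => g (ln r2, y)) 0 (2 * PI) = Cint (fun y => g (ln r1, y)) 0 (2 * PI)).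
  { apply Ceq_minus. apply NNPP. intros N. now apply (Cmult_neq_0 _ _ Ci_nz N). }
  unfold cmean. f_equal.
  transitivity (Cint (fun y => g (ln r1, y)) 0 (2 * PI)).
  - apply Cint_ext. intros t _. unfold g. now rewrite circ_ln.
  - rewrite <- E'. apply Cint_ext. intros t _. unfold g. rewrite circ_ln by lra. reflexivity.
Qed.

(** Otherwise there would be points, on circles of radii tending to [r0], at which
    [f] differs by a fixed amount from its value at the same angle on the circle
    of radius [r0]; at an accumulation point [f] would not be continuous. *)
Lemma cmean_cont : forall f c r0 R0, 0 <= r0 < R0 ->
  (forall z : C, Cmod (z - c)%C < R0 -> Ccont f z) ->
  forall eps, 0 < eps -> exists d, 0 < d /\ forall r, 0 <= r -> Rabs (r - r0) < d -> r < R0 ->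
    Cmod (cmean f c r - cmean f c r0)%C < eps.
Proof.
  intros f c r0 R0 [Hr0 Hr1] Hf eps He. apply NNPP. intros N.
  assert (Hs : forall n : nat, exists p : R * R, 0 <= fst p < R0 /\
    Rabs (fst p - r0) < / (INR n + 1) /\
    eps / 2 < Cmod (f (circ c (fst p) (snd p)) - f (circ c r0 (snd p)))%C).
  { intros n. apply NNPP. intros N1. apply N. exists (/ (INR n + 1)).
    split; [apply inv_S_pos|]. intros r Hr Hrd HrR. apply Rle_lt_trans with (eps / 2); [|lra].
    assert (Hc1 : forall t, Rcont (fun t => f (circ c r t)) t).
    { apply cont_circle_Rcont; [exact Hr|]. intros z Hz. apply Hf. lra. }
    assert (Hc0 : forall t, Rcont (fun t => f (circ c r0 t)) t).
    { apply cont_circle_Rcont; [exact Hr0|]. intros z Hz. apply Hf. lra. }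
    unfold cmean.
    replace (RtoC (/ (2 * PI)) * Cint (fun t => f (circ c r t)) 0 (2 * PI) -
             RtoC (/ (2 * PI)) * Cint (fun t => f (circ c r0 t)) 0 (2 * PI))%C
      with (RtoC (/ (2 * PI)) * (Cint (fun t => f (circ c r t)) 0 (2 * PI) -
             Cint (fun t => f (circ c r0 t)) 0 (2 * PI)))%C by ring.
    rewrite <- Cint_minus by auto.
    assert (Hpi := PI_RGT_0).
    rewrite Cmod_mult, Cmod_RtoC_pos by (left; apply Rinv_0_lt_compat; lra).
    apply (Rmult_le_reg_l (2 * PI)); [lra|].
    rewrite <- Rmult_assoc, Rinv_r, Rmult_1_l by lra.
    replace (2 * PI * (eps / 2)) with ((2 * PI - 0) * (eps / 2)) by ring.
    apply Cint_bound; [lra| |].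
    - intros x _. apply (continuous_minus (V := C_R_NormedModule)); auto.
      + apply Hc1.
      + apply Hc0.
    - intros t Ht. apply Rnot_lt_le. intros Hlt. apply N1. exists (r, t). simpl. auto. }
  apply choice in Hs. destruct Hs as [p Hp].
  destruct (Cbounded_subseq (fun n => Cexp_i (snd (p n))) 1) as [phi [l [Hphi Hl]]].
  { intros n. rewrite Cmod_Cexp_i. lra. }
  set (z := (c + RtoC r0 * l)%C).
  assert (Hlm : Cmod l <= 1).
  { apply Cconv_mod_le with (1 := Hl) (N := O). intros n _. rewrite Cmod_Cexp_i. lra. }
  assert (Hz : Ccont f z).
  { apply Hf. unfold z. replace (c + RtoC r0 * l - c)%C with (RtoC r0 * l)%C by ring.
    rewrite Cmod_mult, Cmod_RtoC_pos by lra. nra. }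
  destruct (Hz (eps / 4) ltac:(lra)) as [d [Hd Hfd]].
  destruct (inv_S_small (d / 2) ltac:(lra)) as [N1 HN1].
  destruct (Hl (d / (2 * (r0 + 1))) ltac:(apply Rdiv_lt_0_compat; lra)) as [N2 HN2].
  specialize (HN1 (phi (N1 + N2)%nat) ltac:(specialize (Hphi (N1 + N2)%nat); lia)).
  specialize (HN2 (N1 + N2)%nat ltac:(lia)).
  set (k := phi (N1 + N2)%nat) in *. destruct (Hp k) as [Q1 [Q2 Q3]].
  destruct (p k) as [r t]. simpl in *.
  assert (D0 : Cmod (circ c r0 t - z)%C < d / 2).
  { unfold circ, z. replace (c + RtoC r0 * Cexp_i t - (c + RtoC r0 * l))%C
      with (RtoC r0 * (Cexp_i t - l))%C by ring.
    rewrite Cmod_mult, Cmod_RtoC_pos by lra.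
    replace (d / 2) with ((r0 + 1) * (d / (2 * (r0 + 1)))) by (field; lra).
    assert (P := Cmod_ge_0 (Cexp_i t - l)%C). nra. }
  assert (D1 : Cmod (circ c r t - z)%C < d).
  { replace (circ c r t - z)%C with (RtoC (r - r0) * Cexp_i t + (circ c r0 t - z))%C
      by (unfold circ; rewrite RtoC_minus; ring).
    apply Rle_lt_trans with (1 := Cmod_triangle _ _).
    rewrite Cmod_mult, Cmod_Cexp_i, Cmod_R. lra. }
  assert (F0 : Cmod (f (circ c r0 t) - f z)%C < eps / 4) by (apply Hfd; lra). assert (F1 := Hfd _ D1).
  assert (T := Cmod_sub_triangle (f (circ c r t) - f z) (f (circ c r0 t) - f z)).
  replace (f (circ c r t) - f z - (f (circ c r0 t) - f z))%C
    with (f (circ c r t) - f (circ c r0 t))%C in T by ring.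
  lra.
Qed.

Lemma cmean_0 : forall f c, cmean f c 0 = f c.
Proof.
  intros f c. transitivity (cmean (fun _ => f c) c 0); [|apply cmean_const].
  unfold cmean. f_equal. apply Cint_ext. intros t _. f_equal. unfold circ. ring.
Qed.

Lemma Ceq_eps : forall a b : C, (forall eps, 0 < eps -> Cmod (a - b)%C < eps) -> a = b.
Proof.
  intros a b H. apply Cmod_zero_eq. apply Rle_antisym; [|apply Cmod_ge_0].
  apply le_epsilon. intros eps He. rewrite Rplus_0_l. left. auto.
Qed.

Lemma cmean_limit : forall f c r0 R0 l, 0 <= r0 < R0 ->
  (forall z : C, Cmod (z - c)%C < R0 -> Ccont f z) ->
  (forall d, 0 < d -> exists r, 0 <= r < R0 /\ Rabs (r - r0) < d /\ cmean f c r = l) ->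
  cmean f c r0 = l.
Proof.
  intros f c r0 R0 l Hr0 Hc Hl. apply Ceq_eps. intros eps He.
  destruct (cmean_cont f c r0 R0 Hr0 Hc eps He) as [d [Hd H]].
  destruct (Hl d Hd) as [r [Hr [Hrd <-]]]. rewrite Cmod_sub_sym. apply H; lra.
Qed.

(** Mean value property; the possible exceptional point is passed by
    continuity in the radius. *)
Lemma mean_value : forall f c w R0,
  (forall z : C, Cmod (z - c)%C < R0 -> Ccont f z) ->
  (forall z : C, Cmod (z - c)%C < R0 -> z <> w -> Cdiff f z) ->
  forall r, 0 <= r < R0 -> cmean f c r = f c.
Proof.
  intros f c w R0 Hc Hd r Hr. set (s := Cmod (w - c)%C).
  assert (Hs : 0 <= s) by apply Cmod_ge_0.
  assert (Hann : forall r1 r2, 0 < r1 <= r2 -> r2 < R0 -> s < r1 \/ r2 < s ->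
    cmean f c r1 = cmean f c r2).
  { intros r1 r2 H1 H2 Hw. apply cmean_annulus; [exact H1|]. intros z Hz.
    apply Hd; [lra|]. intros ->. fold s in Hz. lra. }
  assert (Hin : forall q, 0 <= q < R0 -> q < s \/ q = 0 -> cmean f c q = f c).
  { intros q Hq Hqs. destruct (Req_dec q 0) as [->|Nq]; [apply cmean_0|].
    rewrite <- cmean_0. symmetry. apply cmean_limit with R0; auto; [lra|].
    intros d Hd0. exists (Rmin (d / 2) q).
    assert (M : 0 < Rmin (d / 2) q) by (apply Rmin_pos; lra). rmin.
    split; [lra|]. split; [rewrite Rabs_pos_eq; lra|]. apply Hann; lra. }
  assert (Hat : s < R0 -> cmean f c s = f c).
  { intros HsR. destruct (Req_dec s 0) as [E|Ns]; [rewrite E; apply cmean_0|].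
    apply cmean_limit with R0; auto. intros d Hd0. exists (s - Rmin (d / 2) (s / 2)).
    assert (M : 0 < Rmin (d / 2) (s / 2)) by (apply Rmin_pos; lra). rmin.
    split; [lra|]. split; [rewrite Rabs_left; lra|]. apply Hin; lra. }
  destruct (Rtotal_order r s) as [L|[->|G]]; [apply Hin; lra | apply Hat; lra |].
  rewrite <- Hat by lra. symmetry. apply cmean_limit with R0; auto; [lra|].
  intros d Hd0. exists (s + Rmin (d / 2) (r - s)).
  assert (M : 0 < Rmin (d / 2) (r - s)) by (apply Rmin_pos; lra). rmin.
  split; [lra|]. split; [rewrite Rabs_pos_eq; lra|]. apply Hann; lra.
Qed.

Lemma mean_value_holo : forall f c R0, (forall z : C, Cmod (z - c)%C < R0 -> Cdiff f z) ->
  forall r, 0 <= r < R0 -> cmean f c r = f c.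
Proof.
  intros f c R0 H. apply mean_value with c; intros z Hz; [|intros _]; auto.
  apply Cdiff_cont; auto.
Qed.

(** * The maximum principle *)

Lemma cmean_re_le : forall f c r M, 0 <= r -> cont_circle f c r ->
  (forall z : C, Cmod (z - c)%C = r -> fst (f z) <= M) -> fst (cmean f c r) <= M.
Proof.
  intros f c r M Hr Hf HM. unfold cmean. assert (Hpi := PI_RGT_0).
  assert (Hi := is_Cint (fun t => f (circ c r t)) 0 (2 * PI)
    ltac:(intros; now apply cont_circle_Rcont)).
  set (I := Cint _ _ _) in *.
  assert (H1 := is_RInt_fct_extend_fst (U := R_NormedModule) (V := R_NormedModule) _ _ _ I Hi).
  assert (H2 := is_RInt_const (V := R_NormedModule) 0 (2 * PI) M).
  assert (H3 : fst I <= (2 * PI - 0) * M).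
  { apply (is_RInt_le _ _ 0 (2 * PI) (fst I) ((2 * PI - 0) * M) ltac:(lra) H1 H2).
    intros t _. apply HM, circ_dist, Hr. }
  change (/ (2 * PI) * fst I - 0 * snd I <= M).
  rewrite Rmult_0_l, Rminus_0_r.
  apply (Rmult_le_reg_l (2 * PI)); [lra|].
  rewrite <- Rmult_assoc, Rinv_r, Rmult_1_l by lra. lra.
Qed.

Lemma Cmod_sqr_plus : forall x h : C,
  Cmod (x + h)%C * Cmod (x + h)%C =
  Cmod x * Cmod x + 2 * fst (Cconj x * h)%C + Cmod h * Cmod h.
Proof. intros x h. rewrite !Cmod_sqr. unfold Cconj. simpl. ring. Qed.

(** A holomorphic function of modulus at most one near the boundary. The
    boundary condition is a closedness condition on superlevel sets, so that [A]
    may be any bounded open set. Adding [e |z|^2] to the modulus makes the mean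
    value inequality strict, so that a maximum cannot be attained inside. *)
Lemma max_principle : forall (A : C -> Prop) (v : C -> C) R0,
  (forall z, A z -> Cmod z <= R0) ->
  (forall z, A z -> near z A) ->
  (forall z, A z -> Cdiff v z) ->
  (forall eps u x, 0 < eps -> (forall n, A (u n)) -> Cconv u x ->
     (forall n, 1 + eps <= Cmod (v (u n))) -> A x) ->
  forall z, A z -> Cmod (v z) <= 1.
Proof.
  intros A v R0 HR Hopen Hv Hcl z0 Hz0. apply Rnot_lt_le. intros Hlt.
  set (eta := (Cmod (v z0) - 1) / 3). assert (Heta : 0 < eta) by (unfold eta; lra).
  set (e := eta / (R0 * R0 + 1)).
  assert (He : 0 < e) by (apply Rdiv_lt_0_compat; nra).
  assert (HeR : forall z, A z -> 0 <= e * (Cmod z * Cmod z) <= eta).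
  { intros z Hz. specialize (HR z Hz). assert (P := Cmod_ge_0 z). split; [nra|].
    apply Rle_trans with (e * (R0 * R0 + 1)).
    - apply Rmult_le_compat_l; [lra|]. nra.
    - unfold e. right. field. nra. }
  set (N := fun z => Cmod (v z) + e * (Cmod z * Cmod z)).
  (* [N] attains its maximum: [atan] makes the supremum finite, and a maximising
     sequence, on which [|v| >= 1 + eta], accumulates in [A]. *)
  assert (Hmax : exists x, A x /\ forall y, A y -> N y <= N x).
  { destruct (completeness (fun t => exists z, A z /\ t = atan (N z))) as [S [HS1 HS2]].
    - exists (PI / 2). intros t [z [_ ->]]. left. apply atan_bound.
    - exists (atan (N z0)), z0. auto.
    - assert (Hs : forall n : nat, exists z, A z /\ S - / (INR n + 1) < atan (N z) /\ N z0 <= N z).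
      { intros n. apply NNPP. intros Nn.
        assert (Hp := inv_S_pos n).
        assert (H : S <= S - / (INR n + 1)); [|lra].
        apply HS2. intros t [z [Hz ->]]. apply Rnot_lt_le. intros Hzt.
        destruct (Rle_lt_dec (N z0) (N z)) as [L|L].
        - apply Nn. exists z. auto.
        - apply Nn. exists z0. split; [exact Hz0|]. split; [|lra].
          apply Rlt_trans with (1 := Hzt). now apply atan_increasing. }
      apply choice in Hs. destruct Hs as [u Hu].
      destruct (Cbounded_subseq u R0) as [psi [x [Hpsi Hx]]].
      { intros n. apply HR, Hu. }
      assert (Hge : forall n, 1 + eta <= Cmod (v (u (psi n)))).
      { intros n. destruct (Hu (psi n)) as [U1 [U2 U3]]. unfold N in U3.
        assert (E1 := HeR _ U1). assert (E2 := HeR _ Hz0). unfold eta in *. lra. }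
      assert (Ax : A x).
      { apply (Hcl eta (fun n => u (psi n)) x Heta); [|exact Hx|exact Hge].
        intros n. apply Hu. }
      exists x. split; [exact Ax|]. intros y Hy. apply Rnot_lt_le. intros Hxy.
      set (m := (N x + N y) / 2). assert (Hg : 0 < (m - N x) / 2) by (unfold m; lra).
      assert (Hm : atan m < atan (N y)) by (apply atan_increasing; unfold m; lra).
      assert (De : Ccont (fun z => RtoC e * (z * z))%C x) by (apply Cdiff_cont; cdiff).
      destruct (near_and (Cdiff_cont _ _ (Hv x Ax) _ Hg) (De _ Hg)) as [d [Hd Hnear]].
      destruct (Hx d Hd) as [N1 HN1].
      destruct (inv_S_small (atan (N y) - atan m) ltac:(lra)) as [N2 HN2].
      set (k := (N1 + N2)%nat).
      specialize (HN1 k ltac:(unfold k; lia)).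
      specialize (HN2 (psi k) ltac:(specialize (Hpsi k); unfold k in *; lia)).
      destruct (Hu (psi k)) as [U1 [U2 U3]]. set (w := u (psi k)) in *.
      assert (Nw : N w < m).
      { destruct (Hnear w HN1) as [V1 V2].
        assert (T1 := Cmod_rev_triangle (v w) (v x)).
        assert (T2 := Cmod_rev_triangle (RtoC e * (w * w)) (RtoC e * (x * x))).
        rewrite !(Cmod_mult (RtoC e)), !Cmod_mult, Cmod_RtoC_pos in T2 by lra.
        assert (E1 : forall z, N z = Cmod (v z) + e * (Cmod z * Cmod z)) by reflexivity.
        rewrite E1. rewrite (E1 x) in V1, V2. lra. }
      assert (Pw := atan_increasing (N w) m Nw).
      assert (Sy : atan (N y) <= S) by (apply HS1; exists y; auto).
      lra. }
  destruct Hmax as [x [Ax Hx]].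
  assert (Vx : 1 < Cmod (v x)).
  { assert (H := Hx z0 Hz0). unfold N in H. assert (E1 := HeR x Ax). assert (E2 := HeR _ Hz0).
    unfold eta in *. lra. }
  destruct (Hopen x Ax) as [d [Hd Hball]].
  (* With [a] turning [v x] to the positive axis, and
     [|y|^2 = |x|^2 + 2 Re (conj x (y - x)) + |y - x|^2], maximality at [x] bounds
     the real part of [h] on a circle around [x] by less than that of [h x], the
     mean of [h]. *)
  set (r := d / 2). set (a := (Cconj (v x) / RtoC (Cmod (v x)))%C).
  assert (Nx : RtoC (Cmod (v x)) <> 0) by (intros E; apply RtoC_inj in E; lra).
  assert (Ha : Cmod a = 1).
  { unfold a. rewrite Cmod_div, Cmod_conj, Cmod_RtoC_pos by (auto; lra). field. lra. }
  assert (Hax : (a * v x)%C = RtoC (Cmod (v x))).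
  { unfold a. assert (E := Cmod2_conj (v x)).
    replace (Cconj (v x) / RtoC (Cmod (v x)) * v x)%C
      with ((v x * Cconj (v x)) / RtoC (Cmod (v x)))%C by (field; auto).
    rewrite <- E, RtoC_pow. field. auto. }
  set (h := fun y => (a * v y + RtoC (2 * e) * Cconj x * (y - x))%C).
  assert (Hh : forall y : C, Cmod (y - x)%C < d -> Cdiff h y).
  { intros y Hy. unfold h. cdiff. apply Hv. auto. }
  assert (Mh := mean_value_holo h x d Hh r ltac:(unfold r; lra)).
  assert (Bh : fst (cmean h x r) <= N x - e * (Cmod x * Cmod x + r * r)).
  { apply cmean_re_le; [unfold r; lra| |].
    - intros y Hy. apply Cdiff_cont, Hh. rewrite Hy. unfold r. lra.
    - intros y Hy. assert (Ay : A y) by (apply Hball; rewrite Hy; unfold r; lra).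
      specialize (Hx y Ay). unfold N in Hx at 1.
      assert (E := Cmod_sqr_plus x (y - x)). replace (x + (y - x))%C with y in E by ring.
      rewrite Hy in E. rewrite E in Hx.
      assert (F : fst (h y) = fst (a * v y)%C + 2 * e * fst (Cconj x * (y - x))%C).
      { unfold h. simpl. ring. }
      rewrite F. assert (G := Cmod_fst (a * v y)%C). rewrite Cmod_mult, Ha, Rmult_1_l in G.
      assert (G' := Rle_abs (fst (a * v y)%C)). lra. }
  rewrite Mh in Bh. unfold h in Bh at 1. rewrite Hax in Bh.
  replace (RtoC (2 * e) * Cconj x * (x - x))%C with (RtoC 0) in Bh by ring.
  assert (F : fst (RtoC (Cmod (v x)) + RtoC 0)%C = Cmod (v x)) by (simpl; ring).
  rewrite F in Bh. unfold N in Bh.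
  assert (Hr : 0 < r) by (unfold r; lra).
  assert (0 < e * (r * r)) by (apply Rmult_lt_0_compat; nra).
  lra.
Qed.

Lemma pow_near_1 : forall n eps, 0 < eps -> exists t, 0 < t /\ (1 + t) ^ n < 1 + eps.
Proof.
  induction n as [|n IH]; intros eps He.
  - exists 1. simpl. lra.
  - destruct (IH (eps / 3) ltac:(lra)) as [t [Ht H]].
    exists (Rmin t (Rmin 1 (eps / 3))). split; [repeat apply Rmin_pos; lra|].
    set (s := Rmin t (Rmin 1 (eps / 3))).
    assert (M1 : s <= t) by apply Rmin_l.
    assert (M2 : s <= 1) by (apply Rle_trans with (1 := Rmin_r _ _), Rmin_l).
    assert (M3 : s <= eps / 3) by (apply Rle_trans with (1 := Rmin_r _ _), Rmin_r).
    assert (M0 : 0 < s) by (repeat apply Rmin_pos; lra).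
    assert (Hs : (1 + s) ^ n <= (1 + t) ^ n) by (apply pow_incr; lra).
    assert (Hp : 0 < (1 + s) ^ n) by (apply pow_lt; lra).
    simpl. nra.
Qed.

(** Boundedness near [e1] and [e2], which may also lie on the boundary circle,
    is enough: applied to [u^n (z - e1)(z - e2)], whose modulus tends to zero
    there, the maximum principle bounds all powers of [u]. *)
Lemma max_principle_disc : forall (u : C -> C) (R0 : R) (e1 e2 : C), 0 < R0 ->
  (forall z, Cmod z < R0 -> z <> e1 -> z <> e2 -> Cdiff u z) ->
  (forall e, e = e1 \/ e = e2 -> exists B,
     near e (fun z => Cmod z < R0 -> z <> e1 -> z <> e2 -> Cmod (u z) <= B)) ->
  (forall b, Cmod b = R0 -> b <> e1 -> b <> e2 -> forall eps, 0 < eps ->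
     near b (fun z => Cmod z < R0 -> z <> e1 -> z <> e2 -> Cmod (u z) <= 1 + eps)) ->
  forall z, Cmod z < R0 -> z <> e1 -> z <> e2 -> Cmod (u z) <= 1.
Proof.
  intros u R0 e1 e2 HR Hu Hb Hbd.
  set (A := fun z => Cmod z < R0 /\ z <> e1 /\ z <> e2).
  set (D := R0 + Cmod e1 + Cmod e2).
  assert (P1 := Cmod_ge_0 e1). assert (P2 := Cmod_ge_0 e2).
  assert (HD : 0 < D) by (unfold D; lra).
  assert (HDC : RtoC D <> 0) by (intros E; apply RtoC_inj in E; lra).
  set (v := fun n z => (u z ^ n * ((z - e1) / RtoC D) * ((z - e2) / RtoC D))%C).
  set (q := fun z e => Cmod (z - e)%C / D).
  assert (Hvm : forall n z, Cmod (v n z) = Cmod (u z) ^ n * q z e1 * q z e2).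
  { intros n z. unfold v. rewrite !Cmod_mult, Cmod_pow, !Cmod_div, Cmod_RtoC_pos by (auto; lra).
    reflexivity. }
  assert (Hq : forall z e, Cmod z < R0 -> e = e1 \/ e = e2 -> 0 <= q z e <= 1).
  { intros z e Hz He. assert (T := Cmod_sub_triangle z e). split.
    - apply Rmult_le_pos; [apply Cmod_ge_0 | left; now apply Rinv_0_lt_compat].
    - apply Rle_div_l; [exact HD|]. unfold D. destruct He as [-> | ->]; lra. }
  assert (Hvq : forall n z e, Cmod z < R0 -> e = e1 \/ e = e2 ->
    Cmod (v n z) <= Cmod (u z) ^ n * q z e /\ Cmod (u z) ^ n * q z e <= Cmod (u z) ^ n).
  { intros n z e Hz He. rewrite Hvm. assert (Q1 := Hq z e1 Hz ltac:(auto)).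
    assert (Q2 := Hq z e2 Hz ltac:(auto)). assert (U := pow_le _ n (Cmod_ge_0 (u z))).
    assert (0 <= Cmod (u z) ^ n * q z e1) by (apply Rmult_le_pos; lra).
    assert (0 <= Cmod (u z) ^ n * q z e2) by (apply Rmult_le_pos; lra).
    destruct He as [-> | ->]; nra. }
  assert (Hv : forall n z, A z -> Cmod (v n z) <= 1).
  { intros n. apply max_principle with R0.
    - intros z Hz. left. apply Hz.
    - intros z [Z1 [Z2 Z3]]. exact (near_and (near_lt z R0 Z1) (near_and (near_neq z e1 Z2) (near_neq z e2 Z3))).
    - intros z [Z1 [Z2 Z3]]. unfold v. cdiff; auto.
    - intros eps s x Heps Hs Hx Hsv.
      assert (Hxr : Cmod x <= R0).
      { apply Cconv_mod_le with (1 := Hx) (N := O). intros k _. left. apply Hs. }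
      (* Where [u] stays below [B], so does its power; this contradicts the
         lower bound on [v] both near an [e] and near the circle. *)
      assert (Hfar : forall B, near x (fun z => Cmod z < R0 -> z <> e1 -> z <> e2 -> Cmod (u z) <= B) ->
        forall d, 0 < d -> exists k, Cmod (s k - x)%C < d /\ A (s k) /\ Cmod (u (s k)) ^ n <= B ^ n).
      { intros B [d1 [Hd1 HB]] d Hd. destruct (Hx (Rmin d1 d) (Rmin_pos _ _ Hd1 Hd)) as [k Hk].
        specialize (Hk k (le_n k)). rmin. destruct (Hs k) as [S1 [S2 S3]].
        exists k. split; [lra|]. split; [now split|]. apply pow_incr.
        split; [apply Cmod_ge_0 | apply HB; auto; lra]. }
      assert (Hne : forall e, e = e1 \/ e = e2 -> x <> e).
      { intros e He E. destruct (Hb e He) as [B HB]. rewrite <- E in HB.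
        assert (Bn : 0 < Rabs B ^ n + 1) by (assert (P := pow_le _ n (Rabs_pos B)); lra).
        destruct (Hfar B HB _ (Rdiv_lt_0_compat _ _ HD Bn)) as [k [K1 [K2 K3]]].
        specialize (Hsv k). destruct (Hvq n (s k) e (proj1 K2) He) as [V1 V2].
        assert (Q : q (s k) e <= / (Rabs B ^ n + 1)).
        { unfold q. apply Rle_div_l; [exact HD|]. rewrite <- E.
          unfold Rdiv in K1. lra. }
        assert (K4 := Rle_abs (B ^ n)). rewrite <- RPow_abs in K4.
        assert (K5 := pow_le _ n (Cmod_ge_0 (u (s k)))).
        assert (Rabs B ^ n * / (Rabs B ^ n + 1) <= 1) by (apply Rle_div_l; lra).
        assert (Q0 := Hq (s k) e (proj1 K2) He).
        assert (Cmod (u (s k)) ^ n * q (s k) e <= Rabs B ^ n * / (Rabs B ^ n + 1)).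
        { apply Rmult_le_compat; lra. }
        lra. }
      split; [|split; apply Hne; auto].
      destruct (Rle_lt_or_eq_dec _ _ Hxr) as [L|E]; [exact L|]. exfalso.
      destruct (pow_near_1 n eps Heps) as [t [Ht Htn]].
      destruct (Hfar _ (Hbd x E (Hne e1 ltac:(auto)) (Hne e2 ltac:(auto)) t Ht) 1 Rlt_0_1)
        as [k [_ [K2 K3]]].
      specialize (Hsv k). destruct (Hvq n (s k) e1 (proj1 K2) ltac:(auto)). lra. }
  intros z Z1 Z2 Z3. apply Rnot_lt_le. intros Hlt.
  assert (Hqq : 0 < q z e1 * q z e2).
  { apply Rmult_lt_0_compat; apply Rdiv_lt_0_compat; auto; now apply Cmod_sub_pos. }
  destruct (Pow_x_infinity (Cmod (u z))) with (b := / (q z e1 * q z e2) + 1) as [N0 HN].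
  { rewrite Rabs_pos_eq by apply Cmod_ge_0. exact Hlt. }
  specialize (HN N0 (le_n N0)).
  rewrite Rabs_pos_eq in HN by (apply pow_le, Cmod_ge_0).
  assert (H := Hv N0 z (conj Z1 (conj Z2 Z3))). rewrite Hvm, Rmult_assoc in H.
  set (t := q z e1 * q z e2) in *.
  assert (E : (/ t + 1) * t = 1 + t) by (field; lra).
  apply Rge_le in HN. nra.
Qed.

(** Schwarz's lemma. The maximum principle for [u z / (m z)] tolerates isolated
    singularities, so that [u] may be undefined at the origin and at [e]. *)
Lemma schwarz_lemma : forall (u : C -> C) (e : C) m, 0 < m ->
  (forall z, Cmod z < 1 -> z <> RtoC 0 -> z <> e -> Cdiff u z /\ Cmod (u z) <= m) ->
  (exists A, near 0 (fun z => z <> RtoC 0 -> z <> e -> Cmod (u z) <= A * Cmod z)) ->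
  forall z, Cmod z < 1 -> z <> RtoC 0 -> z <> e -> Cmod (u z) <= m * Cmod z.
Proof.
  intros u e m Hm Hu H0 z Hz Nz Nze.
  assert (Nm : RtoC m <> 0) by (intros E; apply RtoC_inj in E; lra).
  assert (Hmod : forall y : C, y <> 0 -> Cmod (u y / (RtoC m * y))%C = Cmod (u y) / (m * Cmod y)).
  { intros y Ny. rewrite Cmod_div, Cmod_mult, Cmod_RtoC_pos by (try lra; now apply Cmult_neq_0).
    reflexivity. }
  assert (Hpos : forall y : C, y <> 0 -> 0 < m * Cmod y).
  { intros y Ny. apply Rmult_lt_0_compat; [exact Hm | now apply Cmod_gt_0]. }
  assert (Hle : forall y, Cmod y < 1 -> y <> RtoC 0 -> y <> e -> forall d, 0 < d < Cmod y ->
    Cmod (u y / (RtoC m * y))%C <= / d).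
  { intros y Hy N1 N2 d Hd. destruct (Hu y Hy N1 N2) as [_ Hy']. rewrite Hmod by exact N1.
    apply Rle_div_l; [now apply Hpos|]. apply Rle_trans with (1 := Hy').
    replace m with (/ d * (m * d)) at 1 by (field; lra).
    apply Rmult_le_compat_l; [left; apply Rinv_0_lt_compat; lra | nra]. }
  assert (MP : Cmod (u z / (RtoC m * z))%C <= 1).
  { apply (max_principle_disc (fun y => u y / (RtoC m * y))%C 1 0 e Rlt_0_1); auto.
    - intros y Hy N1 N2. cdiff; [now apply Hu | now apply Cmult_neq_0].
    - intros e' He'. destruct (Ceq_dec e' 0) as [->|Ne'].
      + destruct H0 as [A HA]. exists (A / m). apply near_mono with (1 := HA).
        intros y HyA Hy N1 N2. rewrite Hmod by exact N1.
        apply Rle_div_l; [now apply Hpos|].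
        replace (A / m * (m * Cmod y)) with (A * Cmod y) by (field; lra). auto.
      + destruct He' as [->| ->]; [easy|]. assert (Pe : 0 < Cmod e) by now apply Cmod_gt_0.
        exists (/ (Cmod e / 2)). exists (Cmod e / 2). split; [lra|]. intros y Hyd Hy N1 N2.
        assert (T := Cmod_rev_triangle e y). rewrite Cmod_sub_sym in T. apply Hle; auto; lra.
    - intros b Hb N1 N2 eps He. exists (eps / (1 + eps)).
      split; [apply Rdiv_lt_0_compat; lra|]. intros y Hyd Hy M1 M2.
      assert (T := Cmod_rev_triangle b y). rewrite Cmod_sub_sym in T.
      assert (E : / (1 + eps) = 1 - eps / (1 + eps)) by (field; lra).
      rewrite <- (Rinv_inv (1 + eps)). apply Hle; auto.
      split; [apply Rinv_0_lt_compat|]; lra. }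
  rewrite Hmod in MP by exact Nz. apply Rle_div_l in MP; [lra | now apply Hpos].
Qed.

(** * Cauchy's formula and its consequences *)

Lemma off_circle : forall (y c w : C) r, Cmod (y - c)%C = r -> Cmod (w - c)%C < r ->
  r - Cmod (w - c)%C <= Cmod (y - w)%C /\ (y - w)%C <> 0.
Proof.
  intros y c w r Hy Hw. assert (H := Cmod_rev_triangle (y - c) (w - c)).
  replace (y - c - (w - c))%C with (y - w)%C in H by ring. rewrite Hy in H.
  split; [exact H|]. apply Cmod_gt_0. lra.
Qed.

(** The mean is independent of the radius and tends to zero when that grows. *)
Lemma cmean_kernel_0 : forall c w r, Cmod (w - c)%C < r ->
  cmean (fun y => / (y - w))%C c r = 0.
Proof.
  intros c w r Hw. assert (P := Cmod_ge_0 (w - c)%C).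
  apply Ceq_eps. intros eps He.
  set (r' := Rmax r (Cmod (w - c)%C + 2 / eps)).
  assert (M1 : r <= r') by apply Rmax_l.
  assert (M2 : Cmod (w - c)%C + 2 / eps <= r') by apply Rmax_r.
  assert (Q : 0 < 2 / eps) by (apply Rdiv_lt_0_compat; lra).
  assert (Hd : forall y : C, r <= Cmod (y - c)%C -> Cdiff (fun y => / (y - w))%C y).
  { intros y Hy. cdiff. apply (off_circle y c w (Cmod (y - c)%C)); [reflexivity | lra]. }
  rewrite (cmean_annulus _ c r r') by (try lra; intros y Hy; apply Hd; lra).
  replace (cmean (fun y => / (y - w))%C c r' - 0)%C with (cmean (fun y => / (y - w))%C c r')
    by ring.
  apply Rle_lt_trans with (eps / 2); [|lra].
  apply cmean_bound; [lra| |].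
  - intros y Hy. apply Cdiff_cont, Hd. lra.
  - intros y Hy. destruct (off_circle y c w r' Hy ltac:(lra)) as [H1 H2].
    rewrite Cmod_inv by exact H2. replace (eps / 2) with (/ (2 / eps)) by (field; lra).
    apply Rinv_le_contravar; lra.
Qed.

(** The Cauchy integral of [psi] over a circle, up to normalisation. *)
Definition cauchy_int (psi : C -> C) (c : C) (r : R) (w : C) : C :=
  cmean (fun y => psi y * / (y - w))%C c r.

Lemma kernel_circle : forall psi c w r, cont_circle psi c r -> Cmod (w - c)%C < r ->
  cont_circle (fun y => psi y * / (y - w))%C c r.
Proof.
  intros psi c w r H Hw y Hy. apply Ccont_mult; [now apply H|]. apply Cdiff_cont. cdiff.
  now apply (off_circle y c w r).
Qed.

Lemma cauchy_int_bound : forall psi c w r M, cont_circle psi c r -> Cmod (w - c)%C < r ->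
  (forall y : C, Cmod (y - c)%C = r -> Cmod (psi y) <= M) ->
  Cmod (cauchy_int psi c r w) <= M / (r - Cmod (w - c)%C).
Proof.
  intros psi c w r M H Hw HM. assert (P := Cmod_ge_0 (w - c)%C).
  apply cmean_bound; [lra | now apply kernel_circle|]. intros y Hy.
  destruct (off_circle y c w r Hy Hw) as [L N]. rewrite Cmod_mult, Cmod_inv by exact N.
  apply Rmult_le_compat; [apply Cmod_ge_0 | left; apply Rinv_0_lt_compat; lra | now apply HM |].
  apply Rinv_le_contravar; lra.
Qed.

(** Partial fractions:
    [1 / (y - w) = 1 / (y - v) + (w - v) / ((y - v) (y - w))]. *)
Lemma cauchy_int_split : forall psi c w v r, cont_circle psi c r ->
  Cmod (w - c)%C < r -> Cmod (v - c)%C < r ->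
  cauchy_int psi c r w = (cauchy_int psi c r v
    + cauchy_int (fun y => psi y * / (y - v)) c r w * (w - v))%C.
Proof.
  intros psi c w v r H Hw Hv. assert (P := Cmod_ge_0 (w - c)%C). assert (Hk := kernel_circle psi c v r H Hv).
  unfold cauchy_int. rewrite Cmult_comm, <- cmean_scal by (try lra; now apply kernel_circle).
  rewrite <- cmean_plus; [| lra | exact Hk |].
  - apply cmean_ext; [lra|]. intros y Hy. destruct (off_circle y c w r Hy Hw) as [_ N].
    destruct (off_circle y c v r Hy Hv) as [_ N']. field. auto.
  - intros y Hy. apply Ccont_mult; [apply Ccont_const | exact (kernel_circle _ c w r Hk Hw y Hy)].
Qed.

(** The mean value property of [k y (y - c)], where [k] is the difference quotient
    of [f] at [w]: holomorphic off [w], and still continuous at [w]. *)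
Lemma Cauchy_formula : forall f c w r R0, r < R0 -> Cmod (w - c)%C < r ->
  (forall z : C, Cmod (z - c)%C < R0 -> Cdiff f z) ->
  cauchy_int (fun y => f y * (y - c))%C c r w = f w.
Proof.
  intros f c w r R0 Hr Hw Hf. assert (P := Cmod_ge_0 (w - c)%C).
  destruct (Hf w ltac:(lra)) as [l Hl]. apply is_derive_slope in Hl.
  destruct Hl as [k [Hk [_ Ek]]].
  assert (Hkd : forall y : C, Cmod (y - c)%C < R0 -> y <> w -> Cdiff k y).
  { intros y Hy N. apply Cdiff_ext_loc with (f := fun y => ((f y - f w) / (y - w))%C).
    - apply near_mono with (1 := near_neq y w N). intros x Nx. rewrite (Ek x). field.
      now apply Cminus_eq_contra.
    - cdiff; [now apply Hf|]. now apply Cminus_eq_contra. }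
  assert (Hkc : forall y : C, Cmod (y - c)%C < R0 -> Ccont k y).
  { intros y Hy. destruct (Ceq_dec y w) as [->|N]; [exact Hk|]. now apply Cdiff_cont, Hkd. }
  assert (M := mean_value (fun y => k y * (y - c))%C c w R0
    ltac:(intros y Hy; apply Ccont_mult; [now apply Hkc | apply Cdiff_cont; cdiff])
    ltac:(intros y Hy N; apply (Cdiff_mult k); [now apply Hkd | cdiff]) r ltac:(lra)).
  cbv beta in M. replace (k c * (c - c))%C with (RtoC 0) in M by ring.
  assert (C1 : forall a : C, cont_circle (fun _ => a) c r) by (intros a y _; apply Ccont_const).
  assert (C2 : cont_circle (fun y => / (y - w))%C c r).
  { intros y Hy. apply Cdiff_cont. cdiff. now apply (off_circle y c w r). }
  assert (C3 : cont_circle (fun y => k y * (y - c))%C c r).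
  { intros y Hy. apply Ccont_mult; [apply Hkc; lra | apply Cdiff_cont; cdiff]. }
  assert (C4 : cont_circle (fun y => (w - c) * / (y - w))%C c r).
  { intros y Hy. apply Ccont_mult; [apply Ccont_const | now apply C2]. }
  assert (C5 : cont_circle (fun y => 1 + (w - c) * / (y - w))%C c r).
  { intros y Hy. apply Ccont_plus; [apply Ccont_const | now apply C4]. }
  unfold cauchy_int.
  rewrite (cmean_ext _ (fun y => k y * (y - c) + f w * (1 + (w - c) * / (y - w)))%C) by
    (first [lra | intros y Hy; destruct (off_circle y c w r Hy Hw) as [_ N]; rewrite (Ek y); field; exact N]).
  rewrite cmean_plus, M, cmean_scal, cmean_plus, cmean_scal, cmean_const, cmean_kernel_0 by
    (first [lra | solve [auto] | intros y Hy; apply Ccont_mult; [apply Ccont_const | now apply C5]]).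
  ring.
Qed.

(** [y - c] cancels the normalisation of [cauchy_int], so that this is the mean of
    [f y / (y - c)^n]. *)
Definition taylor_coef (f : C -> C) (c : C) (r : R) (n : nat) : C :=
  cauchy_int (fun y => f y * (y - c) * (/ (y - c)) ^ n)%C c r c.

Lemma taylor_circle : forall f c r n, 0 < r -> (forall z : C, Cmod (z - c)%C = r -> Cdiff f z) ->
  cont_circle (fun y => f y * (y - c) * (/ (y - c)) ^ n)%C c r.
Proof.
  intros f c r n Hr Hf y Hy. apply Cdiff_cont. cdiff; [now apply Hf|]. apply Cmod_gt_0. lra.
Qed.

(** [cauchy_int_split] at the centre, iterated. *)
Lemma taylor_remainder : forall f c w r R0 n, r < R0 -> Cmod (w - c)%C < r ->
  (forall z : C, Cmod (z - c)%C < R0 -> Cdiff f z) ->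
  f w = (sum_n (fun k => taylor_coef f c r k * (w - c) ^ k)%C n
         + cauchy_int (fun y => f y * (y - c) * (/ (y - c)) ^ S n) c r w * (w - c) ^ S n)%C.
Proof.
  intros f c w r R0 n Hr Hw Hf. assert (P := Cmod_ge_0 (w - c)%C).
  assert (S : forall n, cauchy_int (fun y => f y * (y - c) * (/ (y - c)) ^ n)%C c r w =
    (taylor_coef f c r n + cauchy_int (fun y => f y * (y - c) * (/ (y - c)) ^ S n) c r w * (w - c))%C).
  { intros m. rewrite (cauchy_int_split _ c w c r).
    - unfold taylor_coef. f_equal. f_equal. apply cmean_ext; [lra|]. intros y _. simpl. ring.
    - apply taylor_circle; [lra|]. intros z Hz. apply Hf. lra.
    - exact Hw.
    - rewrite Cmod_sub_diag. lra. }
  induction n as [|n IH].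
  - rewrite sum_O, <- (Cauchy_formula f c w r R0 Hr Hw Hf) at 1. specialize (S O).
    transitivity (cauchy_int (fun y => f y * (y - c) * (/ (y - c)) ^ 0)%C c r w).
    + apply cmean_ext; [lra|]. intros y _. simpl. ring.
    + rewrite S. simpl. ring.
  - rewrite sum_Sn, IH, (S (Datatypes.S n)) at 1. change plus with Cplus. simpl. ring.
Qed.

Lemma continuous_circle_bounded : forall f c r, 0 <= r -> cont_circle f c r ->
  exists M, 0 <= M /\ forall y : C, Cmod (y - c)%C = r -> Cmod (f y) <= M.
Proof.
  intros f c r Hr Hf. apply NNPP. intros N.
  assert (Hs : forall n : nat, exists y : C, Cmod (y - c)%C = r /\ INR n < Cmod (f y)).
  { intros n. apply NNPP. intros N1. apply N. exists (INR n). split; [apply pos_INR|].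
    intros y Hy. apply Rnot_lt_le. intros H. apply N1. now exists y. }
  apply choice in Hs. destruct Hs as [u Hu].
  destruct (Cbounded_subseq u (Cmod c + r)) as [phi [x [Hphi Hx]]].
  { intros n. destruct (Hu n) as [H1 _]. assert (H := Cmod_rev_triangle (u n) c). lra. }
  assert (Hxc : Cmod (x - c)%C = r).
  { assert (Hx' : Cconv (fun n => 1 * u (phi n) + (- (1)) * c)%C (1 * x + (- (1)) * c)%C).
    { apply Cconv_lin with (v := fun _ => c); [exact Hx|]. intros eps He. exists O. intros n _.
      replace (c - c)%C with (RtoC 0) by ring. now rewrite Cmod_0. }
    assert (E : forall z : C, (1 * z + - (1) * c)%C = (z - c)%C) by (intros; ring).
    rewrite E in Hx'. apply Rle_antisym.
    - apply Cconv_mod_le with (1 := Hx') (N := O). intros n _. rewrite E. right. apply Hu.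
    - apply Cconv_mod_ge with (1 := Hx') (N := O). intros n _. rewrite E. right. symmetry. apply Hu. }
  destruct (Ccont_bounded f x (Hf x Hxc)) as [d [Hd Hb]].
  destruct (Hx d Hd) as [N0 HN].
  destruct (INR_unbounded (Cmod (f x) + 1)) as [N1 HN1].
  set (k := (N0 + N1)%nat). specialize (HN k ltac:(unfold k; lia)).
  specialize (Hb _ HN). destruct (Hu (phi k)) as [_ H2].
  assert (H3 : INR N1 <= INR (phi k)) by (apply le_INR; specialize (Hphi k); unfold k in *; lia).
  lra.
Qed.

Lemma taylor_series : forall f c r R0 w, r < R0 -> Cmod (w - c)%C < r ->
  (forall z : C, Cmod (z - c)%C < R0 -> Cdiff f z) ->
  Cconv (fun n => sum_n (fun k => taylor_coef f c r k * (w - c) ^ k)%C n) (f w).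
Proof.
  intros f c r R0 w Hr Hw Hf eps He. assert (P := Cmod_ge_0 (w - c)%C).
  assert (Dc : forall z : C, Cmod (z - c)%C = r -> Cdiff f z) by (intros z Hz; apply Hf; lra).
  destruct (continuous_circle_bounded f c r ltac:(lra)) as [M [HM0 HM]].
  { intros y Hy. now apply Cdiff_cont, Dc. }
  set (q := Cmod (w - c)%C / r). set (s := r - Cmod (w - c)%C).
  assert (Hs : 0 < s) by (unfold s; lra).
  assert (Hq : 0 <= q < 1).
  { split; [apply Rmult_le_pos; [exact P | left; apply Rinv_0_lt_compat; lra] | apply Rlt_div_l; lra]. }
  set (B := M * r / s). assert (HB : 0 <= B) by (apply Rdiv_le_0_compat; [nra | exact Hs]).
  destruct (pow_lt_1_zero q ltac:(rewrite Rabs_pos_eq; lra) (eps / (B + 1))) as [N HN].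
  { apply Rdiv_lt_0_compat; lra. }
  exists N. intros n Hn. specialize (HN (S n) ltac:(lia)).
  rewrite Rabs_pos_eq in HN by (apply pow_le; lra). apply Rlt_div_r in HN; [|lra].
  rewrite (taylor_remainder f c w r R0 n Hr Hw Hf) at 1.
  set (m := cauchy_int _ c r w). set (S0 := sum_n _ n).
  replace (S0 - (S0 + m * (w - c) ^ S n))%C with (- (m * (w - c) ^ S n))%C by ring.
  rewrite Cmod_opp, Cmod_mult, Cmod_pow.
  assert (Hrn : 0 < r ^ S n) by (apply pow_lt; lra).
  assert (Hm : Cmod m <= M * r * (/ r) ^ S n / s).
  { apply cauchy_int_bound; [now apply taylor_circle; [lra|] | exact Hw |].
    intros y Hy. rewrite !Cmod_mult, Cmod_pow, Cmod_inv, Hy by (apply Cmod_gt_0; lra).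
    apply Rmult_le_compat_r; [apply pow_le; left; apply Rinv_0_lt_compat; lra|].
    apply Rmult_le_compat_r; [lra | now apply HM]. }
  apply Rle_lt_trans with (B * q ^ S n); [|assert (Q := pow_le q (S n) (proj1 Hq)); lra].
  apply Rle_trans with (M * r * (/ r) ^ S n / s * Cmod (w - c)%C ^ S n).
  - apply Rmult_le_compat_r; [now apply pow_le | exact Hm].
  - right. unfold B, q, Rdiv. rewrite Rpow_mult_distr. ring.
Qed.

Lemma Ccont_bounded_mult : forall h v B, near v (fun w => Cmod (h w) <= B) ->
  Ccont (fun w => h w * (w - v))%C v.
Proof.
  intros h v B H eps He. assert (Q : 0 < eps / (Rabs B + 1)).
  { assert (0 <= Rabs B) by apply Rabs_pos. apply Rdiv_lt_0_compat; lra. }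
  eapply near_mono; [exact (near_and H (near_disc v _ Q))|]. intros w [Hw Hd].
  replace (v - v)%C with (RtoC 0) by ring. rewrite Cmult_0_r, Csub_0_r, Cmod_mult.
  assert (P := Rabs_pos B). assert (P' := Rle_abs B). apply Rlt_div_r in Hd; [|lra].
  assert (P2 := Cmod_ge_0 (w - v)%C). nra.
Qed.

Lemma cauchy_int_cont : forall psi c v r, cont_circle psi c r -> Cmod (v - c)%C < r ->
  Ccont (cauchy_int psi c r) v.
Proof.
  intros psi c v r H Hv. assert (P := Cmod_ge_0 (v - c)%C). assert (Hk := kernel_circle psi c v r H Hv).
  destruct (continuous_circle_bounded _ c r ltac:(lra) Hk) as [M [HM0 HM]].
  set (s := (r - Cmod (v - c)%C) / 2). assert (Hs : 0 < s) by (unfold s; lra).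
  eapply Ccont_ext_loc.
  { apply near_mono with (1 := near_ball v c r Hv). intros w Hw. symmetry.
    apply (cauchy_int_split psi c w v r H Hw Hv). }
  apply Ccont_plus; [apply Ccont_const|]. apply (Ccont_bounded_mult _ v (M / s)).
  apply near_mono with (1 := near_ball v c (r - s) ltac:(unfold s; lra)). intros w Hw.
  apply Rle_trans with (1 := cauchy_int_bound _ c w r M Hk ltac:(lra) HM).
  apply Rmult_le_compat_l; [exact HM0|]. apply Rinv_le_contravar; lra.
Qed.

(** By [cauchy_int_split] the difference quotients of a Cauchy integral are Cauchy
    integrals, hence continuous. *)
Lemma cauchy_int_derive : forall psi c v r, cont_circle psi c r -> Cmod (v - c)%C < r ->
  is_derive (cauchy_int psi c r) v (cauchy_int (fun y => psi y * / (y - v))%C c r v).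
Proof.
  intros psi c v r H Hv. eapply Cderive_ext_loc.
  - apply near_mono with (1 := near_ball v c r Hv). intros w Hw. symmetry.
    apply (cauchy_int_split psi c w v r H Hw Hv).
  - apply is_derive_slope. exists (cauchy_int (fun y => psi y * / (y - v))%C c r).
    split; [apply cauchy_int_cont; [now apply kernel_circle | exact Hv]|].
    split; [reflexivity|]. intros w. ring.
Qed.

Lemma cauchy_int_derive_split : forall psi c w v r, cont_circle psi c r ->
  Cmod (w - c)%C < r -> Cmod (v - c)%C < r ->
  cauchy_int (fun y => psi y * / (y - w))%C c r w =
    (cauchy_int (fun y => psi y * / (y - v)) c r w
     + cauchy_int (fun y => psi y * / (y - v) * / (y - w)) c r w * (w - v))%C.
Proof.
  intros psi c w v r H Hw Hv. assert (P := Cmod_ge_0 (v - c)%C).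
  rewrite (cauchy_int_split _ c w v r (kernel_circle psi c w r H Hw) Hw Hv).
  f_equal; [|f_equal]; apply cmean_ext; try lra; intros y _; ring.
Qed.

Lemma cauchy_int_derive_cont : forall psi c v r, cont_circle psi c r -> Cmod (v - c)%C < r ->
  Ccont (fun w => cauchy_int (fun y => psi y * / (y - w))%C c r w) v.
Proof.
  intros psi c v r H Hv. assert (P := Cmod_ge_0 (v - c)%C). assert (Hk := kernel_circle psi c v r H Hv).
  destruct (continuous_circle_bounded _ c r ltac:(lra) Hk) as [M [HM0 HM]].
  set (s := (r - Cmod (v - c)%C) / 2). assert (Hs : 0 < s) by (unfold s; lra).
  eapply Ccont_ext_loc.
  { apply near_mono with (1 := near_ball v c r Hv). intros w Hw. symmetry.
    apply (cauchy_int_derive_split psi c w v r H Hw Hv). }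
  apply Ccont_plus; [now apply cauchy_int_cont|].
  apply (Ccont_bounded_mult _ v (M * / s / s)).
  apply near_mono with (1 := near_ball v c (r - s) ltac:(unfold s; lra)). intros w Hw.
  assert (HMs : 0 <= M * / s) by now apply Rdiv_le_0_compat.
  apply Rle_trans with (M * / s / (r - Cmod (w - c)%C)).
  - apply cauchy_int_bound; [apply kernel_circle; auto; lra | lra |]. intros y Hy.
    destruct (off_circle y c w r Hy ltac:(lra)) as [L N]. rewrite Cmod_mult, (Cmod_inv (y - w)) by exact N.
    apply Rmult_le_compat; [apply Cmod_ge_0 | left; apply Rinv_0_lt_compat; lra | now apply HM |].
    apply Rinv_le_contravar; lra.
  - apply Rmult_le_compat_l; [exact HMs|]. apply Rinv_le_contravar; lra.
Qed.

(** A holomorphic function has a holomorphic derivative, and so are its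
    difference quotients, also at the base point: near [c] all of them are
    Cauchy integrals. *)
Lemma holo_slope : forall (f f1 : C -> C) c R0, 0 < R0 ->
  (forall z : C, Cmod (z - c)%C < R0 -> is_derive f z (f1 z)) ->
  Cdiff f1 c /\ exists k, Cdiff k c /\ k c = f1 c /\
    near c (fun z => f z = f c + k z * (z - c))%C.
Proof.
  intros f f1 c R0 HR Hf. set (r := R0 / 2). assert (Hr : 0 < r < R0) by (unfold r; lra).
  assert (Hfd : forall z : C, Cmod (z - c)%C < R0 -> Cdiff f z) by (intros z Hz; eexists; eauto).
  set (phi := fun y => (f y * (y - c))%C).
  assert (Hphi : cont_circle phi c r).
  { intros y Hy. apply Cdiff_cont. unfold phi. cdiff. apply Hfd. lra. }
  assert (Hcc : Cmod (c - c)%C < r) by now rewrite Cmod_sub_diag.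
  assert (Hk := kernel_circle phi c c r Hphi Hcc).
  assert (Cf : forall w : C, Cmod (w - c)%C < r -> cauchy_int phi c r w = f w).
  { intros w Hw. now apply (Cauchy_formula f c w r R0). }
  assert (E1 : forall w : C, Cmod (w - c)%C < r -> f1 w = cauchy_int (fun y => phi y * / (y - w))%C c r w).
  { intros w Hw. apply Cderive_unique with f w; [apply Hf; lra|].
    apply Cderive_ext_loc with (f := cauchy_int phi c r); [|now apply cauchy_int_derive].
    apply near_mono with (1 := near_ball w c r Hw). exact Cf. }
  split.
  - set (psi := (fun y => phi y * / (y - c))%C) in *.
    apply Cdiff_ext_loc with (f := fun w => (cauchy_int psi c r c
      + (cauchy_int (fun y => psi y * / (y - c)) c r w
         + cauchy_int (fun y => psi y * / (y - w)) c r w) * (w - c))%C).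
    + apply near_mono with (1 := near_ball c c r Hcc). intros w Hw. rewrite (E1 w Hw).
      rewrite (cauchy_int_derive_split phi c w c r Hphi Hw Hcc). fold psi.
      rewrite (cauchy_int_split psi c w c r Hk Hw Hcc). unfold psi. ring.
    + eexists. apply is_derive_slope. exists (fun w => cauchy_int (fun y => psi y * / (y - c)) c r w
        + cauchy_int (fun y => psi y * / (y - w)) c r w)%C.
      split; [|split; [reflexivity | intros y; ring]]. apply Ccont_plus; [apply cauchy_int_cont; auto; now apply kernel_circle|].
      now apply cauchy_int_derive_cont.
  - exists (cauchy_int (fun y => phi y * / (y - c))%C c r).
    split; [eexists; now apply cauchy_int_derive|]. split; [symmetry; now apply E1|].
    apply near_mono with (1 := near_ball c c r Hcc). intros z Hz.
    rewrite <- (Cf z Hz), <- (Cf c Hcc). now apply cauchy_int_split.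
Qed.

(** An injective holomorphic function is open: if [v] near [f c] were omitted
    near [c], then [1/(f - v)] would violate the mean value property. *)
Lemma open_mapping : forall (f : C -> C) c R0, 0 < R0 ->
  (forall z : C, Cmod (z - c)%C < R0 -> Cdiff f z) ->
  (forall z w : C, Cmod (z - c)%C < R0 -> Cmod (w - c)%C < R0 -> f z = f w -> z = w) ->
  near (f c) (fun v => exists z : C, Cmod (z - c)%C < R0 /\ f z = v).
Proof.
  intros f c R0 HR Hf Hinj. set (r := R0 / 2).
  assert (Hne : forall y : C, Cmod (y - c)%C = r -> (f y - f c)%C <> 0).
  { intros y Hy. apply Cminus_eq_contra. intros E.
    assert (y = c) by (apply Hinj; [rewrite Hy; unfold r | rewrite Cmod_sub_diag |]; auto; lra).
    subst y. rewrite Cmod_sub_diag in Hy. unfold r in Hy. lra. }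
  destruct (continuous_circle_bounded (fun y => / (f y - f c))%C c r ltac:(unfold r; lra)) as [M [HM0 HM]].
  { intros y Hy. apply Cdiff_cont. cdiff; [apply Hf; unfold r in Hy; lra | now apply Hne]. }
  set (m := / (M + 1)). assert (Hm : 0 < m) by (apply Rinv_0_lt_compat; lra).
  assert (Hlow : forall y : C, Cmod (y - c)%C = r -> m <= Cmod (f y - f c)%C).
  { intros y Hy. specialize (HM y Hy). rewrite Cmod_inv in HM by now apply Hne.
    assert (Hp : 0 < Cmod (f y - f c)%C) by now apply Cmod_gt_0, Hne.
    rewrite <- (Rinv_inv (Cmod (f y - f c)%C)). apply Rinv_le_contravar; [now apply Rinv_0_lt_compat | lra]. }
  exists (m / 2). split; [lra|]. intros v Hv. apply NNPP. intros N.
  assert (Nv : forall z : C, Cmod (z - c)%C < R0 -> (f z - v)%C <> 0).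
  { intros z Hz. apply Cminus_eq_contra. intros E. apply N. now exists z. }
  assert (Du : forall z : C, Cmod (z - c)%C < R0 -> Cdiff (fun z => / (f z - v))%C z).
  { intros z Hz. cdiff; [now apply Hf | now apply Nv]. }
  assert (B : Cmod (/ (f c - v))%C <= / (m / 2)).
  { rewrite <- (mean_value_holo _ c R0 Du r ltac:(unfold r; lra)).
    apply cmean_bound; [unfold r; lra | |].
    - intros y Hy. apply Cdiff_cont, Du. rewrite Hy. unfold r. lra.
    - intros y Hy. specialize (Hlow y Hy). rewrite Cmod_inv by (apply Nv; rewrite Hy; unfold r; lra).
      apply Rinv_le_contravar; [lra|]. assert (T := Cmod_rev_triangle (f y - f c) (v - f c)).
      replace (f y - f c - (v - f c))%C with (f y - v)%C in T by ring. lra. }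
  assert (Nc : (f c - v)%C <> 0) by (apply Nv; rewrite Cmod_sub_diag; lra).
  rewrite Cmod_inv in B by exact Nc. rewrite Cmod_sub_sym in Hv. revert B.
  apply Rlt_not_le, Rinv_lt_contravar; [|exact Hv].
  apply Rmult_lt_0_compat; [now apply Cmod_gt_0 | lra].
Qed.

(** * Functions on the punctured disc *)

Definition pdisc (z : C) : Prop := 0 < Cmod z < 1.

Lemma pdisc_neq_0 : forall z, pdisc z -> z <> 0.
Proof. intros z [H _]. now apply Cmod_gt_0. Qed.

Lemma pdisc_intro : forall z : C, z <> 0 -> Cmod z < 1 -> pdisc z.
Proof. intros z N H. split; [now apply Cmod_gt_0 | exact H]. Qed.

Lemma pdisc_open : forall z, pdisc z -> near z pdisc.
Proof.
  intros z Hz. eapply near_mono.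
  - exact (near_and (near_neq z 0 (pdisc_neq_0 z Hz)) (near_lt z 1 (proj2 Hz))).
  - intros y [H1 H2]. now apply pdisc_intro.
Qed.

Lemma pdisc_rot : forall b z, Cmod b = 1 -> pdisc z -> pdisc (b * z)%C.
Proof. intros b z Hb Hz. unfold pdisc. now rewrite Cmod_mult, Hb, Rmult_1_l. Qed.

(** Takes the left half-plane to the unit disc and [-1] to [0]. *)
Definition cayley (T : C) : C := ((T + 1) / (T - 1))%C.

Lemma Cconj_sqr : forall z : C, (Cconj z * z)%C = RtoC (Cmod z * Cmod z).
Proof.
  intros z. rewrite Cmod_sqr. unfold Cconj, Cmult, RtoC. simpl. f_equal; ring.
Qed.

Lemma Re_div : forall a b : C, b <> 0 ->
  fst (a / b)%C = fst (a * Cconj b)%C / (Cmod b * Cmod b).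
Proof.
  intros a b Hb. assert (Hp : 0 < Cmod b) by now apply Cmod_gt_0.
  assert (Nb : Cconj b <> 0) by (apply Cmod_gt_0; rewrite Cmod_conj; lra).
  assert (Nr : RtoC (Cmod b * Cmod b) <> 0) by (intros E; apply RtoC_inj in E; nra).
  replace (a / b)%C with (RtoC (/ (Cmod b * Cmod b)) * (a * Cconj b))%C.
  - simpl. field. lra.
  - rewrite RtoC_inv by nra. rewrite <- Cconj_sqr in *. field. auto.
Qed.

Lemma cayley_bounds : forall T : C, fst T <= 0 ->
  (T - 1)%C <> 0 /\ Cmod (cayley T) <= 1 /\ Cmod (cayley T) <= Cmod (T + 1)%C.
Proof.
  intros T HT. set (D := (T - 1)%C).
  assert (FD : fst D = fst T - 1) by reflexivity.
  assert (H1 : 1 <= Cmod D).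
  { assert (Q := Cmod_fst D). rewrite FD, Rabs_left in Q; lra. }
  assert (ND : D <> 0) by (apply Cmod_gt_0; lra).
  assert (Q := Cmod_ge_0 (T + 1)%C).
  assert (H2 : Cmod (T + 1)%C <= Cmod D).
  { assert (P := Cmod_sqr D). assert (P' := Cmod_sqr (T + 1)%C).
    assert (F' : fst (T + 1)%C = fst T + 1) by reflexivity.
    assert (S : snd D = snd T) by (unfold D; simpl; ring). assert (S' : snd (T + 1)%C = snd T) by (simpl; ring).
    rewrite FD, S in P. rewrite F', S' in P'. apply Rnot_lt_le. intros L. nra. }
  split; [exact ND|]. unfold cayley. fold D. rewrite Cmod_div by exact ND.
  split; apply Rle_div_l; nra.
Qed.

Lemma Cmod_Cexp_le_1 : forall z, Cmod (Cexp z) <= 1 <-> fst z <= 0.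
Proof.
  intros z. rewrite Cmod_Cexp, <- exp_0. split; intros H.
  - apply Rnot_lt_le. intros L. apply exp_increasing in L. lra.
  - now apply exp_le_mono.
Qed.

(** The maximum principle for [exp T], with isolated singularities at the origin and
    at the boundary point [w]. *)
Lemma re_max_principle : forall (T : C -> C) w, pdisc w ->
  (forall z, pdisc z -> Cmod z <= Cmod w -> z <> w -> Cdiff T z) ->
  (forall z, pdisc z -> Cmod z = Cmod w -> z <> w -> fst (T z) <= 0) ->
  (exists B, near 0 (fun z => z <> 0 -> Cmod (T z) <= B)) ->
  (exists B, near w (fun z => z <> w -> Cmod (T z) <= B)) ->
  forall z : C, z <> 0 -> Cmod z < Cmod w -> fst (T z) <= 0.
Proof.
  intros T w [Hw0 Hw1] HT Hc H0 H1 z Nz Hz.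
  assert (Pd : forall y : C, Cmod y <= Cmod w -> y <> 0 -> pdisc y) by (intros; apply pdisc_intro; auto; lra).
  assert (HE : forall y, Cmod y <= Cmod w -> y <> 0 -> y <> w -> Cdiff (fun y => Cexp (T y)) y).
  { intros y Hy N1 N2. apply (Cdiff_comp Cexp T); [now apply HT; [apply Pd|..] | eexists; apply Cexp_derive]. }
  assert (Hexp : forall y B, Cmod (T y) <= B -> Cmod (Cexp (T y)) <= exp B).
  { intros y B H. rewrite Cmod_Cexp. apply exp_le_mono.
    assert (Q := Cmod_fst (T y)). assert (Q' := Rle_abs (fst (T y))). lra. }
  apply Cmod_Cexp_le_1.
  apply (max_principle_disc (fun y => Cexp (T y)) (Cmod w) 0 w Hw0); auto.
  - intros y Hy. apply HE. lra.
  - intros e [-> | ->]; [destruct H0 as [B HB] | destruct H1 as [B HB]]; exists (exp B);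
      apply near_mono with (1 := HB); intros y Hy _ N1 N2; auto.
  - intros b Hb N1 N2 eps He.
    assert (Cb := Cdiff_cont _ _ (HE b ltac:(lra) N1 N2)).
    apply near_mono with (1 := Cb eps He). intros y Hy _ _ _.
    assert (R := Cmod_rev_triangle (Cexp (T y)) (Cexp (T b))).
    assert (L := proj2 (Cmod_Cexp_le_1 (T b)) (Hc b (Pd b ltac:(lra) N1) Hb N2)). lra.
  - intros ->. lra.
Qed.

(** * Maps of the punctured disc onto the complement of a convex set *)

(** The functions of the class under study, in a coordinate in which the pole is
    the origin; [F1] is the derivative of [F], and [G] is [F] with the pole
    divided out. *)
Record concave_map (F F1 G : C -> C) (K : C -> Prop) : Prop := {
  cm_convex : convex_set K;
  cm_derive : forall z, pdisc z -> is_derive F z (F1 z);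
  cm_derive_neq_0 : forall z, pdisc z -> F1 z <> 0;
  cm_inj : forall z w, pdisc z -> pdisc w -> F z = F w -> z = w;
  cm_avoid : forall z, pdisc z -> ~ K (F z);
  cm_onto : forall v, ~ K v -> exists z, pdisc z /\ F z = v;
  cm_diff_G : forall z, Cmod z < 1 -> Cdiff G z;
  cm_residue : G 0 <> 0;
  cm_G : forall z, pdisc z -> F z = (G z / z)%C }.

Arguments cm_convex {F F1 G K}.
Arguments cm_derive {F F1 G K}.
Arguments cm_derive_neq_0 {F F1 G K}.
Arguments cm_inj {F F1 G K}.
Arguments cm_avoid {F F1 G K}.
Arguments cm_onto {F F1 G K}.
Arguments cm_diff_G {F F1 G K}.
Arguments cm_residue {F F1 G K}.
Arguments cm_G {F F1 G K}.

(** The counterpart for [F] of the expression whose real part is positive when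
    [F] is replaced by a function with convex image. *)
Definition two_point (F F1 : C -> C) (z w : C) : C :=
  (2 * (z * F1 z / (F z - F w)) - (z + w) / (z - w))%C.

Section ConcaveMap.

Context {F F1 G : C -> C} {K : C -> Prop} (CM : concave_map F F1 G K).

Lemma cm_diff : forall z, pdisc z -> Cdiff F z.
Proof. intros z Hz. exists (F1 z). now apply (cm_derive CM). Qed.

Lemma cm_cont_G_0 : Ccont G 0.
Proof. apply Cdiff_cont, (cm_diff_G CM). rewrite Cmod_0. lra. Qed.

Lemma cm_pole_large : forall M, near 0 (fun z => z <> 0 -> M < Cmod (F z)).
Proof.
  intros M. set (m := Cmod (G 0) / 2).
  assert (Hm : 0 < m) by (unfold m; assert (P := proj1 (Cmod_gt_0 _) (cm_residue CM)); lra).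
  set (M' := Rmax M 1).
  eapply near_mono; [exact (near_and (Ccont_away G 0 0 cm_cont_G_0 (cm_residue CM))
    (near_and (near_disc 0 (m / M') ltac:(apply Rdiv_lt_0_compat; unfold M'; rmin; lra))
              (near_disc 0 1 Rlt_0_1)))|].
  intros z [H1 [H2 H3]] Nz. rewrite !Csub_0_r in *. fold m in H1.
  rewrite (cm_G CM) by now apply pdisc_intro. rewrite Cmod_div by exact Nz.
  assert (Pz : 0 < Cmod z) by now apply Cmod_gt_0. apply Rlt_div_r in H2; [|unfold M'; rmin; lra].
  apply Rlt_div_r; [exact Pz|]. unfold M' in H2. rmin. nra.
Qed.

Lemma cm_open : forall s rho, pdisc s -> 0 < rho ->
  near (F s) (fun v => exists z, pdisc z /\ Cmod (z - s)%C < rho /\ F z = v).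
Proof.
  intros s rho Hs Hrho. destruct (pdisc_open s Hs) as [r [Hr Hball]].
  eapply near_mono; [apply (open_mapping F s (Rmin r rho)); [now apply Rmin_pos | |]|]; cbv beta.
  - intros z Hz. rmin. apply cm_diff, Hball. lra.
  - intros z w Hz Hw. rmin. apply (cm_inj CM); apply Hball; lra.
  - intros v [z [Hz E]]. rmin. exists z. repeat split; try apply Hball; auto; lra.
Qed.

Lemma cm_inv_cont : forall s rho, pdisc s -> 0 < rho ->
  near (F s) (fun v => forall z, pdisc z -> F z = v -> Cmod (z - s)%C < rho).
Proof.
  intros s rho Hs Hrho. apply near_mono with (1 := cm_open s rho Hs Hrho).
  intros v [w [Hw [Hws E]]] z Hz E'. now replace z with w by (apply (cm_inj CM); congruence).
Qed.

(** [1 / F = z / G] extends to an injective function at the origin, so that a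
    neighbourhood of the pole already covers a neighbourhood of infinity. *)
Lemma cm_bounded_away : forall d, 0 < d ->
  exists M, forall z, pdisc z -> d <= Cmod z -> Cmod (F z) <= M.
Proof.
  intros d Hd. destruct (near_and (Ccont_neq G 0 0 cm_cont_G_0 (cm_residue CM))
    (near_and (near_disc 0 d Hd) (near_lt 0 1 ltac:(rewrite Cmod_0; lra)))) as [r [Hr H]].
  assert (HH : forall z : C, Cmod (z - 0)%C < r -> (z / G z)%C = 0 /\ z = 0 \/
    pdisc z /\ (z / G z)%C = (/ F z)%C /\ F z <> 0).
  { intros z Hz. destruct (H z Hz) as [Ng [_ H1]]. destruct (Ceq_dec z 0) as [->|Nz].
    - left. split; [unfold Cdiv; ring | reflexivity].
    - right. assert (Pz := pdisc_intro z Nz H1). rewrite (cm_G CM z Pz).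
      repeat split; try apply Pz; [field; auto|].
      intros E. apply Ng. replace (G z) with (G z / z * z)%C by (field; exact Nz). rewrite E. ring. }
  assert (Ninv : forall v : C, v <> 0 -> (/ v)%C <> 0).
  { intros v Nv E. apply C1_nz. rewrite <- (Cinv_r v Nv), E. ring. }
  destruct (open_mapping (fun z => z / G z)%C 0 r Hr) as [e [He Hl]].
  - intros z Hz. destruct (H z Hz) as [Ng [_ H1]]. cdiff; [now apply (cm_diff_G CM) | exact Ng].
  - intros z w Hz Hw E. cbv beta in E.
    destruct (HH z Hz) as [[E1 ->]|[Pz [E1 N1]]], (HH w Hw) as [[E2 ->]|[Pw [E2 N2]]]; auto.
    + exfalso. apply (Ninv _ N2). congruence.
    + exfalso. apply (Ninv _ N1). congruence.
    + apply (cm_inj CM); auto. rewrite E1, E2 in E.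
      replace (F z) with (/ / F z)%C by (field; auto). rewrite E. field. auto.
  - exists (/ e). intros z Hz Hdz. apply Rnot_lt_le. intros Hlt.
    assert (Hp : 0 < / e) by now apply Rinv_0_lt_compat.
    assert (Nf : F z <> 0) by (apply Cmod_gt_0; lra).
    destruct (Hl (/ F z)%C) as [w [Hw E]].
    { replace (0 / G 0)%C with (RtoC 0) by (field; apply (cm_residue CM)).
      rewrite Csub_0_r, Cmod_inv by exact Nf.
      rewrite <- (Rinv_inv e). apply Rinv_lt_contravar; [nra | exact Hlt]. }
    destruct (HH w Hw) as [[E1 ->]|[Pw [E1 N1]]]; [apply (Ninv _ Nf); congruence|].
    destruct (H w Hw) as [_ [Hwd _]]. rewrite Csub_0_r in Hwd.
    assert (E2 : w = z).
    { apply (cm_inj CM); auto. replace (F w) with (/ / F w)%C by (field; auto).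
      rewrite <- E1, E. field. auto. }
    subst w. lra.
Qed.

(** [F] is proper: it takes the unit circle to [K] in the limit, ... *)
Lemma cm_boundary : forall u x v, (forall n, pdisc (u n)) ->
  Cconv u x -> Cmod x = 1 -> Cconv (fun n => F (u n)) v -> K v.
Proof.
  intros u x v Hu Hx Hx1 Hv. apply NNPP. intros Nv.
  destruct (cm_onto CM v Nv) as [s [Hs Es]].
  set (rho := (1 - Cmod s) / 2). assert (Hrho : 0 < rho) by (unfold rho; destruct Hs; lra).
  destruct (cm_inv_cont s rho Hs Hrho) as [d [Hd Hl]].
  destruct (Hv d Hd) as [N1 H1]. destruct (Hx rho Hrho) as [N2 H2].
  set (k := (N1 + N2)%nat). specialize (H1 k ltac:(unfold k; lia)).
  specialize (H2 k ltac:(unfold k; lia)). rewrite <- Es in H1.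
  specialize (Hl _ H1 _ (Hu k) eq_refl).
  assert (T1 := Cmod_rev_triangle (u k) s). assert (T2 := Cmod_rev_triangle x (u k)).
  rewrite Cmod_sub_sym in T2. unfold rho in *. lra.
Qed.

(** ... and only the unit circle. *)
Lemma cm_to_boundary : forall u v r, (forall n, pdisc (u n)) ->
  Cconv (fun n => F (u n)) v -> K v -> r < 1 -> ~ (forall n, Cmod (u n) <= r).
Proof.
  intros u v r Hu Hv HK Hr Hur.
  destruct (Cbounded_subseq u r Hur) as [phi [x [Hphi Hx]]].
  destruct (Cconv_mod_bounded _ _ Hv) as [N HN].
  destruct (cm_pole_large (Cmod v + 1)) as [d [Hd Hl]].
  assert (Hlow : forall n, (N <= n)%nat -> d <= Cmod (u (phi n))).
  { intros n Hn. apply Rnot_lt_le. intros Hlt.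
    specialize (Hl (u (phi n)) ltac:(now rewrite Csub_0_r) (pdisc_neq_0 _ (Hu _))).
    specialize (HN (phi n) ltac:(specialize (Hphi n); lia)). lra. }
  assert (Hx0 := Cconv_mod_ge _ _ _ N Hx Hlow).
  assert (Hx1 : Cmod x <= r) by (apply Cconv_mod_le with (1 := Hx) (N := O); auto).
  assert (Px : pdisc x) by (split; lra).
  apply (cm_avoid CM x Px).
  replace (F x) with v; [exact HK|].
  apply Cconv_unique with (fun n => F (u (phi n))).
  - now apply (Cconv_sub (fun n => F (u n)) v phi).
  - apply (Cconv_cont F (fun n => u (phi n))); [|exact Hx]. now apply Cdiff_cont, cm_diff.
Qed.

(** [q] is a local inverse of [F] composed with [V]. It is continuous because [F]
    is open, and dividing the slopes of [V] by those of [F] differentiates it. *)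
Lemma inverse_derive : forall (q V : C -> C) z l,
  near z (fun y => pdisc (q y) /\ F (q y) = V y) -> is_derive V z l ->
  is_derive q z (l / F1 (q z))%C.
Proof.
  intros q V z l Hq HV. destruct (near_center _ _ Hq) as [Pz Ez].
  assert (Cq : Ccont q z).
  { intros eps He. destruct (cm_inv_cont (q z) eps Pz He) as [d [Hd H1]]. rewrite Ez in H1.
    eapply near_mono; [exact (near_and Hq (is_derive_Ccont _ _ _ HV d Hd))|].
    intros y [[Py Ey] Hy]. now apply (H1 (V y) Hy). }
  assert (HF := cm_derive CM _ Pz). assert (N := cm_derive_neq_0 CM _ Pz).
  apply is_derive_slope in HF, HV.
  destruct HF as [k [Hk [Ek HF]]], HV as [h [Hh [Eh HV]]].
  assert (Ck : Ccont (fun y => k (q y)) z) by (apply (Ccont_comp k q); auto).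
  assert (Nk : k (q z) <> 0) by now rewrite Ek.
  apply Cderive_ext_loc with (f := fun y => (q z + h y / k (q y) * (y - z))%C).
  - eapply near_mono; [exact (near_and Hq (Ccont_neq _ _ _ Ck Nk))|].
    intros y [[Py Ey] Ny]. cbv beta in *.
    assert (E1 : (k (q y) * (q y - q z) = h y * (y - z))%C).
    { assert (A1 := HF (q y)). assert (A2 := HV y). rewrite Ey, A2, Ez in A1.
      replace (h y * (y - z))%C with (V z + h y * (y - z) - V z)%C by ring.
      rewrite A1. ring. }
    replace (h y / k (q y) * (y - z))%C with ((h y * (y - z)) / k (q y))%C by (field; exact Ny).
    rewrite <- E1. field. exact Ny.
  - apply is_derive_slope. exists (fun y => h y / k (q y))%C.
    replace (q z + h z / k (q z) * (z - z))%C with (q z) by (field; exact Nk).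
    split; [apply Ccont_mult; [exact Hh | now apply Ccont_inv]|].
    split; [now rewrite Eh, Ek|]. intros y. ring.
Qed.

(** The complements of the images of the discs [|z| < r] are convex, with
    respect to pairs of boundary points of equal modulus. With [q z] the
    preimage of the convex combination of [F z] and [F (b z)], the quotient
    [z / q z] is holomorphic where [q] is defined, and has modulus at most one
    near the boundary of that set, be it the origin, the unit circle, or a point
    where the combination falls into [K]. *)
Lemma level_convex : forall b t z s, Cmod b = 1 ->
  0 <= t <= 1 -> pdisc z -> pdisc s ->
  F s = (RtoC t * F z + RtoC (1 - t) * F (b * z))%C -> Cmod z <= Cmod s.
Proof.
  intros b t z0 s0 Hb Ht Hz0 Hs0 E0.
  set (V := fun z => (RtoC t * F z + RtoC (1 - t) * F (b * z))%C) in *.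
  change (F s0 = V z0) in E0.
  set (A := fun z => pdisc z /\ ~ K (V z)).
  assert (Hq : forall z, exists q, A z -> pdisc q /\ F q = V z).
  { intros z. destruct (classic (A z)) as [[Pz NK]|N].
    - destruct (cm_onto CM _ NK) as [q Hq]. exists q. auto.
    - exists z. easy. }
  apply choice in Hq. destruct Hq as [q Hq].
  assert (HV : forall z, pdisc z -> Cdiff V z).
  { intros z Pz. unfold V. cdiff; [now apply cm_diff|].
    apply (Cdiff_comp F (fun z => b * z)%C); [cdiff|]. now apply cm_diff, pdisc_rot. }
  assert (Aopen : forall z, A z -> near z A).
  { intros z Az. destruct (Hq z Az) as [Qz Ez]. destruct Az as [Pz NK].
    destruct (cm_open (q z) 1 Qz Rlt_0_1) as [d [Hd H]]. rewrite Ez in H.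
    eapply near_mono; [exact (near_and (pdisc_open z Pz) (Cdiff_cont _ _ (HV z Pz) d Hd))|].
    intros y [Py Hy]. destruct (H _ Hy) as [w [Pw [_ Ew]]].
    split; [exact Py|]. rewrite <- Ew. now apply (cm_avoid CM). }
  assert (A0 : A z0) by (split; [exact Hz0 | rewrite <- E0; now apply (cm_avoid CM)]).
  assert (Eq0 : q z0 = s0) by (apply (cm_inj CM); try apply Hq; auto; rewrite E0; now apply Hq).
  assert (Nq : forall z, A z -> q z <> 0) by (intros z Az; apply pdisc_neq_0, Hq, Az).
  assert (MP : Cmod (z0 / q z0)%C <= 1).
  { apply (max_principle A (fun z => z / q z)%C 1); [intros z [[_ Pz] _]; lra | exact Aopen | | |exact A0].
    - intros z Az. cdiff; [|now apply Nq]. destruct (HV z (proj1 Az)) as [l Hl].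
      exists (l / F1 (q z))%C. apply (inverse_derive q V z l); [|exact Hl].
      apply near_mono with (1 := Aopen z Az), Hq.
    - intros eps u x Heps Hu Hx Hux.
      assert (Hqu : forall n, (1 + eps) * Cmod (q (u n)) <= Cmod (u n)).
      { intros n. specialize (Hux n). rewrite Cmod_div in Hux by now apply Nq.
        apply Rle_div_r in Hux; [exact Hux | now apply Cmod_gt_0, Nq]. }
      assert (Hto : forall phi v, (forall n, n <= phi n)%nat ->
        Cconv (fun n => V (u (phi n))) v -> K v -> False).
      { intros phi v Hphi Hv HKv.
        apply (cm_to_boundary (fun n => q (u (phi n))) v (/ (1 + eps))); auto.
        - intros n. apply Hq, Hu.
        - intros e He. destruct (Hv e He) as [N HN]. exists N. intros n Hn.
          destruct (Hq (u (phi n)) (Hu _)) as [_ E]. rewrite E. auto.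
        - rewrite <- Rinv_1. apply Rinv_lt_contravar; lra.
        - intros n. specialize (Hqu (phi n)). destruct (Hu (phi n)) as [[_ U] _].
          apply (Rmult_le_reg_l (1 + eps)); [lra|]. rewrite Rinv_r; lra. }
      assert (Hx1 : Cmod x <= 1).
      { apply Cconv_mod_le with (1 := Hx) (N := O). intros n _. left. apply Hu. }
      assert (Hx0 : x <> 0).
      { (* Near the pole [F z] behaves like [G 0 / z], so that [|q|] cannot be
           smaller than [|u|] by a fixed factor. *)
        intros ->. assert (HB : 0 < Cmod (G 0)) by apply Cmod_gt_0, (cm_residue CM).
        set (B := Cmod (G 0)) in *. set (eta := B * eps / (4 + 2 * eps)).
        assert (Eeta : eta * (4 + 2 * eps) = B * eps) by (unfold eta; field; lra).
        destruct (cm_cont_G_0 eta) as [d [Hd Hl]]; [apply Rdiv_lt_0_compat; nra|].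
        assert (HG : forall y : C, Cmod y < d -> B - eta < Cmod (G y) < B + eta).
        { intros y Hy. rewrite <- (Csub_0_r y) in Hy. apply Hl in Hy.
          assert (T1 := Cmod_rev_triangle (G y) (G 0)). assert (T2 := Cmod_rev_triangle (G 0) (G y)).
          rewrite Cmod_sub_sym in T2. unfold B. lra. }
        destruct (Hx d Hd) as [N HN]. specialize (HN N (le_n N)). rewrite Csub_0_r in HN.
        destruct (Hu N) as [Pu _]. destruct (Hq _ (Hu N)) as [Pq Eq]. specialize (Hqu N).
        assert (Pbu := pdisc_rot b _ Hb Pu).
        assert (VT : Cmod (F (q (u N))) <= t * Cmod (F (u N)) + (1 - t) * Cmod (F (b * u N))%C).
        { rewrite Eq. apply Rle_trans with (1 := Cmod_triangle _ _).
          rewrite !Cmod_mult, !Cmod_RtoC_pos by lra. lra. }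
        rewrite !(cm_G CM), !Cmod_div, Cmod_mult, Hb, Rmult_1_l in VT
          by (auto; now apply pdisc_neq_0).
        destruct (HG (u N) HN) as [_ G1]. destruct (HG (b * u N)%C) as [_ G2].
        { now rewrite Cmod_mult, Hb, Rmult_1_l. }
        destruct (HG (q (u N))) as [G3 _]; [destruct Pq, Pu; nra|].
        set (m := Cmod (u N)) in *. set (k := Cmod (q (u N))) in *.
        set (g1 := Cmod (G (u N))) in *. set (g2 := Cmod (G (b * u N)%C)) in *.
        set (g3 := Cmod (G (q (u N)))) in *.
        assert (Pm : 0 < m) by apply Pu. assert (Pk : 0 < k) by apply Pq.
        replace (t * (g1 / m) + (1 - t) * (g2 / m)) with ((t * g1 + (1 - t) * g2) / m) in VT by (field; lra).
        apply (Rle_div_l _ _ _ Pk) in VT.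
        replace ((t * g1 + (1 - t) * g2) / m * k) with ((t * g1 + (1 - t) * g2) * k / m) in VT by (field; lra).
        apply (Rle_div_r _ _ _ Pm) in VT.
        assert (g3 * m <= (B + eta) * k) by (apply Rle_trans with (1 := VT), Rmult_le_compat_r; nra).
        assert (g3 * ((1 + eps) * k) <= g3 * m) by (apply Rmult_le_compat_l; [apply Cmod_ge_0 | lra]).
        assert (g3 * (1 + eps) <= B + eta) by (apply (Rmult_le_reg_r k); lra). nra. }
      destruct (Rle_lt_or_eq_dec _ _ Hx1) as [L|E].
      + assert (Px := pdisc_intro x Hx0 L). split; [exact Px|]. intros HK.
        apply (Hto (fun n => n) (V x)); auto.
        apply (Cconv_cont V u); [|exact Hx]. now apply Cdiff_cont, HV.
      + exfalso. destruct (cm_bounded_away (1 / 2) ltac:(lra)) as [M HM].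
        destruct (Hx (1 / 2) ltac:(lra)) as [N HN].
        assert (Hlow : forall n, (N <= n)%nat -> 1 / 2 <= Cmod (u n)).
        { intros n Hn. specialize (HN n Hn). assert (T := Cmod_rev_triangle x (u n)).
          rewrite Cmod_sub_sym in T. lra. }
        assert (Hub : forall n, pdisc (b * u n)%C) by (intros n; apply pdisc_rot, Hu; exact Hb).
        destruct (Cbounded_subseq (fun n => F (u (N + n)%nat)) M) as [phi [a [Hphi Ha]]].
        { intros n. apply HM; [apply Hu | apply Hlow; lia]. }
        destruct (Cbounded_subseq (fun n => F (b * u (N + phi n)%nat)%C) M) as [psi [c [Hpsi Hc]]].
        { intros n. apply HM; [apply Hub|]. rewrite Cmod_mult, Hb, Rmult_1_l. apply Hlow. lia. }
        set (ph := fun n => (N + phi (psi n))%nat).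
        assert (Hph : forall n, (n <= ph n)%nat).
        { intros n. unfold ph. specialize (Hphi (psi n)). specialize (Hpsi n). lia. }
        assert (Ha' : Cconv (fun n => F (u (ph n))) a).
        { exact (Cconv_sub (fun n => F (u (N + phi n)%nat)) a psi Ha Hpsi). }
        assert (Hxp : Cconv (fun n => u (ph n)) x) by now apply Cconv_sub.
        apply (Hto ph (RtoC t * a + RtoC (1 - t) * c)%C Hph); [now apply Cconv_lin|].
        apply (cm_convex CM a c t); [| | exact Ht].
        * apply (cm_boundary (fun n => u (ph n)) x); auto. intros n. apply Hu.
        * apply (cm_boundary (fun n => b * u (ph n))%C (b * x)%C); auto.
          -- apply (Cconv_cont (fun y => b * y)%C); [|exact Hxp]. apply Cdiff_cont. cdiff.
          -- now rewrite Cmod_mult, Hb, Rmult_1_l. }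
  rewrite Eq0, Cmod_div in MP by now apply pdisc_neq_0.
  apply Rle_div_l in MP; [lra | apply Hs0].
Qed.

(** The infinitesimal form of [level_convex]: the velocity of the preimage of a
    point moving from [F z] towards [F w] does not point into the disc. *)
Lemma level_support : forall z w, pdisc z -> pdisc w ->
  Cmod z = Cmod w -> 0 <= fst ((F w - F z) / F1 z * Cconj z)%C.
Proof.
  intros z w Hz Hw Ezw. apply Rnot_lt_le. intros Hlt.
  assert (Nz := pdisc_neq_0 z Hz).
  set (V := fun tau => (F z + tau * (F w - F z))%C).
  assert (HV : is_derive V (RtoC 0) (F w - F z)%C).
  { eapply Cderive_eq; [unfold V; cderive | cbv beta; ring]. }
  assert (V0 : V 0 = F z) by (unfold V; ring).
  destruct (cm_open z 1 Hz Rlt_0_1) as [d1 [Hd1 H1]]. rewrite <- V0 in H1.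
  assert (Hq : forall tau, exists q, Cmod (V tau - V 0)%C < d1 -> pdisc q /\ F q = V tau).
  { intros tau. destruct (Rlt_dec (Cmod (V tau - V 0)%C) d1) as [L|L].
    - destruct (H1 _ L) as [q [Q1 [_ Q2]]]. exists q. auto.
    - exists z. easy. }
  apply choice in Hq. destruct Hq as [q Hq].
  assert (Hq' : near 0 (fun y => pdisc (q y) /\ F (q y) = V y)).
  { apply near_mono with (1 := is_derive_Ccont _ _ _ HV d1 Hd1), Hq. }
  assert (q0 : q 0 = z).
  { destruct (near_center _ _ Hq') as [P E]. apply (cm_inj CM); auto. now rewrite E. }
  assert (Dq := inverse_derive q V (RtoC 0) _ Hq' HV).
  rewrite q0 in Dq. set (d := ((F w - F z) / F1 z)%C) in *.
  assert (Ed : fst (d * Cconj z)%C = fst (Cconj z * d)%C) by (f_equal; ring).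
  (* [|q t|^2 = |z|^2 - 2 kap t + O(t^2)], smaller than [|z|^2] for small [t]. *)
  set (kap := - fst (d * Cconj z)%C). assert (Hkap : 0 < kap) by (unfold kap; lra).
  set (Q := (Cmod d + kap) * (Cmod d + kap) + 1).
  assert (HQ : 0 < Q) by (assert (S := Rle_0_sqr (Cmod d + kap)); unfold Rsqr in S; unfold Q; lra).
  destruct (near_and (proj1 (is_derive_C _ _ _) Dq (kap / 2) ltac:(lra)) Hq') as [d2 [Hd2 H2]].
  set (t := Rmin (d2 / 2) (Rmin 1 (kap / Q) / 2)).
  assert (Ht : 0 < t).
  { assert (0 < kap / Q) by now apply Rdiv_lt_0_compat. assert (P := Rmin_pos 1 (kap / Q) Rlt_0_1 H).
    apply Rmin_pos; lra. }
  assert (Ht' : t < d2 /\ t < 1 /\ t < kap / Q) by (unfold t in *; rmin; lra).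
  clearbody t. destruct Ht' as [T2 [T1 TQ]]. apply Rlt_div_r in TQ; [|exact HQ].
  assert (Et : Cmod (RtoC t - 0)%C = t) by (rewrite Csub_0_r; apply Cmod_RtoC_pos; lra).
  destruct (H2 (RtoC t) ltac:(lra)) as [H3 [Pq Eq]].
  rewrite Et, q0 in H3. set (e := (q (RtoC t) - z - d * (RtoC t - 0))%C) in *.
  assert (Hle : Cmod z <= Cmod (q (RtoC t))).
  { apply (level_convex (w / z)%C (1 - t) z (q (RtoC t))); auto.
    - rewrite Cmod_div by exact Nz. rewrite Ezw. field. destruct Hw; lra.
    - lra.
    - replace (w / z * z)%C with w by (field; exact Nz). rewrite Eq. unfold V.
      replace (1 - (1 - t)) with t by ring. rewrite RtoC_minus. ring. }
  assert (Eqt : q (RtoC t) = (z + (RtoC t * d + e))%C) by (unfold e; ring).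
  assert (Sq := Cmod_sqr_plus z (RtoC t * d + e)%C). rewrite <- Eqt in Sq.
  assert (F1' : fst (Cconj z * (RtoC t * d + e))%C = t * fst (Cconj z * d)%C + fst (Cconj z * e)%C).
  { simpl. ring. }
  rewrite F1', <- Ed in Sq.
  assert (B1 : fst (Cconj z * e)%C <= kap / 2 * t).
  { apply Rle_trans with (1 := Rle_abs _). apply Rle_trans with (1 := Cmod_fst _).
    rewrite Cmod_mult, Cmod_conj. destruct Hz as [_ Hz1]. assert (P := Cmod_ge_0 e). nra. }
  assert (B2 : Cmod (RtoC t * d + e)%C <= t * (Cmod d + kap)).
  { apply Rle_trans with (1 := Cmod_triangle _ _).
    rewrite Cmod_mult, Cmod_RtoC_pos by lra. nra. }
  assert (B3 : Cmod (RtoC t * d + e)%C * Cmod (RtoC t * d + e)%C <=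
    t * (Cmod d + kap) * (t * (Cmod d + kap))) by (apply Rmult_le_compat; auto using Cmod_ge_0).
  assert (B4 : Cmod z * Cmod z <= Cmod (q (RtoC t)) * Cmod (q (RtoC t)))
    by (apply Rmult_le_compat; auto using Cmod_ge_0).
  assert (B5 : t * (t * Q) < t * kap) by (apply Rmult_lt_compat_l; auto).
  replace (fst (d * Cconj z)%C) with (- kap) in Sq by (unfold kap; ring).
  unfold Q in B5. nra.
Qed.

(** * The two-point inequality *)

Lemma cm_sub_neq_0 : forall z w, pdisc z -> pdisc w -> z <> w -> (F z - F w)%C <> 0.
Proof.
  intros z w Hz Hw N. apply Cminus_eq_contra. intros E. apply N. now apply (cm_inj CM).
Qed.

(** On a circle [(z + w) / (z - w)] is imaginary, and [level_support] gives the sign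
    of the other term. *)
Lemma two_point_circle : forall z w, pdisc z -> pdisc w ->
  z <> w -> Cmod z = Cmod w -> fst (two_point F F1 z w) <= 0.
Proof.
  intros z w Hz Hw Nzw E.
  assert (Nf := cm_sub_neq_0 z w Hz Hw Nzw).
  assert (Nf' := cm_sub_neq_0 w z Hw Hz (not_eq_sym Nzw)).
  assert (N1 := cm_derive_neq_0 CM z Hz).
  assert (S := level_support z w Hz Hw E).
  assert (Nm : (z - w)%C <> 0) by now apply Cminus_eq_contra.
  assert (E2 : fst ((z + w) / (z - w))%C = 0).
  { rewrite Re_div by exact Nm.
    replace (fst ((z + w) * Cconj (z - w))%C) with (Cmod z * Cmod z - Cmod w * Cmod w)
      by (rewrite !Cmod_sqr; unfold Cconj; simpl; ring).
    rewrite E. unfold Rdiv. ring. }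
  assert (Nc : Cconj z <> 0) by (apply Cmod_gt_0; rewrite Cmod_conj; apply Hz).
  set (a := ((F w - F z) / F1 z * Cconj z)%C) in *.
  assert (Ea : (a * F1 z = (F w - F z) * Cconj z)%C) by (unfold a; field; exact N1).
  assert (Na : a <> 0).
  { intros E0. apply (Cmult_neq_0 _ _ Nf' Nc). rewrite <- Ea, E0. ring. }
  assert (EL : (z * F1 z / (F z - F w))%C = (- (RtoC (Cmod z * Cmod z) / a))%C).
  { rewrite <- Cconj_sqr. replace (z * F1 z)%C with (z * (a * F1 z) / a)%C by (field; exact Na).
    rewrite Ea. field. auto. }
  assert (P : 0 <= fst (RtoC (Cmod z * Cmod z) / a)%C).
  { rewrite Re_div by exact Na. assert (Pa : 0 < Cmod a) by now apply Cmod_gt_0.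
    replace (fst (RtoC (Cmod z * Cmod z) * Cconj a)%C) with (Cmod z * Cmod z * fst a)
      by (unfold Cconj; simpl; ring).
    apply Rmult_le_pos; [|left; apply Rinv_0_lt_compat; nra]. destruct Hz. apply Rmult_le_pos; nra. }
  unfold two_point. rewrite EL.
  set (x := (RtoC (Cmod z * Cmod z) / a)%C) in *. set (y := ((z + w) / (z - w))%C) in *.
  replace (fst (2 * - x - y)%C) with (-2 * fst x - fst y) by (simpl; ring). lra.
Qed.

Lemma cm_slope : forall z, pdisc z -> Cdiff F1 z /\ exists k, Cdiff k z /\ k z = F1 z /\
  near z (fun y => F y = F z + k y * (y - z))%C.
Proof.
  intros z Hz. destruct (pdisc_open z Hz) as [d [Hd Hball]].
  apply holo_slope with d; [exact Hd|]. intros y Hy. apply (cm_derive CM). auto.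
Qed.

Lemma two_point_diff_l : forall z w, pdisc z -> pdisc w ->
  z <> w -> Cdiff (fun y => two_point F F1 y w) z.
Proof.
  intros z w Hz Hw N. unfold two_point.
  assert (D := cm_diff z Hz). destruct (cm_slope z Hz) as [D1 _].
  cdiff; try exact D; try exact D1; [now apply cm_sub_neq_0 | now apply Cminus_eq_contra].
Qed.

Lemma two_point_diff_r : forall z w, pdisc z -> pdisc w ->
  z <> w -> Cdiff (fun y => two_point F F1 z y) w.
Proof.
  intros z w Hz Hw N. unfold two_point. assert (D := cm_diff w Hw).
  cdiff; try exact D; [now apply cm_sub_neq_0 | now apply Cminus_eq_contra].
Qed.

(** On the diagonal the two poles of [two_point] cancel: written over the
    common denominator [F z - F w = k z (z - w)], the numerator vanishes there. *)
Lemma two_point_diag : forall w, pdisc w -> exists B, near w (fun z => z <> w ->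
  Cmod (two_point F F1 z w) <= B /\ Cmod (two_point F F1 w z) <= B).
Proof.
  intros w Hw. destruct (cm_slope w Hw) as [D1 [k [Dk [Ek Hk]]]].
  assert (N1 : k w <> 0) by (rewrite Ek; now apply (cm_derive_neq_0 CM)).
  assert (V : forall u, Cdiff u w -> u w = 0 -> exists B, near w (fun z => z <> w ->
    Cmod (u z / (k z * (z - w)))%C <= B)).
  { intros u [l Hl] E. apply is_derive_slope in Hl. destruct Hl as [h [Hh [_ Eh]]].
    assert (Cq : Ccont (fun z => h z * / k z)%C w).
    { apply Ccont_mult; [exact Hh|]. apply Ccont_inv; [now apply Cdiff_cont | exact N1]. }
    eexists. eapply near_mono;
      [exact (near_and (Ccont_bounded _ _ Cq) (Ccont_neq _ _ _ (Cdiff_cont _ _ Dk) N1))|].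
    intros z [Hz Nk] N. rewrite (Eh z), E.
    replace ((0 + h z * (z - w)) / (k z * (z - w)))%C with (h z * / k z)%C; [exact Hz|].
    field. split; [now apply Cminus_eq_contra | exact Nk]. }
  destruct (V (fun z => 2 * z * F1 z - (z + w) * k z)%C) as [B1 H1];
    [cdiff; [exact D1 | exact Dk] | rewrite Ek; ring |].
  destruct (V (fun z => (w + z) * k z - 2 * w * F1 w)%C) as [B2 H2];
    [cdiff; exact Dk | rewrite Ek; ring |].
  exists (Rmax B1 B2). eapply near_mono;
    [exact (near_and (near_and H1 H2) (near_and Hk (Ccont_neq _ _ _ (Cdiff_cont _ _ Dk) N1)))|].
  intros z [[V1 V2] [Hz Nk]] N. specialize (V1 N). specialize (V2 N).
  assert (Nm := Cminus_eq_contra _ _ N). assert (Nm' : (w - z)%C <> 0) by (apply Cminus_eq_contra; auto).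
  assert (Nkz : (- (k z * (z - w)))%C <> 0).
  { intros E. apply (Cmult_neq_0 _ _ Nk Nm). rewrite <- Copp_0, <- E. ring. }
  split; eapply Rle_trans; [| apply Rmax_l | | apply Rmax_r].
  - replace (two_point F F1 z w) with ((2 * z * F1 z - (z + w) * k z) / (k z * (z - w)))%C; [exact V1|].
    unfold two_point. rewrite Hz.
    replace (F w + k z * (z - w) - F w)%C with (k z * (z - w))%C by ring. field. auto.
  - replace (two_point F F1 w z) with (((w + z) * k z - 2 * w * F1 w) / (k z * (z - w)))%C; [exact V2|].
    unfold two_point. rewrite Hz.
    replace (F w - (F w + k z * (z - w)))%C with (- (k z * (z - w)))%C by ring. field. auto.
Qed.

Lemma near_0_pdisc : forall w, pdisc w -> near 0 (fun z => z <> 0 -> pdisc z /\ z <> w /\ F z = (G z / z)%C).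
Proof.
  intros w Hw. eapply near_mono; [exact (near_and (near_lt 0 1 ltac:(rewrite Cmod_0; lra))
    (near_neq 0 w (not_eq_sym (pdisc_neq_0 w Hw))))|].
  intros z [H1 H2] Nz. assert (Pz := pdisc_intro z Nz H1). split; [exact Pz|]. split; [exact H2 | now apply (cm_G CM)].
Qed.

(** At the pole of [F] in either variable [two_point] takes the value [-1]. *)
Lemma two_point_zero_r : forall z, pdisc z -> exists A, near 0 (fun w => w <> 0 ->
  Cmod (two_point F F1 z w + 1)%C <= A * Cmod w).
Proof.
  intros z Hz. set (S := fun w => (2 * (z * F1 z * / (w * F z - G w)) - 2 * / (z - w))%C).
  assert (CG := cm_cont_G_0).
  assert (CD : Ccont (fun w => w * F z - G w)%C 0).
  { apply Ccont_minus; [|exact CG]. apply Ccont_mult; [apply Ccont_id | apply Ccont_const]. }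
  assert (ND : (0 * F z - G 0)%C <> 0).
  { intros E. apply (cm_residue CM). replace (G 0) with (- (0 * F z - G 0))%C by ring. rewrite E. ring. }
  assert (CS : Ccont S 0).
  { apply Ccont_minus; apply Ccont_mult; try apply Ccont_const.
    - apply Ccont_mult; [apply Ccont_const|]. now apply Ccont_inv.
    - apply Ccont_inv; [|rewrite Csub_0_r; now apply pdisc_neq_0].
      apply Ccont_minus; [apply Ccont_const | apply Ccont_id]. }
  eexists. eapply near_mono; [exact (near_and (near_0_pdisc z Hz)
    (near_and (Ccont_bounded S 0 CS) (Ccont_neq _ _ _ CD ND)))|].
  intros w [Hw [HS Nw]] N. destruct (Hw N) as [Pw [Nwz Ew]].
  replace (two_point F F1 z w + 1)%C with (S w * w)%C.
  - rewrite Cmod_mult. apply Rmult_le_compat_r; [apply Cmod_ge_0 | exact HS].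
  - unfold S, two_point. rewrite Ew.
    replace (F z - G w / w)%C with ((w * F z - G w) / w)%C by (field; exact N).
    field. repeat split; auto. apply Cminus_eq_contra. auto.
Qed.

Lemma two_point_zero_l : forall w, pdisc w -> exists A, near 0 (fun z => z <> 0 ->
  Cmod (two_point F F1 z w + 1)%C <= A * Cmod z).
Proof.
  intros w Hw. set (G1 := C_derive G).
  assert (HG : forall z : C, Cmod (z - 0)%C < 1 -> is_derive G z (G1 z)).
  { intros z Hz. rewrite Csub_0_r in Hz. destruct (cm_diff_G CM z Hz) as [l Hl].
    unfold G1. now rewrite (is_C_derive_unique G z l Hl). }
  destruct (holo_slope G G1 0 1 Rlt_0_1 HG) as [DG1 _].
  set (S := fun z => (2 * ((G1 z - F w) * / (G z - z * F w)) - 2 * / (z - w))%C).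
  assert (CG := cm_cont_G_0).
  assert (CD : Ccont (fun z => G z - z * F w)%C 0).
  { apply Ccont_minus; [exact CG|]. apply Ccont_mult; [apply Ccont_id | apply Ccont_const]. }
  assert (ND : (G 0 - 0 * F w)%C <> 0).
  { replace (G 0 - 0 * F w)%C with (G 0) by ring. apply (cm_residue CM). }
  assert (CS : Ccont S 0).
  { apply Ccont_minus; apply Ccont_mult; try apply Ccont_const.
    - apply Ccont_mult; [|now apply Ccont_inv].
      apply Ccont_minus; [now apply Cdiff_cont | apply Ccont_const].
    - apply Ccont_inv; [apply Ccont_minus; [apply Ccont_id | apply Ccont_const]|].
      apply Cminus_eq_contra. now apply not_eq_sym, pdisc_neq_0. }
  eexists. eapply near_mono; [exact (near_and (near_0_pdisc w Hw)
    (near_and (Ccont_bounded S 0 CS) (Ccont_neq _ _ _ CD ND)))|].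
  intros z [Hz [HS Nz]] N. destruct (Hz N) as [Pz [Nzw Ez]].
  assert (E1 : F1 z = (G1 z / z - G z / (z * z))%C).
  { apply Cderive_unique with F z; [now apply (cm_derive CM)|].
    apply Cderive_ext_loc with (f := fun y => (G y * / y)%C).
    - apply near_mono with (1 := pdisc_open z Pz). intros y Py. now rewrite (cm_G CM y Py).
    - eapply Cderive_eq; [apply Cderive_mult; [apply HG; rewrite Csub_0_r; apply Pz|]|].
      + apply (Cderive_inv (fun y => y)); [apply Cderive_id | exact N].
      + cbv beta. field. exact N. }
  replace (two_point F F1 z w + 1)%C with (S z * z)%C.
  - rewrite Cmod_mult. apply Rmult_le_compat_r; [apply Cmod_ge_0 | exact HS].
  - unfold S, two_point. rewrite E1, Ez.
    replace (G z / z - F w)%C with ((G z - z * F w) / z)%C by (field; exact N).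
    field. repeat split; auto. now apply Cminus_eq_contra.
Qed.

(** From pairs with [|z| = |w|] to all pairs, by the maximum principle in the
    variable of smaller modulus. *)
Lemma two_point_re : forall z w, pdisc z -> pdisc w -> z <> w ->
  fst (two_point F F1 z w) <= 0.
Proof.
  intros z w Hz Hw N.
  assert (B1 : forall T, (exists A, near 0 (fun y => y <> 0 -> Cmod (T y + 1)%C <= A * Cmod y)) ->
    exists B, near 0 (fun y => y <> 0 -> Cmod (T y) <= B)).
  { intros T [A HA]. exists (Rabs A + 1).
    eapply near_mono; [exact (near_and HA (near_lt 0 1 ltac:(rewrite Cmod_0; lra)))|].
    intros y [Hy Hy1] Ny. specialize (Hy Ny). replace (T y) with ((T y + 1) - 1)%C by ring.
    apply Rle_trans with (1 := Cmod_sub_triangle _ _). rewrite Cmod_1.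
    assert (P := Cmod_ge_0 y). assert (Q := Rle_abs A). assert (Q' := Rabs_pos A). nra. }
  destruct (Rtotal_order (Cmod z) (Cmod w)) as [L|[E|L]].
  - apply (re_max_principle (fun y => two_point F F1 y w) w Hw).
    + intros y Hy _ Ny. now apply two_point_diff_l.
    + intros y Hy E Ny. now apply two_point_circle.
    + now apply (B1 (fun y => two_point F F1 y w)), two_point_zero_l.
    + destruct (two_point_diag w Hw) as [B HB]. exists B.
      apply near_mono with (1 := HB). intros y Hy Ny. now apply Hy.
    + now apply pdisc_neq_0.
    + exact L.
  - now apply two_point_circle.
  - apply (re_max_principle (fun y => two_point F F1 z y) z Hz).
    + intros y Hy _ Ny. apply two_point_diff_r; auto.
    + intros y Hy E Ny. apply two_point_circle; auto.
    + now apply (B1 (fun y => two_point F F1 z y)), two_point_zero_r.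
    + destruct (two_point_diag z Hz) as [B HB]. exists B.
      apply near_mono with (1 := HB). intros y Hy Ny. now apply Hy.
    + now apply pdisc_neq_0.
    + exact L.
Qed.

(** The maximum principle gives more than [two_point_re]: since [two_point] is
    [-1] at the pole, Schwarz's lemma applies to its Cayley transform in each of
    the two variables. *)
Lemma two_point_schwarz : forall z w, pdisc z -> pdisc w ->
  z <> w -> Cmod (cayley (two_point F F1 z w)) <= Cmod z * Cmod w.
Proof.
  assert (Pd : forall y : C, Cmod y < 1 -> y <> RtoC 0 -> pdisc y) by (intros; now apply pdisc_intro).
  assert (Hr : forall z w, pdisc z -> pdisc w -> z <> w ->
    Cmod (cayley (two_point F F1 z w)) <= 1 * Cmod w).
  { intros z w Hz Hw N.
    apply (schwarz_lemma (fun y => cayley (two_point F F1 z y)) z 1 Rlt_0_1);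
      auto; [| | apply Hw | now apply pdisc_neq_0].
    - intros y Hy N1 N2. assert (Py := Pd y Hy N1).
      destruct (cayley_bounds _ (two_point_re z y Hz Py (not_eq_sym N2))) as [NT [B1 _]].
      assert (D := two_point_diff_r z y Hz Py (not_eq_sym N2)).
      split; [unfold cayley; cdiff; try exact D; exact NT | exact B1].
    - destruct (two_point_zero_r z Hz) as [A HA]. exists A.
      eapply near_mono; [exact (near_and HA (near_0_pdisc z Hz))|]. intros y [HyA Hy] N1 _.
      destruct (Hy N1) as [Py [N2 _]]. apply Rle_trans with (2 := HyA N1).
      apply cayley_bounds, two_point_re; auto. }
  intros z w Hz Hw N. rewrite Rmult_comm.
  apply (schwarz_lemma (fun y => cayley (two_point F F1 y w)) w (Cmod w));
    auto; [apply Hw | | | apply Hz | now apply pdisc_neq_0].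
  - intros y Hy N1 N2. assert (Py := Pd y Hy N1).
    destruct (cayley_bounds _ (two_point_re y w Py Hw N2)) as [NT _].
    assert (D := two_point_diff_l y w Py Hw N2).
    split; [unfold cayley; cdiff; try exact D; exact NT|].
    rewrite <- Rmult_1_l. now apply Hr.
  - destruct (two_point_zero_l w Hw) as [A HA]. exists A.
    eapply near_mono; [exact (near_and HA (near_0_pdisc w Hw))|]. intros y [HyA Hy] N1 N2.
    destruct (Hy N1) as [Py _]. apply Rle_trans with (2 := HyA N1).
    now apply cayley_bounds, two_point_re.
Qed.

End ConcaveMap.

(** * The Schwarz-Pick lemma *)

Lemma Cconj_RtoC : forall r : R, Cconj (RtoC r) = RtoC r.
Proof. intros r. unfold Cconj, RtoC. simpl. f_equal. ring. Qed.

Lemma blaschke_identity : forall a z : C,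
  Cmod (1 - Cconj a * z)%C * Cmod (1 - Cconj a * z)%C - Cmod (z - a)%C * Cmod (z - a)%C
  = (1 - Cmod a * Cmod a) * (1 - Cmod z * Cmod z).
Proof. intros [a b] [x y]. rewrite !Cmod_sqr. unfold Cconj. simpl. ring. Qed.

Lemma blaschke_denom : forall a z : C, Cmod a < 1 -> Cmod z <= 1 ->
  1 - Cmod a <= Cmod (1 - Cconj a * z)%C /\ (1 - Cconj a * z)%C <> 0.
Proof.
  intros a z Ha Hz. assert (T := Cmod_rev_triangle 1 (Cconj a * z)%C).
  rewrite Cmod_1, Cmod_mult, Cmod_conj in T. assert (P := Cmod_ge_0 a).
  assert (1 - Cmod a <= Cmod (1 - Cconj a * z)%C) by nra.
  split; [exact H|]. apply Cmod_gt_0. lra.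
Qed.

Lemma blaschke_le : forall a z : C, Cmod a <= 1 -> Cmod z <= 1 ->
  Cmod (z - a)%C <= Cmod (1 - Cconj a * z)%C.
Proof.
  intros a z Ha Hz. assert (E := blaschke_identity a z).
  assert (P1 := Cmod_ge_0 a). assert (P2 := Cmod_ge_0 z).
  assert (P3 := Cmod_ge_0 (z - a)%C). assert (P4 := Cmod_ge_0 (1 - Cconj a * z)%C).
  assert (0 <= (1 - Cmod a * Cmod a) * (1 - Cmod z * Cmod z)) by (apply Rmult_le_pos; nra).
  apply Rnot_lt_le. intros L. nra.
Qed.

Lemma blaschke_lt : forall a z : C, Cmod a < 1 -> Cmod z < 1 ->
  Cmod (z - a)%C < Cmod (1 - Cconj a * z)%C.
Proof.
  intros a z Ha Hz. assert (E := blaschke_identity a z).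
  assert (P1 := Cmod_ge_0 a). assert (P2 := Cmod_ge_0 z).
  assert (P3 := Cmod_ge_0 (z - a)%C). assert (P4 := Cmod_ge_0 (1 - Cconj a * z)%C).
  assert (0 < (1 - Cmod a * Cmod a) * (1 - Cmod z * Cmod z)) by (apply Rmult_lt_0_compat; nra).
  apply Rnot_le_lt. intros L. nra.
Qed.

(** At the origin, with an exceptional point [e]. The factor [s < 1] keeps the
    denominator away from zero even if [W 0] is unimodular. *)
Lemma schwarz_pick : forall (W : C -> C) (e : C), e <> 0 ->
  (forall z, Cmod z < 1 -> z <> e -> Cdiff W z /\ Cmod (W z) <= 1) ->
  forall z, Cmod z < 1 -> z <> e ->
  Cmod (W z - W 0)%C <= Cmod z * Cmod (1 - Cconj (W 0) * W z)%C.
Proof.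
  intros W e Ne HW z Hz Nze. destruct (Ceq_dec z 0) as [->|Nz].
  { rewrite Cmod_sub_diag, Cmod_0. lra. }
  set (b := W 0). destruct (HW 0 ltac:(rewrite Cmod_0; lra) (not_eq_sym Ne)) as [D0 Hb]. fold b in Hb.
  set (X := Cmod (W z - b)%C). set (E := Cmod (1 - Cconj b * W z)%C).
  assert (HX : 0 <= X) by apply Cmod_ge_0. assert (Pz := Cmod_ge_0 z).
  assert (Hs : forall s, 0 < s < 1 -> s * X <= Cmod z * Cmod (1 - RtoC (s * s) * (Cconj b * W z))%C).
  { intros s Hs. set (D := fun y => (1 - RtoC (s * s) * (Cconj b * W y))%C).
    assert (HD : forall y, Cmod (W y) <= 1 -> D y <> 0 /\ Cmod (RtoC s * (W y - b))%C <= Cmod (D y)).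
    { intros y Hy. assert (Hsb : Cmod (RtoC s * b)%C <= s) by (rewrite Cmod_mult, Cmod_RtoC_pos; nra).
      assert (Hso : Cmod (RtoC s * W y)%C <= 1) by (rewrite Cmod_mult, Cmod_RtoC_pos; nra).
      replace (D y) with (1 - Cconj (RtoC s * b) * (RtoC s * W y))%C
        by (unfold D; rewrite Cmult_conj, RtoC_mult, Cconj_RtoC; ring).
      replace (RtoC s * (W y - b))%C with (RtoC s * W y - RtoC s * b)%C by ring.
      split; [apply blaschke_denom | apply blaschke_le]; lra. }
    set (u := fun y => (RtoC s * (W y - b) / D y)%C).
    assert (Du : forall y, Cmod y < 1 -> y <> e -> Cdiff u y).
    { intros y Hy N. destruct (HW y Hy N) as [Dy By]. unfold u, D.
      cdiff; try exact Dy. now apply HD. }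
    destruct (Du 0 ltac:(rewrite Cmod_0; lra) (not_eq_sym Ne)) as [l Hl].
    apply is_derive_slope in Hl. destruct Hl as [k [Hk [_ Ek]]].
    assert (S : Cmod (u z) <= 1 * Cmod z).
    { apply (schwarz_lemma u e 1 Rlt_0_1); auto.
      - intros y Hy _ N. split; [now apply Du|]. destruct (HD y (proj2 (HW y Hy N))) as [N' B].
        unfold u. rewrite Cmod_div by exact N'. apply Rle_div_l; [now apply Cmod_gt_0 | lra].
      - eexists. apply near_mono with (1 := Ccont_bounded k 0 Hk). intros y Hy _ _.
        rewrite (Ek y). replace (u 0 + k y * (y - 0))%C with (k y * y)%C.
        + rewrite Cmod_mult. apply Rmult_le_compat_r; [apply Cmod_ge_0 | exact Hy].
        + unfold u. fold b. unfold Cdiv. ring. }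
    destruct (HD z (proj2 (HW z Hz Nze))) as [N' _]. unfold u in S.
    rewrite Cmod_div, Cmod_mult, Cmod_RtoC_pos in S by (auto; lra).
    apply (Rle_div_l _ _ _ (proj1 (Cmod_gt_0 _) N')) in S. unfold D in S. fold X in S. lra. }
  apply Rnot_lt_le. intros L. set (t := (X - Cmod z * E) / (2 * (X + 2))).
  assert (PE : 0 <= E) by apply Cmod_ge_0.
  assert (Et : t * (2 * (X + 2)) = X - Cmod z * E) by (unfold t; field; lra).
  assert (Q0 : 0 <= Cmod z * E) by now apply Rmult_le_pos.
  assert (Ht : 0 < t < 1) by (split; unfold t; [apply Rdiv_lt_0_compat | apply Rlt_div_l]; lra). specialize (Hs (1 - t) ltac:(lra)).
  assert (B : Cmod (1 - RtoC ((1 - t) * (1 - t)) * (Cconj b * W z))%C <= E + 2 * t).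
  { replace (1 - RtoC ((1 - t) * (1 - t)) * (Cconj b * W z))%C with
      ((1 - Cconj b * W z) + RtoC (2 * t - t * t) * (Cconj b * W z))%C
      by (rewrite !RtoC_mult, !RtoC_minus, !RtoC_mult; ring).
    apply Rle_trans with (1 := Cmod_triangle _ _). fold E.
    rewrite !Cmod_mult, Cmod_conj, Cmod_RtoC_pos by nra.
    destruct (HW z Hz Nze) as [_ Q]. assert (P1 := Cmod_ge_0 b). assert (P2 := Cmod_ge_0 (W z)).
    assert (0 <= Cmod b * Cmod (W z) <= 1) by nra. nra. }
  nra.
Qed.

Lemma schwarz_pick_derive : forall (W : C -> C) (e l : C), e <> 0 ->
  (forall z, Cmod z < 1 -> z <> e -> Cdiff W z /\ Cmod (W z) <= 1) ->
  is_derive W (RtoC 0) l -> Cmod l <= 1 - Cmod (W 0) * Cmod (W 0).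
Proof.
  intros W e l Ne HW Hl.
  assert (Cl : Ccont W 0) by now apply is_derive_Ccont with l.
  apply is_derive_slope in Hl. destruct Hl as [k [Hk [<- Ek]]].
  destruct (HW 0 ltac:(rewrite Cmod_0; lra) (not_eq_sym Ne)) as [_ Hb]. assert (P := Cmod_ge_0 (W 0)).
  replace (1 - Cmod (W 0) * Cmod (W 0)) with (Cmod (1 - Cconj (W 0) * W 0)%C).
  2:{ rewrite Cconj_sqr, <- RtoC_minus. apply Cmod_RtoC_pos. nra. }
  apply (Ccont_le_punctured k (fun z => 1 - Cconj (W 0) * W z)%C 0 Hk).
  - apply Ccont_minus; [apply Ccont_const|]. now apply Ccont_mult; [apply Ccont_const|].
  - eapply near_mono; [exact (near_and (near_lt 0 1 ltac:(rewrite Cmod_0; lra)) (near_neq 0 e (not_eq_sym Ne)))|].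
    intros z [Hz Nze] Nz. assert (S := schwarz_pick W e Ne HW z Hz Nze).
    rewrite (Ek z) in S at 1. rewrite Csub_0_r in S.
    replace (W 0 + k z * z - W 0)%C with (z * k z)%C in S by ring. rewrite Cmod_mult in S.
    apply Rmult_le_reg_l with (2 := S). now apply Cmod_gt_0.
Qed.

Lemma schwarz_pick_constant : forall (W : C -> C) (e z : C), e <> 0 ->
  (forall z, Cmod z < 1 -> z <> e -> Cdiff W z /\ Cmod (W z) <= 1) ->
  Cmod (W 0) = 1 -> Cmod z < 1 -> z <> e -> W z = W 0.
Proof.
  intros W e z Ne HW E1 Hz N. assert (S := schwarz_pick W e Ne HW z Hz N).
  assert (E : Cmod (1 - Cconj (W 0) * W z)%C = Cmod (W z - W 0)%C).
  { replace (1 - Cconj (W 0) * W z)%C with (Cconj (W 0) * - (W z - W 0))%C.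
    - rewrite Cmod_mult, Cmod_conj, Cmod_opp, E1. ring.
    - replace (Cconj (W 0) * - (W z - W 0))%C
        with (Cconj (W 0) * W 0 - Cconj (W 0) * W z)%C by ring.
      rewrite Cconj_sqr, E1. now rewrite Rmult_1_l. }
  rewrite E in S. apply Cmod_zero_eq. assert (P := Cmod_ge_0 (W z - W 0)%C). nra.
Qed.

(** * The automorphism of the disc that moves the origin to [p] *)

Definition mob (p : R) (w : C) : C := ((w + RtoC p) / (1 + RtoC p * w))%C.

Definition mob_inv (p : R) (z : C) : C := ((z - RtoC p) / (1 - RtoC p * z))%C.

Lemma RtoC_neq_0 : forall r, r <> 0 -> RtoC r <> 0.
Proof. intros r Hr E. now apply RtoC_inj in E. Qed.

Lemma Cmod_RtoC_lt_1 : forall p, 0 < p < 1 -> Cmod (RtoC p) < 1.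
Proof. intros p Hp. rewrite Cmod_RtoC_pos; lra. Qed.

Lemma one_minus_sqr : forall p, 0 < p < 1 -> (1 - RtoC p * RtoC p)%C <> 0.
Proof. intros p Hp. rewrite <- RtoC_mult, <- RtoC_minus. apply RtoC_neq_0. nra. Qed.

Lemma one_plus_sqr : forall p, 0 < p < 1 -> (1 + RtoC p * RtoC p)%C <> 0.
Proof. intros p Hp. rewrite <- RtoC_mult, <- RtoC_plus. apply RtoC_neq_0. nra. Qed.

Lemma mob_inv_denom : forall p z, 0 < p < 1 -> Cmod z < 1 -> (1 - RtoC p * z)%C <> 0.
Proof.
  intros p z Hp Hz. rewrite <- (Cconj_RtoC p).
  apply blaschke_denom; [now apply Cmod_RtoC_lt_1 | lra].
Qed.

Lemma mob_inv_disc : forall p z, 0 < p < 1 -> Cmod z < 1 -> Cmod (mob_inv p z) < 1.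
Proof.
  intros p z Hp Hz. assert (N := mob_inv_denom p z Hp Hz). unfold mob_inv.
  rewrite Cmod_div by exact N. apply Rlt_div_l; [now apply Cmod_gt_0|]. rewrite Rmult_1_l.
  assert (B := blaschke_lt (RtoC p) z (Cmod_RtoC_lt_1 p Hp) Hz). now rewrite Cconj_RtoC in B.
Qed.

Lemma mob_opp : forall p z, mob p z = (- mob_inv p (- z))%C.
Proof.
  intros p z. unfold mob, mob_inv.
  replace (1 - RtoC p * - z)%C with (1 + RtoC p * z)%C by ring. unfold Cdiv. ring.
Qed.

Lemma mob_denom : forall p w, 0 < p < 1 -> Cmod w < 1 -> (1 + RtoC p * w)%C <> 0.
Proof.
  intros p w Hp Hw. replace (1 + RtoC p * w)%C with (1 - RtoC p * - w)%C by ring.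
  apply mob_inv_denom; [exact Hp | now rewrite Cmod_opp].
Qed.

Lemma mob_disc : forall p w, 0 < p < 1 -> Cmod w < 1 -> Cmod (mob p w) < 1.
Proof.
  intros p w Hp Hw. rewrite mob_opp, Cmod_opp.
  apply mob_inv_disc; [exact Hp | now rewrite Cmod_opp].
Qed.

Lemma mob_mob_inv : forall p z, 0 < p < 1 -> Cmod z < 1 -> mob p (mob_inv p z) = z.
Proof.
  intros p z Hp Hz. assert (N1 := mob_inv_denom p z Hp Hz).
  assert (N3 := one_minus_sqr p Hp). unfold mob, mob_inv.
  replace (1 + RtoC p * ((z - RtoC p) / (1 - RtoC p * z)))%C
    with ((1 - RtoC p * RtoC p) / (1 - RtoC p * z))%C by (field; exact N1).
  field. auto.
Qed.

Lemma mob_inv_mob : forall p w, 0 < p < 1 -> Cmod w < 1 -> mob_inv p (mob p w) = w.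
Proof.
  intros p w Hp Hw. assert (E := mob_mob_inv p (- w) Hp ltac:(now rewrite Cmod_opp)).
  rewrite mob_opp in E. rewrite mob_opp. set (v := mob_inv p (- w)) in *.
  replace w with (- - w)%C by ring. rewrite <- E. ring.
Qed.

Lemma mob_inv_pdisc : forall p z, 0 < p < 1 -> Cmod z < 1 -> z <> RtoC p -> pdisc (mob_inv p z).
Proof.
  intros p z Hp Hz Nz. split; [|now apply mob_inv_disc].
  assert (N := mob_inv_denom p z Hp Hz). unfold mob_inv. rewrite Cmod_div by exact N.
  apply Rdiv_lt_0_compat; [now apply Cmod_sub_pos | now apply Cmod_gt_0].
Qed.

Lemma mob_0 : forall p, mob p 0 = RtoC p.
Proof.
  intros p. unfold mob. replace (1 + RtoC p * 0)%C with (RtoC 1) by ring. field.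
Qed.

Lemma mob_neq_p : forall p w, 0 < p < 1 -> pdisc w -> mob p w <> RtoC p.
Proof.
  intros p w Hp Hw E. apply (pdisc_neq_0 w Hw). rewrite <- (mob_inv_mob p w Hp (proj2 Hw)).
  rewrite E. unfold mob_inv, Cdiv. ring.
Qed.

Lemma mob_derive : forall p w, 0 < p < 1 -> Cmod w < 1 ->
  is_derive (mob p) w ((1 - RtoC p * RtoC p) / ((1 + RtoC p * w) * (1 + RtoC p * w)))%C.
Proof.
  intros p w Hp Hw. assert (N := mob_denom p w Hp Hw). unfold mob, Cdiv.
  eapply Cderive_eq; [cderive; exact N|]. cbv beta. field. exact N.
Qed.

(** * Concave univalent functions *)

(** With the pole divided out, the Laurent coefficients of [f] at [p] become the
    Taylor coefficients of [h]. *)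
Definition numerator (p : R) (f : C -> Csphere) (h : C -> C) : Prop :=
  h (RtoC p) <> 0 /\ forall z, Cmod z < 1 -> Cdiff h z /\
    (z <> RtoC p -> f z = Fin (h z / (z - RtoC p))%C).

Lemma Co_finite_derive : forall p f z, 0 < p < 1 -> Co p f -> Cmod z < 1 -> z <> RtoC p ->
  f z = Fin (finite_part (f z)) /\
  exists l : C, l <> 0 /\ is_derive (fun y => finite_part (f y)) z l.
Proof.
  intros p f z Hp H Hz Nz. destruct (Co_conformal p f H) as [Hinj Hc].
  destruct (Hc z Hz) as [[l [Nl [Hl Dl]]]|[Hpole _]].
  - split; [|exists l; auto].
    assert (Hfz := near_center z _ (proj1 (locally_Cmod z _) Hl)). cbv beta in Hfz.
    destruct (f z); [reflexivity | easy].
  - exfalso. apply Nz. apply Hinj; auto; [now apply Cmod_RtoC_lt_1|].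
    rewrite Hpole. symmetry. apply (Co_pole p f H).
Qed.

Lemma Co_numerator : forall p f, 0 < p < 1 -> Co p f -> exists h, numerator p f h.
Proof.
  intros p f Hp H. set (P := RtoC p).
  destruct (Co_pole p f H) as [_ [g [Hg [Ng Hf]]]].
  apply locally_Cmod in Hg. apply locally'_Cmod in Hf. destruct Hf as [d [Hd Hf]].
  exists (fun z => if Ceq_dec z P then g z else (finite_part (f z) * (z - P))%C).
  split; [destruct (Ceq_dec (RtoC p) P); easy|]. intros z Hz. fold P. split.
  - destruct (Ceq_dec z P) as [->|N].
    + apply Cdiff_ext_loc with (f := g); [|exact (near_center P _ Hg)].
      exists d. split; [exact Hd|]. intros y Hy. destruct (Ceq_dec y P) as [E|N]; [reflexivity|].
      rewrite Hf by (split; [now apply Cmod_sub_pos | exact Hy]). rewrite Cpow_1_r. simpl finite_part.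
      fold P. field. now apply Cminus_eq_contra.
    + apply Cdiff_ext_loc with (f := fun y => (finite_part (f y) * (y - P))%C).
      * apply near_mono with (1 := near_neq z P N). intros y Ny. now destruct (Ceq_dec y P).
      * destruct (Co_finite_derive p f z Hp H Hz N) as [_ [l [_ Hl]]]. cdiff. now exists l.
  - intros N. destruct (Ceq_dec z P) as [E|_]; [easy|].
    rewrite (proj1 (Co_finite_derive p f z Hp H Hz N)) at 1. f_equal.
    field. now apply Cminus_eq_contra.
Qed.

Definition disc_map (p : R) (f : C -> Csphere) (w : C) : C := finite_part (f (mob p w)).

Lemma disc_map_derive : forall p f w (l : C), 0 < p < 1 -> Cmod w < 1 ->
  is_derive (fun y => finite_part (f y)) (mob p w) l ->
  is_derive (disc_map p f) w
    (l * ((1 - RtoC p * RtoC p) / ((1 + RtoC p * w) * (1 + RtoC p * w))))%C.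
Proof.
  intros p f w l Hp Hw Hl.
  exact (Cderive_comp (fun y => finite_part (f y)) (mob p) w _ _ (mob_derive p w Hp Hw) Hl).
Qed.

Definition disc_residue (p : R) (h : C -> C) (w : C) : C :=
  (h (mob p w) * (1 + RtoC p * w) / (1 - RtoC p * RtoC p))%C.

(** [f] composed with [mob p]; the omitted set stays the same. *)
Lemma Co_concave_map : forall p f h, 0 < p < 1 -> Co p f -> numerator p f h ->
  concave_map (disc_map p f) (C_derive (disc_map p f)) (disc_residue p h)
    (fun v => ~ image_of unit_disc f (Fin v)).
Proof.
  intros p f h Hp H [Nh Hh]. assert (N3 := one_minus_sqr p Hp).
  assert (Hw : forall w, pdisc w -> Cmod (mob p w) < 1 /\ mob p w <> RtoC p /\
    f (mob p w) = Fin (disc_map p f w)).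
  { intros w Pw. assert (W1 := mob_disc p w Hp (proj2 Pw)). assert (W2 := mob_neq_p p w Hp Pw).
    split; [exact W1|]. split; [exact W2|]. now apply (Co_finite_derive p f). }
  assert (HD : forall w, pdisc w -> exists l : C, l <> 0 /\ is_derive (disc_map p f) w l).
  { intros w Pw. destruct (Hw w Pw) as [W1 [W2 _]].
    destruct (Co_finite_derive p f (mob p w) Hp H W1 W2) as [_ [l [Nl Hl]]].
    assert (N := mob_denom p w Hp (proj2 Pw)).
    eexists. split; [|apply disc_map_derive; [exact Hp | apply Pw | exact Hl]].
    intros E. apply (Cmult_neq_0 _ _ Nl N3).
    replace (l * (1 - RtoC p * RtoC p))%C with
      (l * ((1 - RtoC p * RtoC p) / ((1 + RtoC p * w) * (1 + RtoC p * w)))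
       * ((1 + RtoC p * w) * (1 + RtoC p * w)))%C by (field; exact N).
    rewrite E. ring. }
  split.
  - apply (Co_concave p f H).
  - intros w Pw. destruct (HD w Pw) as [l [_ Hl]]. now rewrite (is_C_derive_unique _ w l Hl).
  - intros w Pw. destruct (HD w Pw) as [l [Nl Hl]]. now rewrite (is_C_derive_unique _ w l Hl).
  - intros w v Pw Pv E. destruct (Hw w Pw) as [W1 [_ W2]], (Hw v Pv) as [V1 [_ V2]].
    rewrite <- (mob_inv_mob p w), <- (mob_inv_mob p v) by (auto; apply Pw || apply Pv). f_equal.
    apply (proj1 (Co_conformal p f H)); auto. congruence.
  - intros w Pw N. destruct (Hw w Pw) as [W1 [_ W2]]. apply N. now exists (mob p w).
  - intros v Nv. apply NNPP in Nv. destruct Nv as [z [Hz E]].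
    assert (Nz : z <> RtoC p).
    { intros ->. rewrite (proj1 (Co_pole p f H)) in E. easy. }
    exists (mob_inv p z). split; [now apply mob_inv_pdisc|].
    unfold disc_map. rewrite mob_mob_inv by auto. now rewrite E.
  - intros w Pw. unfold disc_residue. cdiff; [|exact N3].
    apply (Cdiff_comp h (mob p)); [eexists; now apply mob_derive|]. now apply Hh, mob_disc.
  - unfold disc_residue. rewrite mob_0. intros E. apply Nh.
    replace (h (RtoC p)) with (h (RtoC p) * (1 + RtoC p * 0) / (1 - RtoC p * RtoC p)
      * (1 - RtoC p * RtoC p))%C by (field; exact N3). rewrite E. ring.
  - intros w Pw. destruct (Hw w Pw) as [W1 [W2 _]]. unfold disc_map, disc_residue.
    rewrite (proj2 (Hh _ W1) W2). simpl finite_part.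
    replace (mob p w - RtoC p)%C with (w * (1 - RtoC p * RtoC p) / (1 + RtoC p * w))%C.
    + field. repeat split; auto; [now apply pdisc_neq_0 | apply mob_denom; [exact Hp | apply Pw]].
    + unfold mob. field. apply mob_denom; [exact Hp | apply Pw].
Qed.

(** For [f z = h z / (z - p)], the function [om] for which
    [f z = (z - p / (1 + p^2) (1 + om z) z^2) / ((1 - z / p) (1 - z p))]. *)
Definition om (p : R) (h : C -> C) (z : C) : C :=
  ((z + h z * (1 - z * RtoC p) / RtoC p) * (1 + RtoC p * RtoC p) / (RtoC p * (z * z)) - 1)%C.

(** [om] in the coordinate of the disc in which the pole is the origin. *)
Definition om_disc (p : R) (h : C -> C) (w : C) : C := om p h (mob p w).

(** [a / b] in the closed disc is taken to [(a + r b) / (b + r a)], again in it. *)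
Lemma Cmod_swap_le : forall (r : R) (a b : C), 0 <= r <= 1 -> Cmod a <= Cmod b ->
  Cmod (RtoC r * b + a)%C <= Cmod (b + RtoC r * a)%C.
Proof.
  intros r a b Hr H.
  assert (E1 := Cmod_sqr (RtoC r * b + a)%C). assert (E2 := Cmod_sqr (b + RtoC r * a)%C).
  assert (Ea := Cmod_sqr a). assert (Eb := Cmod_sqr b).
  assert (P1 := Cmod_ge_0 (RtoC r * b + a)%C). assert (P2 := Cmod_ge_0 (b + RtoC r * a)%C).
  assert (P3 := Cmod_ge_0 a).
  assert (E : Cmod (b + RtoC r * a)%C * Cmod (b + RtoC r * a)%C
              - Cmod (RtoC r * b + a)%C * Cmod (RtoC r * b + a)%C
              = (1 - r * r) * (Cmod b * Cmod b - Cmod a * Cmod a)).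
  { rewrite E1, E2, Ea, Eb. destruct a, b. simpl. ring. }
  assert (0 <= (1 - r * r) * (Cmod b * Cmod b - Cmod a * Cmod a)) by (apply Rmult_le_pos; nra).
  apply Rnot_lt_le. intros L. nra.
Qed.

Lemma mob_neq_0 : forall p w, 0 < p < 1 -> Cmod w < 1 -> w <> RtoC (- p) ->
  (w + RtoC p)%C <> 0 /\ mob p w <> 0.
Proof.
  intros p w Hp Hw N. assert (Nd := mob_denom p w Hp Hw).
  assert (N1 : (w + RtoC p)%C <> 0).
  { intros E. apply N. rewrite RtoC_opp. replace w with (w + RtoC p - RtoC p)%C by ring. rewrite E. ring. }
  split; [exact N1|]. intros E. apply N1.
  replace (w + RtoC p)%C with (mob p w * (1 + RtoC p * w))%C by (unfold mob; field; exact Nd).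
  rewrite E. ring.
Qed.

(** The two-point inequality with the first point at [-p], the preimage of the
    origin, where [F] and its derivative are known. *)
Lemma om_disc_bound : forall p f h s, 0 < p < 1 -> Co p f -> numerator p f h -> pdisc s ->
  s <> RtoC (- p) -> Cmod (om_disc p h s) <= 1.
Proof.
  intros p f h s Hp H Hh Hs Hse. assert (CM := Co_concave_map p f h Hp H Hh).
  set (e := RtoC (- p)) in *. assert (N3 := one_minus_sqr p Hp). assert (N4 := one_plus_sqr p Hp).
  assert (Np : RtoC p <> 0) by (apply RtoC_neq_0; lra).
  assert (Pm : Cmod (RtoC p) = p) by (apply Cmod_RtoC_pos; lra).
  assert (Nd := mob_denom p s Hp (proj2 Hs)). destruct (mob_neq_0 p s Hp (proj2 Hs) Hse) as [Nsp Nz].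
  assert (Ee : e = (- RtoC p)%C) by apply RtoC_opp.
  assert (Em : Cmod e = p) by (rewrite Ee, Cmod_opp; exact Pm).
  assert (Pe : pdisc e) by (split; lra).
  assert (Ns := pdisc_neq_0 s Hs).
  assert (M0 : mob p e = 0).
  { unfold mob. rewrite Ee. replace (- RtoC p + RtoC p)%C with (RtoC 0) by ring. unfold Cdiv. ring. }
  assert (FE : disc_map p f e = 0) by (unfold disc_map; now rewrite M0, (Co_zero p f H)).
  assert (FE' : C_derive (disc_map p f) e = (/ (1 - RtoC p * RtoC p))%C).
  { assert (D := proj2 (Co_derive p f H)). rewrite <- M0 in D.
    rewrite (is_C_derive_unique _ e _ (disc_map_derive p f e 1 Hp (proj2 Pe) D)), Ee.
    replace (1 + RtoC p * - RtoC p)%C with (1 - RtoC p * RtoC p)%C by ring. field. exact N3. }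
  assert (Q := two_point_schwarz CM e s Pe Hs (not_eq_sym Hse)).
  destruct (cayley_bounds _ (two_point_re CM e s Pe Hs (not_eq_sym Hse))) as [NT _].
  assert (Nw := cm_sub_neq_0 CM s e Hs Pe Hse). rewrite FE, Csub_0_r in Nw.
  assert (Eh : h (mob p s) = (disc_map p f s * (s * (1 - RtoC p * RtoC p) / (1 + RtoC p * s)))%C).
  { rewrite (cm_G CM s Hs). unfold disc_residue. field. repeat split; auto. }
  unfold om_disc, om. rewrite Eh. unfold mob in *.
  unfold two_point in Q, NT. rewrite FE, FE', Ee in Q, NT. rewrite Ee in Em.
  set (P := RtoC p) in *. set (w := disc_map p f s) in *. clear Eh.
  (* The Cayley transform of the two-point function is [A / (P B)], and [om] arises
     from [A / (P^2 s B) = a / b] by the fractional linear map of [Cmod_swap_le]. *)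
  set (A := (P * (s + P) + s * (1 - P * P) * w)%C). set (B := ((s + P) - (1 - P * P) * w)%C).
  set (T := (2 * (- P * / (1 - P * P) / (0 - w)) - (- P + s) / (- P - s))%C) in *.
  assert (Nm : (- P - s)%C <> 0).
  { intros E. apply Nsp. replace (s + P)%C with (- (- P - s))%C by ring. rewrite E. ring. }
  assert (N0 : (0 - w)%C <> 0).
  { intros E. apply Nw. replace w with (- (0 - w))%C by ring. rewrite E. ring. }
  assert (ET1 : (T + 1)%C = (2 * A / ((1 - P * P) * w * (s + P)))%C) by (unfold T, A; field; auto).
  assert (ET2 : (T - 1)%C = (2 * P * B / ((1 - P * P) * w * (s + P)))%C) by (unfold T, B; field; auto).
  assert (NB : B <> 0).
  { intros E. apply NT. rewrite ET2, E. unfold Cdiv. ring. }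
  assert (EPhi : cayley T = (A / (P * B))%C).
  { unfold cayley. rewrite ET1, ET2. field. repeat split; auto. }
  assert (PB : 0 < Cmod B) by now apply Cmod_gt_0.
  assert (HA : Cmod (A / P)%C <= Cmod (P * s * B)%C).
  { rewrite EPhi, Em, Cmod_div, Cmod_mult, Pm in Q by now apply Cmult_neq_0.
    rewrite Cmod_div, !Cmod_mult, Pm by exact Np. apply (Rle_div_l _ _ _ (Rmult_lt_0_compat _ _ (proj1 Hp) PB)) in Q.
    apply Rle_div_l; lra. }
  set (a := (A / P)%C) in *. set (b := (P * s * B)%C) in *.
  assert (S := Cmod_swap_le (p * p) a b ltac:(nra) HA).
  rewrite RtoC_mult in S. fold P in S.
  assert (Eden : (b + P * P * a)%C = (P * ((s + P) * (s + P)))%C) by (unfold b, a, A, B; field; exact Np).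
  assert (Nden : (b + P * P * a)%C <> 0) by (rewrite Eden; repeat apply Cmult_neq_0; auto).
  match goal with |- Cmod ?x <= 1 => replace x with ((P * P * b + a) / (b + P * P * a))%C end.
  - rewrite Cmod_div by exact Nden. apply Rle_div_l; [now apply Cmod_gt_0 | lra].
  - rewrite Eden. unfold b, a, A, B. field. repeat split; auto.
Qed.

Lemma om_disc_spec : forall p f h, 0 < p < 1 -> Co p f -> numerator p f h ->
  forall w, Cmod w < 1 -> w <> RtoC (- p) ->
  Cdiff (om_disc p h) w /\ Cmod (om_disc p h w) <= 1.
Proof.
  intros p f h Hp H Hh.
  assert (Np : RtoC p <> 0) by (apply RtoC_neq_0; lra).
  assert (D : forall w, Cmod w < 1 -> w <> RtoC (- p) -> Cdiff (om_disc p h) w).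
  { intros w Hw N. destruct (mob_neq_0 p w Hp Hw N) as [_ Nz].
    apply (Cdiff_comp (om p h) (mob p)); [eexists; now apply mob_derive|].
    assert (Dh := proj1 (proj2 Hh _ (mob_disc p w Hp Hw))). unfold om.
    cdiff; try exact Dh; try exact Np. apply Cmult_neq_0; [exact Np | now apply Cmult_neq_0]. }
  intros w Hw N. split; [auto|].
  destruct (Ceq_dec w 0) as [->|Nw]; [|apply om_disc_bound with f; auto; now apply pdisc_intro].
  rewrite <- Cmod_1.
  apply (Ccont_le_punctured (om_disc p h) (fun _ => RtoC 1)); [now apply Cdiff_cont, D | apply Ccont_const|].
  eapply near_mono; [exact (near_and (near_lt 0 1 Hw) (near_neq 0 _ N))|].
  intros y [Y1 Y2] Ny. rewrite Cmod_1. apply om_disc_bound with f; auto. now apply pdisc_intro.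
Qed.

(** The zeroth Laurent coefficient in terms of [om_disc]: [h p = a_(-1)] and
    [h1 = a_0]. *)
Lemma laurent_om : forall p (h : C -> C) (h1 : C), 0 < p < 1 -> is_derive h (RtoC p) h1 ->
  exists o1 : C, is_derive (om_disc p h) (RtoC 0) o1 /\
    (RtoC ((1 - p ^ 2) / p) * h1 + RtoC ((1 - p ^ 2 + p ^ 4) / (1 - p ^ 4)))%C =
    (RtoC (p ^ 2 * (2 - p ^ 2) / (1 - p ^ 4)) * om_disc p h 0
     + RtoC (p ^ 3 / (1 - p ^ 4)) * o1)%C.
Proof.
  intros p h h1 Hp H1. assert (N3 := one_minus_sqr p Hp). assert (N4 := one_plus_sqr p Hp).
  assert (Np : RtoC p <> 0) by (apply RtoC_neq_0; lra).
  assert (D0 := mob_derive p 0 Hp ltac:(rewrite Cmod_0; lra)).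
  assert (D : is_derive (om p h) (RtoC p)
    (((1 + (h1 * (1 - RtoC p * RtoC p) - h (RtoC p) * RtoC p) / RtoC p) / (RtoC p * (RtoC p * RtoC p))
      - 2 * (RtoC p + h (RtoC p) * (1 - RtoC p * RtoC p) / RtoC p)
        / (RtoC p * (RtoC p * RtoC p * RtoC p))) * (1 + RtoC p * RtoC p))%C).
  { unfold om, Cdiv. eapply Cderive_eq.
    - cderive; [exact H1 | repeat apply Cmult_neq_0; auto].
    - cbv beta. field. auto. }
  rewrite <- (mob_0 p) in D at 1. eexists. split; [exact (Cderive_comp _ _ _ _ _ D0 D)|].
  unfold om_disc. rewrite mob_0.
  assert (Hp4 : 1 - p ^ 4 <> 0).
  { assert (0 < (1 - p * p) * (1 + p * p)) by (apply Rmult_lt_0_compat; nra). lra. }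
  rewrite !RtoC_div, RtoC_mult, !RtoC_plus, !RtoC_minus, !RtoC_pow by (auto; lra).
  unfold om. set (P := RtoC p) in *.
  assert (E4 : (1 - P ^ 4)%C = ((1 - P * P) * (1 + P * P))%C) by (simpl; ring).
  assert (Nd : (1 + P * 0)%C <> 0) by (replace (1 + P * 0)%C with (RtoC 1) by ring; apply C1_nz).
  rewrite E4. clearbody P. simpl. field. repeat split; auto.
Qed.

(** * Laurent coefficients at the pole *)

Lemma is_series_C : forall (t : nat -> C) (v : C),
  is_series (K := C_AbsRing) (V := C_NormedModule) t v <->
  Cconv (fun n => sum_n (G := C_AbelianGroup) t n) v.
Proof.
  intros t v. split.
  - intros H eps He.
    assert (L : locally (T := C_UniformSpace) v (fun y => Cmod (y - v)%C < eps)).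
    { apply locally_Cmod. exists eps. auto. }
    destruct (H _ L) as [N HN]. exists N. exact HN.
  - intros H P HP. apply locally_Cmod in HP. destruct HP as [d [Hd HP]].
    destruct (H d Hd) as [N HN]. exists N. intros n Hn. apply HP. auto.
Qed.

Lemma Cconv_ext : forall u v l, (forall n, u n = v n) -> Cconv u l -> Cconv v l.
Proof.
  intros u v l E H eps He. destruct (H eps He) as [N HN]. exists N. intros n Hn.
  rewrite <- E. auto.
Qed.

Lemma sum_n_Cmult : forall (a : C) (t : nat -> C) n,
  (a * sum_n (G := C_AbelianGroup) t n)%C = sum_n (G := C_AbelianGroup) (fun k => a * t k)%C n.
Proof.
  intros a t n. induction n as [|n IH].
  - now rewrite !sum_O.
  - rewrite !sum_Sn. rewrite <- IH. change plus with Cplus. ring.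
Qed.

Lemma sum_n_Cext : forall (s t : nat -> C) n, (forall k, s k = t k) ->
  sum_n (G := C_AbelianGroup) s n = sum_n (G := C_AbelianGroup) t n.
Proof. intros s t n H. apply sum_n_ext. exact H. Qed.

Lemma Cconv_scal : forall (a : C) u l, Cconv u l -> Cconv (fun n => a * u n)%C (a * l)%C.
Proof.
  intros a u l H. apply (Cconv_cont (fun z => a * z)%C); [|exact H].
  apply Cdiff_cont. cdiff.
Qed.

Lemma taylor_coef_radius : forall f c r1 r2 R0 n, 0 < r1 <= r2 -> r2 < R0 ->
  (forall z : C, Cmod (z - c)%C < R0 -> Cdiff f z) ->
  taylor_coef f c r1 n = taylor_coef f c r2 n.
Proof.
  intros f c r1 r2 R0 n H1 H2 Hf. apply cmean_annulus; [exact H1|]. intros z Hz.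
  cdiff; [apply Hf; lra | |]; apply Cmod_gt_0; lra.
Qed.

Lemma numerator_disc : forall p (z : C), 0 < p < 1 -> Cmod (z - RtoC p)%C < 1 - p -> Cmod z < 1.
Proof.
  intros p z Hp Hz. assert (T := Cmod_rev_triangle z (RtoC p)). rewrite Cmod_RtoC_pos in T; lra.
Qed.

(** The Taylor series of [h], divided by [z - p]. For its sum at [z] a circle
    that encloses [z] is needed, hence [taylor_coef_radius]. *)
Lemma laurent_exists : forall p f h, 0 < p < 1 -> numerator p f h ->
  exists a, is_laurent f (RtoC p) (1 - p) a.
Proof.
  intros p f h Hp [_ Hh]. set (P := RtoC p) in *.
  assert (Dh : forall z : C, Cmod (z - P)%C < 1 - p -> Cdiff h z).
  { intros z Hz. now apply Hh, (numerator_disc p). }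
  exists (fun n => if (n <? -1)%Z then RtoC 0
                   else taylor_coef h P ((1 - p) / 2) (Z.to_nat (n + 1))).
  split.
  - intros n Hn. apply Z.ltb_lt in Hn. now rewrite Hn.
  - intros z [Hz0 Hz1]. exists (h z / (z - P))%C.
    assert (Nz : (z - P)%C <> 0) by now apply Cmod_gt_0.
    split; [apply Hh; [now apply (numerator_disc p) | intros ->; apply Nz; ring]|].
    apply is_series_C. set (r := (Cmod (z - P)%C + (1 - p)) / 2).
    assert (Hr : Cmod (z - P)%C < r < 1 - p) by (unfold r; lra).
    assert (TS := taylor_series h P r (1 - p) z (proj2 Hr) (proj1 Hr) Dh).
    replace (h z / (z - P))%C with (/ (z - P) * h z)%C by (field; exact Nz).
    eapply Cconv_ext; [|apply (Cconv_scal (/ (z - P))%C); exact TS].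
    intros n. cbv beta. rewrite sum_n_Cmult. apply sum_n_Cext. intros k.
    assert (Ek : (Z.of_nat k - 1 <? -1)%Z = false) by (apply Z.ltb_ge; lia).
    rewrite Ek. replace (Z.to_nat (Z.of_nat k - 1 + 1)) with k by lia.
    rewrite (taylor_coef_radius h P ((1 - p) / 2) r (1 - p)) by (auto; unfold r; lra).
    unfold Cdiv. ring.
Qed.

Lemma bounded_terms : forall (t : nat -> C) v,
  Cconv (fun n => sum_n (G := C_AbelianGroup) t n) v -> exists M, 0 <= M /\ forall k, Cmod (t k) <= M.
Proof.
  intros t v H. destruct (Cconv_mod_bounded _ _ H) as [N HN].
  assert (Hfin : exists M, 0 <= M /\ forall k, (k <= N)%nat -> Cmod (t k) <= M).
  { clear HN. induction N as [|N [M [HM0 HM]]].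
    - exists (Cmod (t 0%nat)). split; [apply Cmod_ge_0|]. intros k Hk.
      replace k with 0%nat by lia. lra.
    - exists (Rmax M (Cmod (t (S N)))). split; [apply Rle_trans with (1 := HM0), Rmax_l|].
      intros k Hk. destruct (Nat.eq_dec k (S N)) as [->|Nk]; [apply Rmax_r|].
      apply Rle_trans with (2 := Rmax_l _ _). apply HM. lia. }
  destruct Hfin as [M [HM0 HM]]. exists (M + 2 * (Cmod v + 1)).
  assert (P := Cmod_ge_0 v). split; [lra|]. intros k.
  destruct (le_lt_dec k N) as [L|L]; [specialize (HM k L); lra|].
  destruct k as [|k]; [lia|].
  assert (E : t (S k) = (sum_n (G := C_AbelianGroup) t (S k) - sum_n (G := C_AbelianGroup) t k)%C).
  { rewrite sum_Sn. change plus with Cplus. ring. }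
  rewrite E. apply Rle_trans with (1 := Cmod_sub_triangle _ _).
  assert (H1 := HN (S k) ltac:(lia)). assert (H2 := HN k ltac:(lia)). cbv beta in H1, H2. lra.
Qed.

(** From the second one on, the terms are dominated by a geometric series of ratio
    [|u| / r], at most one half. *)
Lemma power_series_order_2 : forall (b : nat -> C) r M u v, 0 < r ->
  (forall k, Cmod (b k) * r ^ k <= M) -> Cmod u <= r / 2 ->
  Cconv (fun n => sum_n (G := C_AbelianGroup) (fun k => b k * u ^ k)%C n) v ->
  Cmod (v - b 0%nat - b 1%nat * u)%C <= 2 * M / (r * r) * (Cmod u * Cmod u).
Proof.
  intros b r M u v Hr HM Hu H.
  set (q := Cmod u / r). assert (Pu := Cmod_ge_0 u).
  assert (Hq0 : 0 <= q) by (apply Rmult_le_pos; [lra | left; now apply Rinv_0_lt_compat]).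
  assert (Hq : q <= / 2).
  { unfold q. apply (Rmult_le_reg_r r); [exact Hr|]. unfold Rdiv.
    rewrite Rmult_assoc, Rinv_l; lra. }
  assert (HM0 : 0 <= M).
  { apply Rle_trans with (2 := HM 0%nat). simpl. rewrite Rmult_1_r. apply Cmod_ge_0. }
  assert (Hterm : forall k, Cmod (b k * u ^ k)%C <= M * q ^ k).
  { intros k. rewrite Cmod_mult, Cmod_pow. unfold q, Rdiv. rewrite Rpow_mult_distr, pow_inv.
    assert (Hrk : 0 < r ^ k) by now apply pow_lt.
    apply (Rmult_le_reg_r (r ^ k)); [exact Hrk|].
    replace (M * (Cmod u ^ k * / r ^ k) * r ^ k) with (M * Cmod u ^ k) by (field; lra).
    specialize (HM k). assert (0 <= Cmod u ^ k) by now apply pow_le. nra. }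
  assert (Hpart : forall n, Cmod (sum_n (G := C_AbelianGroup) (fun k => b k * u ^ k)%C (S n)
      - b 0%nat - b 1%nat * u)%C <= 2 * M * (q * q) * (1 - (/ 2) ^ n)).
  { induction n as [|n IH].
    - rewrite sum_Sn, sum_O. change plus with Cplus. simpl.
      replace (b 0%nat * 1 + b 1%nat * (u * 1) - b 0%nat - b 1%nat * u)%C with (RtoC 0) by ring.
      rewrite Cmod_0. lra.
    - rewrite sum_Sn. change plus with Cplus. set (S1 := sum_n _ (S n)) in *.
      replace (S1 + b (S (S n)) * u ^ S (S n) - b 0%nat - b 1%nat * u)%C
        with ((S1 - b 0%nat - b 1%nat * u) + b (S (S n)) * u ^ S (S n))%C by ring.
      apply Rle_trans with (1 := Cmod_triangle _ _).
      assert (Ht := Hterm (S (S n))).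
      assert (Hqn : q ^ S (S n) <= q * q * (/ 2) ^ n).
      { replace (q ^ S (S n)) with (q * q * q ^ n) by (simpl; ring).
        apply Rmult_le_compat_l; [nra|]. apply pow_incr. lra. }
      assert (Hmul : M * q ^ S (S n) <= M * (q * q * (/ 2) ^ n)) by now apply Rmult_le_compat_l.
      simpl. simpl in Ht, Hmul. lra. }
  assert (Eq : 2 * M / (r * r) * (Cmod u * Cmod u) = 2 * M * (q * q)) by (unfold q; field; lra).
  rewrite Eq.
  assert (Hlim : Cconv (fun n => sum_n (G := C_AbelianGroup) (fun k => b k * u ^ k)%C (S n)
      - b 0%nat - b 1%nat * u)%C (v - b 0%nat - b 1%nat * u)%C).
  { apply (Cconv_cont (fun z => z - b 0%nat - b 1%nat * u)%C
      (fun n => sum_n (G := C_AbelianGroup) (fun k => b k * u ^ k)%C (S n))).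
    - apply Cdiff_cont. cdiff.
    - apply (Cconv_sub _ v S H). lia. }
  apply Cconv_mod_le with (1 := Hlim) (N := 0%nat). intros n _.
  apply Rle_trans with (1 := Hpart n). assert (0 < (/ 2) ^ n) by (apply pow_lt; lra).
  assert (0 <= 2 * M * (q * q)) by (apply Rmult_le_pos; nra). nra.
Qed.

Lemma quadratic_is_derive : forall (f : C -> C) (w l : C) K,
  near w (fun y => Cmod (f y - f w - l * (y - w))%C <= K * (Cmod (y - w)%C * Cmod (y - w)%C)) ->
  is_derive f w l.
Proof.
  intros f w l K H. apply is_derive_C. intros eps He.
  assert (Q : 0 < eps / (Rabs K + 1)) by (apply Rdiv_lt_0_compat; assert (P := Rabs_pos K); lra).
  eapply near_mono; [exact (near_and H (near_disc w _ Q))|].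
  intros y [H1 H2]. apply Rle_trans with (1 := H1). assert (P := Cmod_ge_0 (y - w)%C).
  rewrite <- Rmult_assoc. apply Rmult_le_compat_r; [exact P|].
  assert (K0 := Rabs_pos K). assert (K1 := Rle_abs K). apply Rlt_div_r in H2; [|lra]. nra.
Qed.

(** The Laurent series of [f], multiplied by [z - p], is a power series with sum
    [h]; its first two coefficients are the value and the derivative of [h]. *)
Lemma laurent_coef_eq : forall p f h (h1 : C), 0 < p < 1 -> numerator p f h ->
  is_derive h (RtoC p) h1 -> laurent_coef p f 0%Z = h1.
Proof.
  intros p f h h1 Hp Hh H1.
  assert (Hl : is_laurent f (RtoC p) (1 - p) (laurent_coef p f)).
  { exact (epsilon_spec (inhabits (fun _ : Z => RtoC 0)) (is_laurent f (RtoC p) (1 - p))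
      (laurent_exists p f h Hp Hh)). }
  set (a := laurent_coef p f) in *. clearbody a. destruct Hl as [_ Hl].
  destruct Hh as [_ Hh]. set (P := RtoC p) in *.
  set (b := fun k : nat => a (Z.of_nat k - 1)%Z).
  assert (Hser : forall u, 0 < Cmod u < 1 - p ->
    Cconv (fun n => sum_n (G := C_AbelianGroup) (fun k => b k * u ^ k)%C n) (h (P + u)%C)).
  { intros u Hu. assert (Eu : (P + u - P)%C = u) by ring.
    assert (Nu : u <> 0) by now apply Cmod_gt_0.
    destruct (Hl (P + u)%C) as [v [Ev Hv]]; [now rewrite Eu|].
    rewrite (proj2 (Hh (P + u)%C ltac:(apply (numerator_disc p); [exact Hp | fold P; rewrite Eu; lra]))) in Ev.
    2:{ intros E. apply Nu. rewrite <- Eu, E. unfold P. ring. }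
    rewrite Eu in Ev, Hv. injection Ev as Ev. apply is_series_C in Hv.
    replace (h (P + u)%C) with (u * v)%C by (rewrite <- Ev; field; exact Nu).
    eapply Cconv_ext; [|apply (Cconv_scal u); exact Hv].
    intros n. cbv beta. rewrite sum_n_Cmult. apply sum_n_Cext. intros k. unfold b. field. exact Nu. }
  set (r := (1 - p) / 2). assert (Hr : 0 < r) by (unfold r; lra).
  assert (Er : Cmod (RtoC r) = r) by (apply Cmod_RtoC_pos; lra).
  destruct (bounded_terms _ _ (Hser (RtoC r) ltac:(rewrite Er; unfold r; lra))) as [M [HM0 HM]].
  assert (HM' : forall k, Cmod (b k) * r ^ k <= M).
  { intros k. specialize (HM k). now rewrite Cmod_mult, Cmod_pow, Er in HM. }
  set (K := 2 * M / (r * r)).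
  assert (Hquad : near P (fun z => z <> P ->
    Cmod (h z - b 0%nat - b 1%nat * (z - P))%C <= K * (Cmod (z - P)%C * Cmod (z - P)%C))).
  { apply near_mono with (1 := near_disc P (r / 2) ltac:(lra)). intros z Hz N.
    assert (Ez : (P + (z - P))%C = z) by ring. rewrite <- Ez at 1.
    apply (power_series_order_2 b r M _ _ Hr HM'); [lra|]. apply Hser.
    split; [now apply Cmod_sub_pos | unfold r in Hz; lra]. }
  assert (Eh : h P = b 0%nat).
  { set (q := fun z => (b 0%nat + b 1%nat * (z - P))%C).
    replace (b 0%nat) with (q P) by (unfold q; ring). apply Cmod_zero_eq. apply Rle_antisym; [|apply Cmod_ge_0].
    replace 0 with (Cmod (RtoC K * ((P - P) * (P - P)))%C).
    2:{ replace (RtoC K * ((P - P) * (P - P)))%C with (RtoC 0) by ring. apply Cmod_0. }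
    apply (Ccont_le_punctured (fun z => h z - q z)%C (fun z => RtoC K * ((z - P) * (z - P)))%C).
    - apply Ccont_minus; [now apply is_derive_Ccont with h1|]. apply Cdiff_cont. unfold q. cdiff.
    - apply Cdiff_cont. cdiff.
    - apply near_mono with (1 := Hquad). intros z Hz N. specialize (Hz N).
      rewrite !Cmod_mult, Cmod_R. replace (h z - q z)%C with (h z - b 0%nat - b 1%nat * (z - P))%C
        by (unfold q; ring).
      apply Rle_trans with (1 := Hz). apply Rmult_le_compat_r; [|apply Rle_abs].
      apply Rmult_le_pos; apply Cmod_ge_0. }
  change (b 1%nat = h1). symmetry.
  apply Cderive_unique with h P; [exact H1|].
  apply quadratic_is_derive with K. apply near_mono with (1 := Hquad). intros z Hz. rewrite Eh.
  destruct (Ceq_dec z P) as [->|N]; [|now apply Hz].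
  rewrite Eh. replace (b 0%nat - b 0%nat - b 1%nat * (P - P))%C with (RtoC 0) by ring.
  rewrite Cmod_sub_diag, Cmod_0. lra.
Qed.

(** * The functions with constant [om] *)

Lemma Csqrt_exists : forall z : C, exists w : C, (w * w)%C = z.
Proof.
  intros [x y]. set (m := Cmod (x, y)).
  assert (Em : m * m = x * x + y * y) by (unfold m; rewrite Cmod_sqr; reflexivity).
  assert (Hx := Cmod_fst (x, y)). simpl in Hx. fold m in Hx. apply Rabs_le_between in Hx.
  set (u := sqrt ((m + x) / 2)). set (v := sqrt ((m - x) / 2)).
  assert (Eu : u * u = (m + x) / 2) by (apply sqrt_sqrt; lra).
  assert (Ev : v * v = (m - x) / 2) by (apply sqrt_sqrt; lra).
  assert (Euv : 2 * (u * v) = Rabs y).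
  { unfold u, v. rewrite <- sqrt_mult by lra.
    replace ((m + x) / 2 * ((m - x) / 2)) with ((y / 2) * (y / 2)).
    - change (y / 2 * (y / 2)) with (Rsqr (y / 2)). rewrite sqrt_Rsqr_abs.
      unfold Rdiv. rewrite Rabs_mult, (Rabs_pos_eq (/ 2)) by lra. field.
    - assert (E : y * y = m * m - x * x) by lra. field_simplify. rewrite <- !Rsqr_pow2.
      unfold Rsqr. lra. }
  destruct (Rle_dec 0 y) as [P|N].
  - exists (u, v). rewrite Rabs_pos_eq in Euv by exact P.
    unfold Cmult. simpl. f_equal; lra.
  - exists (u, - v). rewrite Rabs_left in Euv by lra.
    unfold Cmult. simpl. f_equal; lra.
Qed.

Lemma quadratic_roots : forall x y : C, exists r s : C, (r + s)%C = x /\ (r * s)%C = y.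
Proof.
  intros x y. destruct (Csqrt_exists (x * x - 4 * y)%C) as [d Hd].
  exists ((x + d) / 2)%C, ((x - d) / 2)%C. split; [field|].
  replace ((x + d) / 2 * ((x - d) / 2))%C with ((x * x - d * d) / 4)%C.
  - rewrite Hd. field.
  - field.
Qed.

(** The map of the punctured disc onto the outside of an ellipse or a segment. *)
Definition joukowski (gam w : C) : C := (/ w + gam * w)%C.

(** The omitted set is the image of the closed disc under the real-linear map
    that agrees with [joukowski gam] on the unit circle, where
    [Cconj t = / t]. *)
Lemma joukowski_omitted : forall gam x : C, Cmod gam <= 1 ->
  ((forall w, pdisc w -> joukowski gam w <> x) <->
   exists t : C, Cmod t <= 1 /\ (Cconj t + gam * t)%C = x).
Proof.
  intros gam x Hg. split.
  - intros H. destruct (quadratic_roots x gam) as [r [s [Es Ep]]].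
    (* [1 / r] and [1 / s] are the preimages of [x]. *)
    assert (Hrs : forall r s : C, (r + s)%C = x -> (r * s)%C = gam -> Cmod r <= 1).
    { clear r s Es Ep. intros r s Es Ep. apply Rnot_lt_le. intros L.
      assert (Nr : r <> 0) by (apply Cmod_gt_0; lra).
      assert (P : 0 < / Cmod r) by (apply Rinv_0_lt_compat; lra).
      apply (H (/ r)%C).
      - unfold pdisc. rewrite Cmod_inv by exact Nr. split; [exact P|].
        rewrite <- Rinv_1. apply Rinv_lt_contravar; lra.
      - unfold joukowski. rewrite <- Ep, <- Es. field. exact Nr. }
    assert (Hr := Hrs r s Es Ep).
    assert (Hs : Cmod s <= 1).
    { apply (Hrs s r); [rewrite <- Es; ring | rewrite <- Ep; ring]. }
    assert (Pr := Cmod_ge_0 r). assert (Ps := Cmod_ge_0 s).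
    destruct (Rle_lt_or_eq_dec _ _ Hg) as [L|E].
    + set (D := 1 - Cmod gam * Cmod gam).
      assert (Pg := Cmod_ge_0 gam). assert (HD : 0 < D) by (unfold D; nra).
      assert (ND : RtoC D <> 0) by (apply RtoC_neq_0; lra).
      assert (ED : RtoC D = (1 - Cconj gam * gam)%C).
      { unfold D. rewrite Cconj_sqr, RtoC_minus. reflexivity. }
      (* The real-linear map is invertible. *)
      exists ((Cconj x - Cconj gam * x) / RtoC D)%C. split.
      * assert (Em : Cmod gam = Cmod r * Cmod s) by (rewrite <- Ep; apply Cmod_mult).
        assert (Ex : (Cconj x - Cconj gam * x)%C =
          (Cconj r * RtoC (1 - Cmod s * Cmod s) + Cconj s * RtoC (1 - Cmod r * Cmod r))%C).
        { rewrite !RtoC_minus, <- !Cconj_sqr, <- Es, <- Ep, Cplus_conj, Cmult_conj. ring. }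
        rewrite Ex, Cmod_div, (Cmod_RtoC_pos D) by (auto; lra).
        apply Rle_div_l; [exact HD|].
        apply Rle_trans with (1 := Cmod_triangle _ _).
        rewrite !Cmod_mult, !Cmod_conj, !Cmod_RtoC_pos by nra. unfold D. rewrite Em.
        rewrite Em in L. set (m := Cmod r) in *. set (n := Cmod s) in *.
        assert (E1 : m * (1 - n * n) + n * (1 - m * m) = (m + n) * (1 - m * n)) by ring.
        assert (E2 : 1 * (1 - m * n * (m * n)) = (1 + m * n) * (1 - m * n)) by ring.
        rewrite E1, E2. apply Rmult_le_compat_r; [lra|]. nra.
      * assert (Ec : Cconj ((Cconj x - Cconj gam * x) / RtoC D)%C =
          ((x - gam * Cconj x) / RtoC D)%C).
        { rewrite Cdiv_conj by exact ND.
          rewrite Cminus_conj, Cmult_conj, !Cconj_conj, Cconj_RtoC. reflexivity. }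
        rewrite Ec.
        replace ((x - gam * Cconj x) / RtoC D + gam * ((Cconj x - Cconj gam * x) / RtoC D))%C
          with (x * (1 - Cconj gam * gam) / RtoC D)%C by (field; exact ND).
        rewrite <- ED. field. exact ND.
    + assert (Em : Cmod gam = Cmod r * Cmod s) by (rewrite <- Ep; apply Cmod_mult).
      assert (Er : Cmod r = 1) by nra.
      exists (Cconj r). split; [rewrite Cmod_conj; lra|]. rewrite Cconj_conj, <- Ep, <- Es.
      replace (r * s * Cconj r)%C with (Cconj r * r * s)%C by ring.
      rewrite Cconj_sqr, Er, Rmult_1_l. ring.
  - intros [t [Ht Et]] w Hw E. assert (Nw := pdisc_neq_0 w Hw). destruct Hw as [Hw0 Hw1].
    assert (E1 : (1 - Cconj t * w)%C = (gam * (t - w) * w)%C).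
    { unfold joukowski in E. rewrite <- E in Et.
      replace (1 - Cconj t * w)%C with ((/ w - Cconj t) * w)%C by (field; exact Nw).
      replace (/ w)%C with (Cconj t + gam * t - gam * w)%C by (rewrite Et; ring). ring. }
    assert (B := blaschke_le t w Ht ltac:(lra)).
    assert (E2 : Cmod (1 - Cconj t * w)%C = Cmod gam * Cmod (w - t)%C * Cmod w).
    { rewrite E1, !Cmod_mult. now rewrite (Cmod_sub_sym t). }
    assert (T := Cmod_rev_triangle 1 (Cconj t * w)).
    rewrite Cmod_1, Cmod_mult, Cmod_conj in T.
    assert (P1 := Cmod_ge_0 t). assert (P2 := Cmod_ge_0 gam). assert (P3 := Cmod_ge_0 (w - t)%C).
    set (X := Cmod (1 - Cconj t * w)%C) in *.
    assert (HX : 0 < X) by nra.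
    assert (Cmod gam * Cmod (w - t)%C <= X) by nra. nra.
Qed.

Definition om_constant (p : R) (a z : C) : Csphere :=
  sphere_div (z - RtoC (p / (1 + p ^ 2)) * (1 + a) * z ^ 2)%C
             ((1 - z / RtoC p) * (1 - z * RtoC p))%C.

Section OmConstant.

Context (p : R) (a : C) (Hp : 0 < p < 1) (Ha : Cmod a <= 1).

Let P : C := RtoC p.

Definition om_constant_num (z : C) : C :=
  (- P * (z - P / (1 + P * P) * (1 + a) * (z * z)) / (1 - z * P))%C.

(** The coefficients of the function in the coordinate [mob_inv p z], found by
    partial fractions: see [om_constant_joukowski]. An automorphism of the disc
    takes [a] to [gam]. *)
Let kappa : C :=
  (- (P * P * (1 - a * (P * P))) / ((1 + P * P) * ((1 - P * P) * (1 - P * P))))%C.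

Let gam : C := ((P * P - a) / (1 - a * (P * P)))%C.

Let shift : C := ((1 + P * P * gam) / P)%C.

Lemma om_constant_nz : P <> 0 /\ (1 - P * P)%C <> 0 /\ (1 + P * P)%C <> 0 /\
  (1 - a * (P * P))%C <> 0.
Proof.
  split; [apply RtoC_neq_0; lra|]. split; [now apply one_minus_sqr|].
  split; [now apply one_plus_sqr|].
  assert (T := Cmod_rev_triangle 1 (a * (P * P))).
  assert (Pm : Cmod P = p) by (unfold P; apply Cmod_RtoC_pos; lra).
  rewrite Cmod_1, !Cmod_mult, Pm in T.
  apply Cmod_gt_0. assert (Q := Cmod_ge_0 a). assert (p * p < 1) by nra. nra.
Qed.

Lemma om_constant_kappa : kappa <> 0.
Proof.
  destruct om_constant_nz as [N1 [N2 [N3 N4]]]. intros E.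
  apply (Cmult_neq_0 _ _ (Cmult_neq_0 _ _ N1 N1) N4).
  replace (P * P * (1 - a * (P * P)))%C with (- kappa * ((1 + P * P) * ((1 - P * P) * (1 - P * P))))%C
    by (unfold kappa; field; auto).
  rewrite E. ring.
Qed.

Lemma om_constant_gam : Cmod gam <= 1.
Proof.
  destruct om_constant_nz as [_ [_ [_ N4]]]. unfold gam. rewrite Cmod_div by exact N4.
  apply Rle_div_l; [now apply Cmod_gt_0|]. rewrite Rmult_1_l.
  assert (Hpp : Cmod (RtoC (p * p)) <= 1) by (rewrite Cmod_RtoC_pos; nra).
  assert (B := blaschke_le (RtoC (p * p)) a Hpp Ha).
  rewrite Cconj_RtoC, RtoC_mult in B. fold P in B.
  rewrite Cmod_sub_sym. now replace (a * (P * P))%C with (P * P * a)%C by ring.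
Qed.

Lemma om_constant_denom : forall z, Cmod z < 1 -> (1 - z * P)%C <> 0.
Proof.
  intros z Hz. assert (N := mob_inv_denom p z Hp Hz). fold P in N.
  now replace (z * P)%C with (P * z)%C by ring.
Qed.

Lemma om_constant_fin : forall z, Cmod z < 1 -> z <> P ->
  om_constant p a z = Fin (om_constant_num z / (z - P))%C.
Proof.
  intros z Hz Nz. destruct om_constant_nz as [N1 [_ [N3 _]]].
  assert (N8 := om_constant_denom z Hz). assert (N6 := Cminus_eq_contra _ _ Nz).
  assert (N7 : (P - z)%C <> 0) by (apply Cminus_eq_contra; auto).
  unfold om_constant, sphere_div. fold P. destruct (Ceq_dec _ _) as [E|_].
  - exfalso. apply (Cmult_neq_0 _ _ N7 N8).
    replace ((P - z) * (1 - z * P))%C with (P * ((1 - z / P) * (1 - z * P)))%C by (field; exact N1).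
    rewrite E. ring.
  - f_equal. rewrite RtoC_div, RtoC_plus, RtoC_pow by nra. fold P. unfold om_constant_num. simpl.
    field. repeat split; auto.
Qed.

Lemma om_constant_pole_value : om_constant p a P = Inf.
Proof.
  unfold om_constant, sphere_div. fold P. destruct om_constant_nz as [N1 _].
  destruct (Ceq_dec _ _) as [_|N]; [reflexivity|]. exfalso. apply N. field. exact N1.
Qed.

Lemma om_constant_numerator : forall f, (forall z, unit_disc z -> f z = om_constant p a z) ->
  numerator p f om_constant_num.
Proof.
  intros f Hf. destruct om_constant_nz as [N1 [N2 [N3 N4]]]. fold P. split.
  - intros E. apply (Cmult_neq_0 _ _ (Cmult_neq_0 _ _ N1 N1) N4).
    replace (P * P * (1 - a * (P * P)))%C with (- om_constant_num P * ((1 + P * P) * (1 - P * P)))%C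
      by (unfold om_constant_num; field; auto).
    fold P in E. rewrite E. ring.
  - intros z Hz. split.
    + unfold om_constant_num. cdiff. now apply om_constant_denom.
    + intros N. rewrite (Hf z Hz). now apply om_constant_fin.
Qed.

Lemma om_constant_om : forall z, Cmod z < 1 -> z <> RtoC 0 -> om p om_constant_num z = a.
Proof.
  intros z Hz Nz. destruct om_constant_nz as [N1 [_ [N3 _]]].
  assert (N8 := om_constant_denom z Hz). unfold om, om_constant_num. fold P. field. auto.
Qed.

Lemma om_constant_joukowski : forall z, Cmod z < 1 -> z <> P ->
  om_constant p a z = Fin (kappa * (joukowski gam (mob_inv p z) + shift))%C.
Proof.
  intros z Hz Nz. rewrite om_constant_fin by auto. f_equal.
  destruct om_constant_nz as [N1 [N2 [N3 N4]]].
  assert (N5 := mob_inv_denom p z Hp Hz). fold P in N5. assert (N8 := om_constant_denom z Hz).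
  assert (N6 : (z - P)%C <> 0) by now apply Cminus_eq_contra.
  unfold om_constant_num, kappa, shift, gam, joukowski, mob_inv. fold P. clearbody P.
  field. repeat split; auto.
Qed.

Lemma om_constant_inj : forall z1 z2, Cmod z1 < 1 -> Cmod z2 < 1 ->
  om_constant p a z1 = om_constant p a z2 -> z1 = z2.
Proof.
  intros z1 z2 H1 H2 E. destruct (Ceq_dec z1 P) as [->|N1]; destruct (Ceq_dec z2 P) as [->|N2].
  - reflexivity.
  - rewrite om_constant_pole_value, om_constant_fin in E by auto. easy.
  - rewrite om_constant_pole_value, om_constant_fin in E by auto. easy.
  - rewrite !om_constant_joukowski in E by auto.
    assert (Q1 := mob_inv_pdisc p z1 Hp H1 N1). assert (Q2 := mob_inv_pdisc p z2 Hp H2 N2).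
    rewrite <- (mob_mob_inv p z1), <- (mob_mob_inv p z2) by auto. f_equal.
    set (w1 := mob_inv p z1) in *. set (w2 := mob_inv p z2) in *.
    assert (E1 : (kappa * (joukowski gam w1 + shift))%C = (kappa * (joukowski gam w2 + shift))%C)
      by congruence.
    assert (M1 := pdisc_neq_0 w1 Q1). assert (M2 := pdisc_neq_0 w2 Q2).
    assert (Nk := om_constant_kappa). clearbody w1 w2 kappa shift.
    assert (E2 : ((w1 - w2) * (gam * (w1 * w2) - 1))%C = 0).
    { replace ((w1 - w2) * (gam * (w1 * w2) - 1))%C with
        ((kappa * (joukowski gam w1 + shift) - kappa * (joukowski gam w2 + shift))
          * (w1 * w2) / kappa)%C by (unfold joukowski; field; auto).
      rewrite E1. field. exact Nk. }
    apply Ceq_minus. apply NNPP. intros N. revert E2. apply Cmult_neq_0; [exact N|].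
    assert (T := Cmod_rev_triangle 1 (gam * (w1 * w2))). rewrite Cmod_1, !Cmod_mult in T.
    assert (G := om_constant_gam). destruct Q1 as [A1 B1], Q2 as [A2 B2].
    assert (X1 : 0 < Cmod w1 * Cmod w2) by now apply Rmult_lt_0_compat.
    assert (X2 : Cmod w1 * Cmod w2 < 1) by nra.
    apply Cmod_gt_0. rewrite Cmod_sub_sym. nra.
Qed.

Lemma om_constant_is_derive : forall (g : C -> C) z l, Cmod z < 1 -> z <> P ->
  (forall y, Cmod y < 1 -> y <> P -> om_constant p a y = Fin (g y)) ->
  is_derive g z l -> is_sphere_derive (om_constant p a) z l.
Proof.
  intros g z l Hz Nz Hg Hl.
  assert (Hn : near z (fun y => om_constant p a y = Fin (g y))).
  { eapply near_mono; [exact (near_and (near_lt z 1 Hz) (near_neq z P Nz))|].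
    intros y [Y1 Y2]. auto. }
  split.
  - apply locally_near. apply near_mono with (1 := Hn). intros y Hy. now rewrite Hy.
  - apply Cderive_ext_loc with (2 := Hl). apply near_mono with (1 := Hn). intros y Hy. now rewrite Hy.
Qed.

Lemma om_constant_derive : forall z, Cmod z < 1 -> z <> P ->
  exists l : C, l <> 0 /\ is_sphere_derive (om_constant p a) z l.
Proof.
  intros z Hz Nz. assert (Q := mob_inv_pdisc p z Hp Hz Nz).
  set (w := mob_inv p z) in *. assert (Nw := pdisc_neq_0 w Q).
  assert (N5 := mob_inv_denom p z Hp Hz). destruct om_constant_nz as [_ [N2 _]].
  fold P in N5. assert (Nww : (w * w)%C <> 0) by now apply Cmult_neq_0.
  assert (Dm : is_derive (mob_inv p) z ((1 - P * P) / ((1 - P * z) * (1 - P * z)))%C).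
  { unfold mob_inv, Cdiv. fold P. eapply Cderive_eq; [cderive; exact N5|].
    cbv beta. field. exact N5. }
  assert (Dj : is_derive (fun w => kappa * (joukowski gam w + shift))%C w (kappa * (gam - / (w * w)))%C).
  { unfold joukowski. eapply Cderive_eq; [cderive; exact Nw|]. cbv beta. field. exact Nw. }
  assert (Nj : (kappa * (gam - / (w * w)))%C <> 0).
  { apply Cmult_neq_0; [apply om_constant_kappa|].
    assert (T := Cmod_rev_triangle (/ (w * w)) gam). rewrite Cmod_inv, Cmod_mult in T by exact Nww.
    destruct Q as [Q0 Q1]. assert (G := om_constant_gam).
    assert (1 < / (Cmod w * Cmod w)) by (rewrite <- Rinv_1; apply Rinv_lt_contravar; nra).
    apply Cmod_gt_0. rewrite Cmod_sub_sym. lra. }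
  eexists. split; [|exact (om_constant_is_derive _ z _ Hz Nz om_constant_joukowski
    (Cderive_comp (fun w => kappa * (joukowski gam w + shift))%C (mob_inv p) z _ _ Dm Dj))].
  intros E. apply (Cmult_neq_0 _ _ Nj N2).
  replace (kappa * (gam - / (w * w)) * (1 - P * P))%C with
    (kappa * (gam - / (w * w)) * ((1 - P * P) / ((1 - P * z) * (1 - P * z)))
     * ((1 - P * z) * (1 - P * z)))%C by (clearbody kappa gam; field; auto).
  rewrite E. ring.
Qed.

Lemma om_constant_pole : pole_at (om_constant p a) 1 P.
Proof.
  destruct (om_constant_numerator _ (fun z _ => eq_refl)) as [Nn Hn]. fold P in Nn, Hn.
  split; [apply om_constant_pole_value|]. exists om_constant_num.
  assert (HP : near P (fun y => Cmod y < 1)) by now apply near_lt, Cmod_RtoC_lt_1.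
  split; [|split; [exact Nn|]].
  - apply locally_near. apply near_mono with (1 := HP). intros y Hy. now apply Hn.
  - destruct HP as [d [Hd HP]]. apply locally'_Cmod. exists d. split; [exact Hd|].
    intros y [Y0 Y1]. rewrite Cpow_1_r. apply Hn; [now apply HP|].
    intros ->. rewrite Cmod_sub_diag in Y0. lra.
Qed.

Lemma om_constant_image : forall v,
  image_of unit_disc (om_constant p a) (Fin v) <->
  exists w, pdisc w /\ joukowski gam w = (v / kappa - shift)%C.
Proof.
  intros v. assert (Nk := om_constant_kappa). split.
  - intros [z [Hz E]]. assert (Nz : z <> P).
    { intros ->. rewrite om_constant_pole_value in E. easy. }
    exists (mob_inv p z). split; [now apply mob_inv_pdisc|].
    rewrite om_constant_joukowski in E by auto.
    assert (E' : (kappa * (joukowski gam (mob_inv p z) + shift))%C = v) by congruence.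
    rewrite <- E'. field. exact Nk.
  - intros [w [Hw E]]. exists (mob p w).
    assert (H1 : Cmod (mob p w) < 1) by (apply mob_disc; [exact Hp | apply Hw]).
    split; [exact H1|].
    rewrite om_constant_joukowski by (auto; now apply mob_neq_p).
    rewrite mob_inv_mob by (exact Hp || apply Hw). rewrite E. f_equal. field. exact Nk.
Qed.

(** The omitted set is convex: [joukowski_omitted] describes it as the image of a
    disc under a real-affine map. *)
Lemma om_constant_Co : Co p (om_constant p a).
Proof.
  destruct om_constant_nz as [N1 [N2 [N3 N4]]].
  assert (H0 : Cmod (RtoC 0) < 1) by (rewrite Cmod_0; lra).
  assert (N0 : RtoC 0 <> P) by (intros E; apply N1; now rewrite <- E).
  split.
  - intros z Hz. destruct (Ceq_dec z P) as [->|Nz].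
    + right. exists 1%nat. split; [lia | apply om_constant_pole].
    + left. apply locally_near.
      eapply near_mono; [exact (near_and (near_lt z 1 Hz) (near_neq z P Nz))|].
      intros y [Y1 Y2]. destruct (om_constant_derive y Y1 Y2) as [l [_ Hl]]. now exists l.
  - apply om_constant_pole.
  - rewrite om_constant_fin by auto. f_equal. unfold om_constant_num. field. auto.
  - apply (om_constant_is_derive _ (RtoC 0) (RtoC 1) H0 N0 om_constant_fin).
    unfold om_constant_num, Cdiv. eapply Cderive_eq; [cderive|].
    + now apply om_constant_denom.
    + now apply Cminus_eq_contra.
    + cbv beta. field. auto.
  - split.
    + intros z1 z2 H1 H2. now apply om_constant_inj.
    + intros z Hz. destruct (Ceq_dec z P) as [->|Nz].
      * right. apply om_constant_pole.
      * left. now apply om_constant_derive.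
  - split.
    + intros H. apply H. exists P. split; [now apply Cmod_RtoC_lt_1 | apply om_constant_pole_value].
    + assert (Hom : forall v, ~ image_of unit_disc (om_constant p a) (Fin v) <->
        exists t : C, Cmod t <= 1 /\ (Cconj t + gam * t)%C = (v / kappa - shift)%C).
      { intros v. rewrite om_constant_image.
        rewrite <- (joukowski_omitted gam _ om_constant_gam). split.
        - intros H w Hw E. apply H. now exists w.
        - intros H [w [Hw E]]. now apply (H w). }
      intros x y t Hx Hy Ht. apply Hom in Hx, Hy. apply Hom.
      destruct Hx as [s1 [S1 E1]], Hy as [s2 [S2 E2]].
      assert (Nk := om_constant_kappa).
      exists (RtoC t * s1 + RtoC (1 - t) * s2)%C. split.
      * apply Rle_trans with (1 := Cmod_triangle _ _).
        rewrite !Cmod_mult, !Cmod_RtoC_pos by lra. nra.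
      * rewrite Cplus_conj, !Cmult_conj, !Cconj_RtoC.
        replace (RtoC t * Cconj s1 + RtoC (1 - t) * Cconj s2
                 + gam * (RtoC t * s1 + RtoC (1 - t) * s2))%C
          with (RtoC t * (Cconj s1 + gam * s1) + RtoC (1 - t) * (Cconj s2 + gam * s2))%C by ring.
        rewrite E1, E2, RtoC_minus. field. exact Nk.
Qed.

End OmConstant.

(** * The domain of variability *)

Lemma constant_eq_om : forall p f h a, 0 < p < 1 -> Cmod a <= 1 -> Co p f -> numerator p f h ->
  (forall w, Cmod w < 1 -> w <> RtoC (- p) -> om_disc p h w = a) ->
  forall z, unit_disc z -> f z = om_constant p a z.
Proof.
  intros p f h a Hp Ha H [_ Hh] Ho z Hz. unfold unit_disc in Hz.
  destruct (Ceq_dec z (RtoC p)) as [->|N].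
  { rewrite (om_constant_pole_value p a Hp Ha). apply (Co_pole p f H). }
  destruct (Ceq_dec z 0) as [->|Nz].
  { now rewrite (Co_zero p f H), (Co_zero p _ (om_constant_Co p a Hp Ha)). }
  rewrite (om_constant_fin p a Hp Ha z Hz N), (proj2 (Hh z Hz) N). f_equal. f_equal.
  destruct (om_constant_nz p a Hp Ha) as [N1 [_ [N3 _]]].
  assert (N8 := om_constant_denom p Hp z Hz).
  assert (E := Ho (mob_inv p z) (mob_inv_disc p z Hp Hz)). unfold om_disc in E.
  rewrite mob_mob_inv in E by auto. unfold om_constant_num. rewrite <- E.
  - unfold om. field. auto.
  - intros E'. apply Nz. rewrite <- (mob_mob_inv p z Hp Hz), E'. unfold mob. rewrite RtoC_opp.
    replace (- RtoC p + RtoC p)%C with (RtoC 0) by ring. unfold Cdiv. ring.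
Qed.

Lemma constant_laurent : forall p f a, 0 < p < 1 -> Cmod a <= 1 ->
  (forall z, unit_disc z -> f z = om_constant p a z) ->
  (RtoC ((1 - p ^ 2) / p) * laurent_coef p f 0%Z
   + RtoC ((1 - p ^ 2 + p ^ 4) / (1 - p ^ 4)))%C =
  (RtoC (p ^ 2 * (2 - p ^ 2) / (1 - p ^ 4)) * a)%C.
Proof.
  intros p f a Hp Ha Hf. assert (Hh := om_constant_numerator p a Hp Ha f Hf).
  destruct (proj1 (proj2 Hh _ (Cmod_RtoC_lt_1 p Hp))) as [h1 H1].
  destruct (laurent_om p _ h1 Hp H1) as [o1 [Ho E]].
  rewrite (laurent_coef_eq p f _ h1 Hp Hh H1), E.
  assert (Hc : near 0 (fun w => om_disc p (om_constant_num p a) w = a)).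
  { assert (N0 : RtoC 0 <> RtoC (- p)) by (intros E0; apply RtoC_inj in E0; lra).
    eapply near_mono; [exact (near_and (near_lt 0 1 ltac:(rewrite Cmod_0; lra)) (near_neq _ _ N0))|].
    intros w [W1 W2]. apply om_constant_om; auto; [now apply mob_disc | now apply mob_neq_0]. }
  assert (E1 : o1 = 0).
  { apply Cderive_unique with (1 := Ho). apply Cderive_ext_loc with (f := fun _ => a); [|apply Cderive_const].
    apply near_mono with (1 := Hc). auto. }
  rewrite E1, (near_center _ _ Hc). ring.
Qed.

Lemma sqrt_3_bound : forall p, 0 < p <= sqrt 3 - 1 -> p < 1 /\ 2 * p <= 2 - p * p.
Proof.
  intros p Hp. assert (S := sqrt_sqrt 3 ltac:(lra)). assert (S0 := sqrt_pos 3).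
  split; nra.
Qed.

(** For [om_disc] of modulus [x] at the origin and derivative at most [1 - x^2]
    there; the condition on [p] makes the bound increase with [x] up to
    [x = 1]. *)
Lemma variability_bound : forall p x y, 0 < p < 1 -> 2 * p <= 2 - p * p -> 0 <= x <= 1 ->
  y <= 1 - x * x ->
  p ^ 2 * (2 - p ^ 2) / (1 - p ^ 4) * x + p ^ 3 / (1 - p ^ 4) * y
    <= p ^ 2 * (2 - p ^ 2) / (1 - p ^ 4) /\
  (p ^ 2 * (2 - p ^ 2) / (1 - p ^ 4) * x + p ^ 3 / (1 - p ^ 4) * y
    = p ^ 2 * (2 - p ^ 2) / (1 - p ^ 4) -> x = 1).
Proof.
  intros p x y Hp Hp2 Hx Hy.
  assert (H4 : 0 < 1 - p ^ 4).
  { replace (1 - p ^ 4) with ((1 - p * p) * (1 + p * p)) by ring. apply Rmult_lt_0_compat; nra. }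
  assert (K : 0 < p * p / (1 - p ^ 4)) by (apply Rdiv_lt_0_compat; nra).
  set (S := (1 - x) * (2 - p * p - p * (1 + x)) + p * (1 - x * x - y)).
  assert (E : p ^ 2 * (2 - p ^ 2) / (1 - p ^ 4) -
    (p ^ 2 * (2 - p ^ 2) / (1 - p ^ 4) * x + p ^ 3 / (1 - p ^ 4) * y) =
    p * p / (1 - p ^ 4) * S) by (unfold S; field; lra).
  assert (A1 : 0 <= p * (1 - x * x - y)) by (apply Rmult_le_pos; lra).
  assert (A2 : p * (1 - x) <= 2 - p * p - p * (1 + x)) by lra.
  assert (A3 : 0 <= (1 - x) * (2 - p * p - p * (1 + x))) by (apply Rmult_le_pos; nra).
  split; [assert (0 <= p * p / (1 - p ^ 4) * S) by (apply Rmult_le_pos; unfold S; lra); lra|].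
  intros Eq. assert (S0 : S = 0) by (apply (Rmult_eq_reg_l (p * p / (1 - p ^ 4))); lra).
  apply Rle_antisym; [lra|]. apply Rnot_lt_le. intros L.
  assert (0 < (1 - x) * (2 - p * p - p * (1 + x))) by (apply Rmult_lt_0_compat; nra).
  unfold S in S0. lra.
Qed.

Lemma Cexp_i_surj : forall a : C, Cmod a = 1 -> exists t, 0 <= t <= 2 * PI /\ Cexp_i t = a.
Proof.
  intros [x y] H. assert (E := Cmod_sqr (x, y)). rewrite H in E. simpl in E.
  assert (Hx : -1 <= x <= 1) by (split; nra).
  assert (B := acos_bound x). assert (P := PI_RGT_0).
  assert (S : sqrt (1 - x ^ 2) = Rabs y).
  { replace (1 - x ^ 2) with (Rsqr y) by (unfold Rsqr; simpl; lra). apply sqrt_Rsqr_abs. }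
  destruct (Rle_dec 0 y) as [Py|Ny].
  - exists (acos x). split; [lra|]. unfold Cexp_i. rewrite cos_acos by exact Hx.
    rewrite sin_acos by exact Hx. unfold Rsqr. replace (x * x) with (x ^ 2) by ring.
    rewrite S, Rabs_pos_eq by exact Py. reflexivity.
  - exists (2 * PI - acos x). split; [lra|]. unfold Cexp_i.
    replace (2 * PI - acos x) with (- acos x + 2 * INR 1 * PI) by (simpl; ring).
    rewrite cos_period, sin_period, cos_neg, sin_neg, cos_acos by exact Hx.
    rewrite sin_acos by exact Hx. unfold Rsqr. replace (x * x) with (x ^ 2) by ring.
    rewrite S, Rabs_left by lra. f_equal. ring.
Qed.

Theorem theorem2 :
  forall p : R, 0 < p <= sqrt 3 - 1 ->
  (forall w : C,
     (exists f : C -> Csphere, Co p f /\ laurent_coef p f 0%Z = w) <->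
     Cmod (RtoC ((1 - p ^ 2) / p) * w
           + RtoC ((1 - p ^ 2 + p ^ 4) / (1 - p ^ 4)))%C
       <= p ^ 2 * (2 - p ^ 2) / (1 - p ^ 4)) /\
  (forall f : C -> Csphere, Co p f ->
     (Cmod (RtoC ((1 - p ^ 2) / p) * laurent_coef p f 0%Z
            + RtoC ((1 - p ^ 2 + p ^ 4) / (1 - p ^ 4)))%C
        = p ^ 2 * (2 - p ^ 2) / (1 - p ^ 4) <->
      exists theta : R, 0 <= theta <= 2 * PI /\
        forall z : C, unit_disc z -> f z = extremal_function p theta z)).
Proof.
  intros p Hp0. destruct (sqrt_3_bound p Hp0) as [Hp1 Hp2].
  assert (Hp : 0 < p < 1) by lra.
  assert (H4 : 1 - p ^ 4 = (1 - p * p) * (1 + p * p)) by ring.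
  set (r := p ^ 2 * (2 - p ^ 2) / (1 - p ^ 4)).
  assert (Hr : 0 < r).
  { unfold r. rewrite H4. apply Rdiv_lt_0_compat; apply Rmult_lt_0_compat; nra. }
  assert (Hq : 0 < p ^ 3 / (1 - p ^ 4)).
  { rewrite H4. apply Rdiv_lt_0_compat; [apply pow_lt; lra | apply Rmult_lt_0_compat; nra]. }
  assert (Ne : RtoC (- p) <> 0) by (apply RtoC_neq_0; lra).
  assert (Est : forall f, Co p f -> exists h, numerator p f h /\
    Cmod (RtoC ((1 - p ^ 2) / p) * laurent_coef p f 0%Z
          + RtoC ((1 - p ^ 2 + p ^ 4) / (1 - p ^ 4)))%C <= r /\
    (Cmod (RtoC ((1 - p ^ 2) / p) * laurent_coef p f 0%Z
          + RtoC ((1 - p ^ 2 + p ^ 4) / (1 - p ^ 4)))%C = r ->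
     Cmod (om_disc p h 0) = 1)).
  { intros f H. destruct (Co_numerator p f Hp H) as [h Hh]. exists h. split; [exact Hh|].
    destruct (proj1 (proj2 Hh _ (Cmod_RtoC_lt_1 p Hp))) as [h1 H1].
    destruct (laurent_om p _ h1 Hp H1) as [o1 [Ho E]].
    rewrite (laurent_coef_eq p f _ h1 Hp Hh H1), E. fold r.
    assert (HW := om_disc_spec p f h Hp H Hh).
    assert (S := schwarz_pick_derive (om_disc p h) (RtoC (- p)) o1 Ne HW Ho).
    destruct (HW 0 ltac:(rewrite Cmod_0; lra) (not_eq_sym Ne)) as [_ Hx].
    destruct (variability_bound p _ (Cmod o1) Hp Hp2 (conj (Cmod_ge_0 _) Hx) S) as [V1 V2].
    fold r in V1, V2.
    assert (T : Cmod (RtoC r * om_disc p h 0 + RtoC (p ^ 3 / (1 - p ^ 4)) * o1)%C <=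
      r * Cmod (om_disc p h 0) + p ^ 3 / (1 - p ^ 4) * Cmod o1).
    { apply Rle_trans with (1 := Cmod_triangle _ _). rewrite !Cmod_mult, !Cmod_RtoC_pos; lra. }
    split; [lra|]. intros Eq. apply V2. lra. }
  split.
  - intros w. split.
    + intros [f [H <-]]. destruct (Est f H) as [h [_ [B _]]]. exact B.
    + intros Hw. set (k := RtoC ((1 - p ^ 2) / p)) in *.
      set (q := RtoC ((1 - p ^ 2 + p ^ 4) / (1 - p ^ 4))) in *. set (a := ((k * w + q) / RtoC r)%C).
      assert (Nr : RtoC r <> 0) by (apply RtoC_neq_0; lra).
      assert (Nk : k <> 0).
      { apply RtoC_neq_0. assert (0 < (1 - p ^ 2) / p) by (apply Rdiv_lt_0_compat; nra). lra. }
      assert (Ha : Cmod a <= 1).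
      { unfold a. rewrite Cmod_div, (Cmod_RtoC_pos r) by (auto; lra). apply Rle_div_l; lra. }
      exists (om_constant p a). split; [now apply om_constant_Co|].
      assert (L := constant_laurent p (om_constant p a) a Hp Ha (fun z _ => eq_refl)).
      fold r k q in L. set (l := laurent_coef p (om_constant p a) 0%Z) in *. clearbody l.
      assert (L' : (k * l + q)%C = (k * w + q)%C) by (rewrite L; unfold a; field; exact Nr).
      replace l with ((k * l + q - q) / k)%C by (field; exact Nk). rewrite L'. field. exact Nk.
  - intros f H. split.
    + intros Eq. destruct (Est f H) as [h [Hh [_ B]]]. specialize (B Eq).
      destruct (Cexp_i_surj _ B) as [theta [Ht Et]]. exists theta. split; [exact Ht|].
      change (forall z : C, unit_disc z -> f z = om_constant p (Cexp_i theta) z).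
      apply (constant_eq_om p f h); auto; [rewrite Cmod_Cexp_i; lra|]. intros w Hw Nw. rewrite Et.
      apply schwarz_pick_constant with (RtoC (- p)); auto. now apply om_disc_spec with f.
    + intros [theta [_ Hf]].
      rewrite (constant_laurent p f (Cexp_i theta) Hp ltac:(rewrite Cmod_Cexp_i; lra) Hf), Cmod_mult, Cmod_Cexp_i.
      fold r. rewrite Cmod_RtoC_pos; lra.
Qed.
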